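(* Let $z=(z_1,\dots,z_n)\sim N(0,I_n)$ be a standard normal random vector in $\mathbb{R}^n$. Let $f_1,\dots,f_n:\mathbb{R}^n\to\mathbb{R}$ be functions with $\mathbb{E}[f_i(z)^2]<\infty$ for each $i$, and let $f=(f_1,\dots,f_n)^\top:\mathbb{R}^n\to\mathbb{R}^n$. Consider the identity $$\mathbb{E}\Big[\big(z^\top f(z)-\operatorname{div} f(z)\big)^2\Big]=\mathbb{E}\sum_{i=1}^n f_i(z)^2+\mathbb{E}\sum_{i=1}^n\sum_{j=1}^n\frac{\partial f_i}{\partial x_j}(z)\frac{\partial f_j}{\partial x_i}(z).\qquad(\ast)$$ (i) If each $f_i$ is twice continuously differentiable and its first and second order partial derivatives have sub-exponential growth, then $(\ast)$ holds. (ii) If $f:\mathbb{R}^n\to\mathbb{R}^n$ is $L$-Lipschitz for some $L<+\infty$ (with respect to the Euclidean norm), then $(\ast)$ holds. (iii) If each component $f_i$ belongs to the Gaussian Sobolev space $W^{1,2}(\gamma_n)$, then $(\ast)$ holds.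
   Context: $\operatorname{div} f=\sum_{i=1}^n \partial f_i/\partial x_i$. $\gamma_n$ is the standard Gaussian measure on $\mathbb{R}^n$. $W^{1,2}(\gamma_n)$ is the completion of $C_0^\infty(\mathbb{R}^n)$ (smooth compactly supported real functions) for the norm $\|g\|_{1,2}=\mathbb{E}[g(z)^2]^{1/2}+\mathbb{E}[\|\nabla g(z)\|^2]^{1/2}$, $z\sim N(0,I_n)$; equivalently, it is the set of locally integrable, weakly differentiable $g:\mathbb{R}^n\to\mathbb{R}$ with $\mathbb{E}[g(z)^2]+\mathbb{E}[\|\nabla g(z)\|^2]<\infty$. In (ii) and (iii) derivatives are understood almost everywhere / in the weak sense. A function $g$ has sub-exponential growth if there are constants $C,c$ with $|g(x)|\le C e^{c\|x\|}$ for all $x$. *)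

(* Defs.v *)
From HB Require Import structures.
From mathcomp Require Import all_boot all_order all_algebra.
From mathcomp Require Import all_classical all_reals all_analysis.
Set Implicit Arguments.
Unset Strict Implicit.
Unset Printing Implicit Defensive.
Import Order.TTheory GRing.Theory Num.Theory.
Import numFieldNormedType.Exports.
Local Open Scope classical_set_scope.
Local Open Scope ring_scope.

(* R^n is 'rV[R]_n, whose library norm is the sup norm (equivalent to the
   Euclidean one, so topology, limits and derivatives are the usual ones). *)

Section measurable_row.
Context {R : realType} {n : nat}.

Let coord (i : 'I_n) (x : 'rV[R]_n) : R := x ord0 i.

Let row_set0 : g_sigma_preimage coord set0.
Proof. exact: sigma_algebra0. Qed.

Let row_setC A : g_sigma_preimage coord A -> g_sigma_preimage coord (~` A).
Proof. exact: sigma_algebraC. Qed.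

Let row_bigcup (F : (set 'rV[R]_n)^nat) :
  (forall i, g_sigma_preimage coord (F i)) ->
  g_sigma_preimage coord (\bigcup_i (F i)).
Proof. exact: sigma_algebra_bigcup. Qed.

(* The sigma-algebra on R^n generated by the coordinates, i.e. the Borel one. *)
HB.instance Definition _ := @isMeasurable.Build default_measure_display
  'rV[R]_n (g_sigma_preimage coord) row_set0 row_setC row_bigcup.

End measurable_row.

Section row_measurability.
Context {R : realType}.

Lemma measurable_coord n (i : 'I_n) :
  measurable_fun [set: 'rV[R]_n] (fun x : 'rV[R]_n => x ord0 i).
Proof.
move=> _ Y mY; rewrite setTI; apply: sub_sigma_algebra => /=.
rewrite -bigcup_seq/=; exists i => /=; first by rewrite mem_index_enum.
by exists Y => //; rewrite setTI.
Qed.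

Lemma measurable_fun_row d (T : measurableType d) n (f : T -> 'rV[R]_n) :
  (forall i, measurable_fun [set: T] (fun t => f t ord0 i)) ->
  measurable_fun [set: T] f.
Proof.
move=> mf.
have mg : g_sigma_preimage (fun i t => f t ord0 i) `<=` @measurable _ T.
  apply: smallest_sub; first exact: sigma_algebra_measurable.
  rewrite -bigcup_seq/=; apply: bigcup_sub => i _ A [B mB <-].
  exact: mf.
move=> _ A mA; apply: mg.
rewrite (_ : (fun i t => f t ord0 i) =
  (fun i => (fun x : 'rV[R]_n => x ord0 i) \o f)) //.
by rewrite g_sigma_preimage_comp; exists A.
Qed.

Definition row_cons n (p : measurableTypeR R * 'rV[R]_n) : 'rV[R]_n.+1 :=
  \row_(i < n.+1) oapp (p.2 ord0) p.1 (unlift ord0 i).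

Definition row_uncons n (x : 'rV[R]_n.+1) : measurableTypeR R * 'rV[R]_n :=
  (x ord0 ord0, \row_(i < n) x ord0 (lift ord0 i)).

Lemma row_consK n : cancel (@row_cons n) (@row_uncons n).
Proof.
case=> a v; rewrite /row_uncons /row_cons /= mxE unlift_none/=.
by congr pair; apply/rowP => i; rewrite !mxE liftK.
Qed.

Lemma row_unconsK n : cancel (@row_uncons n) (@row_cons n).
Proof.
move=> x; apply/rowP => i; rewrite mxE.
by case: unliftP => [j|] -> //=; rewrite mxE.
Qed.

Lemma measurable_row_cons n : measurable_fun [set: measurableTypeR R * 'rV[R]_n] (@row_cons n).
Proof.
apply: measurable_fun_row => i; under eq_fun do rewrite mxE.
case: unliftP => [j|] _ /=; last exact: measurable_fst.
exact: (measurableT_comp (measurable_coord j) measurable_snd).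
Qed.

Lemma measurable_row_uncons n :
  measurable_fun [set: 'rV[R]_n.+1] (@row_uncons n).
Proof.
apply: measurable_fun_pair; first exact: measurable_coord.
apply: measurable_fun_row => i; under eq_fun do rewrite mxE.
exact: measurable_coord.
Qed.

End row_measurability.

Section row_cons_measure.
Local Open Scope ereal_scope.
Context {R : realType} {n : nat}.
Variables (mu : {sigma_finite_measure set (measurableTypeR R) -> \bar R})
  (nu : {sigma_finite_measure set 'rV[R]_n -> \bar R}).

Definition row_cons_measure : set 'rV[R]_n.+1 -> \bar R :=
  pushforward (mu \x nu) (@row_cons R n).

Let row_cons_measure0 : row_cons_measure set0 = 0.
Proof. by rewrite /row_cons_measure /pushforward preimage_set0 measure0. Qed.

Let row_cons_measure_ge0 A : 0 <= row_cons_measure A.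
Proof. by rewrite /row_cons_measure /pushforward measure_ge0. Qed.

Let row_cons_measure_sigma_additive : semi_sigma_additive row_cons_measure.
Proof.
have mp A : measurable A -> measurable (@row_cons R n @^-1` A).
  by move=> mA; rewrite -[X in measurable X]setTI; exact: measurable_row_cons.
move=> F mF tF mUF; rewrite /row_cons_measure /pushforward preimage_bigcup.
apply: measure_semi_sigma_additive.
- by move=> i; exact: mp.
- apply/trivIsetP => /= i j _ _ ij; rewrite -preimage_setI.
  by move/trivIsetP : tF => /(_ _ _ _ _ ij) ->//; rewrite preimage_set0.
- by rewrite -preimage_bigcup; exact: mp.
Qed.

HB.instance Definition _ := isMeasure.Build _ _ _ row_cons_measure
  row_cons_measure0 row_cons_measure_ge0 row_cons_measure_sigma_additive.

Let row_cons_measure_sigma_finite : sigma_finite setT row_cons_measure.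
Proof.
have mf := @measurable_row_uncons R n.
have /sigma_finiteP[F [TF ndF Foo]] := sigma_finiteT mu.
have /sigma_finiteP[G [TG ndG Goo]] := sigma_finiteT nu.
exists (fun i => @row_uncons R n @^-1` (F i `*` G i)).
  rewrite -preimage_bigcup (_ : \bigcup_i _ = setT) ?preimage_setT//.
  rewrite -setXTT TF TG; apply/seteqP; split => [[x y]|[x y]].
    by move=> [i _ []/= ? ?]; split; exists i.
  move=> [/= [i _ Fix] [k _ Gky]]; exists (maxn i k) => //; split.
  - by move: x Fix; exact/subsetPset/ndF/leq_maxl.
  - by move: y Gky; exact/subsetPset/ndG/leq_maxr.
move=> i; have [mF Fi] := Foo i; have [mG Gi] := Goo i; split.
  rewrite -[X in measurable X]setTI.
  by apply: mf => //; exact: measurableX.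
rewrite /row_cons_measure /pushforward -comp_preimage.
rewrite (_ : _ \o _ = id); last by apply/funext => x; exact: row_consK.
rewrite preimage_id product_measure1E//.
by rewrite lte_mul_pinfty// ge0_fin_numE.
Qed.

HB.instance Definition _ := Measure_isSigmaFinite.Build _ _ _
  row_cons_measure row_cons_measure_sigma_finite.

End row_cons_measure.

Fixpoint power_measure {R : realType}
    (mu : {sigma_finite_measure set (measurableTypeR R) -> \bar R}) (n : nat) :
    {sigma_finite_measure set 'rV[R]_n -> \bar R} :=
  match n with
  | 0 => \d_(0 : 'rV[R]_0)
  | m.+1 => row_cons_measure mu (power_measure mu m)
  end.

Lemma power_measureE {R : realType}
    (mu : {sigma_finite_measure set (measurableTypeR R) -> \bar R}) (n : nat)
    (A : 'I_n -> set R) : (forall i, measurable (A i)) ->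
  power_measure mu n [set x | forall i, A i (x ord0 i)] =
  (\prod_(i < n) mu (A i))%E.
Proof.
elim: n A => [|n IH] A mA.
  rewrite big_ord0 /= diracE mem_set//=; by case.
have mB : measurable
    [set x : 'rV[R]_n | forall i, A (lift ord0 i) (x ord0 i)].
  rewrite (_ : [set x | _] = \bigcap_(i in [set: 'I_n])
      ((fun x : 'rV[R]_n => x ord0 i) @^-1` A (lift ord0 i))).
    apply: fin_bigcap_measurable => // i _.
    rewrite -[X in measurable X]setTI; exact: measurable_coord.
  by apply/seteqP; split => [x Ax i _|x Ax i]; exact: Ax.
rewrite big_ord_recl /= /row_cons_measure /pushforward.
rewrite (_ : _ @^-1` _ = A ord0 `*`
    [set x : 'rV[R]_n | forall i, A (lift ord0 i) (x ord0 i)]).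
  have -> := @product_measure1E _ _ (measurableTypeR R) 'rV[R]_n R
    mu (power_measure mu n) _ _ (mA ord0) mB.
  congr (_ * _)%E.
  by apply: (IH (fun i => A (lift ord0 i))).
apply/seteqP; split => [[a v] /= Aav|[a v] /= [Aa Av] i].
  split=> [|i]; first by have := Aav ord0; rewrite mxE unlift_none.
  by have := Aav (lift ord0 i); rewrite mxE liftK.
by rewrite mxE; case: unliftP => [j|] ->.
Qed.

Definition lebesgue_row (R : realType) (n : nat) :
    {sigma_finite_measure set 'rV[R]_n -> \bar R} :=
  power_measure (@lebesgue_measure R) n.

(* The standard Gaussian measure N(0, I_n). *)
Definition gauss_row (R : realType) (n : nat) :
    {sigma_finite_measure set 'rV[R]_n -> \bar R} :=
  power_measure (normal_prob (0 : R) 1) n.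

Section analysis_row.
Context {R : realType} {n : nat}.
Implicit Types (x : 'rV[R]_n) (g h : 'rV[R]_n -> R).

Definition enorm x : R := Num.sqrt (\sum_(i < n) x ord0 i ^+ 2).

Definition partial (j : 'I_n) g x : R := 'D_(delta_mx ord0 j) g x.

Definition grad g x : 'rV[R]_n := \row_(j < n) partial j g x.

Fixpoint Cclass (k : nat) g : Prop :=
  match k with
  | 0 => continuous g
  | m.+1 => (forall x, differentiable g x) /\
            (forall j, Cclass m (partial j g))
  end.

Definition test_function g : Prop :=
  (forall k, Cclass k g) /\ compact (closure [set x | g x != 0]).

Definition subexponential g : Prop :=
  exists C c : R, forall x, `|g x| <= C * expR (c * enorm x).

Definition lipschitz_enorm (L : R) (F : 'rV[R]_n -> 'rV[R]_n) : Prop :=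
  forall x y, enorm (F x - F y) <= L * enorm (x - y).

Definition locally_integrable_row g : Prop :=
  measurable_fun [set: 'rV[R]_n] g /\
  forall K : set 'rV[R]_n, compact K ->
    (\int[lebesgue_row R n]_(x in K) `|g x|%:E < +oo)%E.

Definition weak_partial (j : 'I_n) g h : Prop :=
  [/\ locally_integrable_row g, locally_integrable_row h &
    forall phi, test_function phi ->
      (\int[lebesgue_row R n]_x (g x * partial j phi x)%:E =
       - \int[lebesgue_row R n]_x (h x * phi x)%:E)%E].

(* The norm ||.||_{1,2} for differentiable functions. *)
Definition sobolev_norm g : \bar R :=
  ('N[gauss_row R n]_2%:E[EFin \o g] +
   'N[gauss_row R n]_2%:E[EFin \o (fun x => enorm (grad g x))])%E.

(* The completion of the test functions for [sobolev_norm], realized inside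
   L^2: g belongs to it iff it is the L^2-limit of a [sobolev_norm]-Cauchy
   sequence of test functions. *)
Definition gauss_sobolev g : Prop :=
  measurable_fun [set: 'rV[R]_n] g /\
  exists phi : nat -> 'rV[R]_n -> R,
    [/\ forall k, test_function (phi k),
        forall e : R, 0 < e -> exists N, forall k l, (N <= k)%N -> (N <= l)%N ->
          (sobolev_norm (phi k \- phi l)%R < e%:E)%E
      & 'N[gauss_row R n]_2%:E[EFin \o (phi k \- g)%R]%E @[k --> \oo] --> 0%E].

End analysis_row.

(* The identity for f with D i j standing for the partial derivative of f i
   along x_j. The first expectation on the right is of a nonnegative function
   and so is the left-hand side; the integrability clause says that the
   remaining, signed, expectation exists. *)
Definition second_order_stein {R : realType} {n : nat} {d : measure_display}
    {Omega : measurableType d} (P : probability Omega R)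
    (z : Omega -> 'rV[R]_n) (f : 'I_n -> 'rV[R]_n -> R)
    (D : 'I_n -> 'I_n -> 'rV[R]_n -> R) : Prop :=
  P.-integrable [set: Omega] (EFin \o
    (fun w => \sum_(i < n) \sum_(j < n) D i j (z w) * D j i (z w))) /\
  ('E_P[(fun w => (\sum_(i < n) z w ord0 i * f i (z w)
                  - \sum_(i < n) D i i (z w)) ^+ 2)%R] =
   'E_P[(fun w => \sum_(i < n) f i (z w) ^+ 2)%R] +
   'E_P[(fun w => \sum_(i < n) \sum_(j < n)
                    D i j (z w) * D j i (z w))%R])%E.

(* Main.v *)
(* The Cameron-Martin shift along a coordinate,
   E[g(z + t e_j)] = E[g(z) exp(t z_j - t^2/2)], gives at t -> 0 the Stein
   identity E[D_j f] = E[z_j f] for every f of exponential growth that is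
   locally Lipschitz along the coordinates and a.e. differentiable there.
   Write delta_i f = x_i f - D_i f.  Integrating by parts in
   E[delta_i f * delta_j g] leaves the term E[delta_i f * D_j g], which must be
   exchanged with E[delta_j f * D_i g]; replacing D_j g by a difference quotient
   and moving the shift onto f with Cameron-Martin does this without second
   derivatives.  Hence
     E[delta_i f * delta_j g] = 1_(i = j) E[f g] + E[D_j f * D_i g],
   and summing over i, j yields the identity.

   (i) is a direct instance.  (ii) follows from Rademacher's theorem on
   coordinate lines and Fubini.  On the line, a nondecreasing function whose
   increments are at most those of the identity has a Stieltjes measure
   dominated by Lebesgue's, hence is the integral of a density and is a.e.
   differentiable.  For (iii), the identity applied to differences of test
   functions f_k shows that sum_i delta_i f_k,i is Cauchy in L^2, so both sides
   pass to the limit; the L^2 limits of the partial derivatives are weak partial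
   derivatives by integration by parts, and these are a.e. unique, because
   products of smooth bumps converge boundedly to indicators of open boxes. *)

From HB Require Import structures.
From mathcomp Require Import all_boot all_order all_algebra.
From mathcomp Require Import all_classical all_reals all_analysis.
From mathcomp Require Import measurable_realfun.
From mathcomp Require Import ring lra.
Require Import Defs.
Set Implicit Arguments.
Unset Strict Implicit.
Unset Printing Implicit Defensive.
Import Order.TTheory GRing.Theory Num.Theory.
Import numFieldNormedType.Exports.
Local Open Scope classical_set_scope.
Local Open Scope ring_scope.

(** * Iterated integrals over R^n and Gaussian translation *)

(** All three cases meet in one predicate, [reg f D]: exponential growth, difference quotients
    bounded exponentially and uniformly for steps of size at most 1, and [D j] a version of the j-th
    derivative valid only almost everywhere. This is weak enough for Lipschitz functions, yet closed
    under products, translations and difference quotients, the operations that the integration by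
    parts consumes. Exponential growth is the natural scale: the Cameron-Martin weights are
    themselves exponentials of a coordinate, and one exponential bound dominates each limit t -> 0.
    Case (iii) is reached only by closure. There the term of indefinite sign is handled by D_j f_i *
    D_i f_j <= ((D_j f_i)^2 + (D_i f_j)^2) / 2, so the sum of the delta_i f_i is controlled by the
    Sobolev norm without estimating any x_i f_i separately. Since (iii) quantifies over every choice
    of weak derivatives, the L^2 limits must also be compared with an arbitrary choice, which is
    where uniqueness enters. *)

Section lebesgue_translation.
Local Open Scope ereal_scope.
Context {R : realType}.
Local Notation mu := (@lebesgue_measure R).

Let measurable_shift (h : R) : measurable_fun [set: measurableTypeR R] (fun x : measurableTypeR R => (x + h)%R : measurableTypeR R).
Proof. by apply: measurable_funD. Qed.

(** A measure that gives each half-open interval its length is Lebesgue measure, and translation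
    preserves these lengths. *)
Lemma lebesgue_measure_shift (h : R) (A : set R) : measurable A ->
  mu A = pushforward mu (fun x : measurableTypeR R => (x + h)%R : measurableTypeR R) A.
Proof.
move=> mA.
pose m : {measure set (measurableTypeR R) -> \bar R} := measure_function_pushforward__canonical__measure_function_Measure mu (measurable_shift h).
rewrite -[RHS]/(m A); apply: lebesgue_measure_unique => // X [[a b] _ <-].
rewrite /m /= /pushforward.
rewrite (_ : _ @^-1` _ = `](a - h)%R, (b - h)%R]%classic); last first.
  by apply/seteqP; split => x /=; rewrite !in_itv/= ltrBlDr lerBrDr.
by rewrite !lebesgue_measure_itv/= !lte_fin ltrD2r -!EFinB; case: ifPn => // _; congr EFin; ring.
Qed.

Lemma ge0_integral_lebesgue_shift (h : R) (g : measurableTypeR R -> \bar R) :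
  measurable_fun [set: measurableTypeR R] g -> (forall x, 0 <= g x) ->
  \int[mu]_x g (x + h)%R = \int[mu]_x g x.
Proof.
move=> mg g0.
have := @ge0_integral_pushforward _ _ _ (measurableTypeR R) R _ (measurable_shift h) mu setT g measurableT mg (fun y _ => g0 y).
rewrite preimage_setT => <-.
apply: eq_measure_integral => A mA _.
by rewrite [RHS](lebesgue_measure_shift h mA).
Qed.

(** Integration goes through the Radon-Nikodym derivative of [normal_prob]; that derivative equals
    [normal_pdf] almost everywhere because both have the same integral over every measurable set. *)
Lemma ge0_integral_normal (f : measurableTypeR R -> \bar R) :
  measurable_fun [set: measurableTypeR R] f -> (forall x, 0 <= f x) ->
  \int[normal_prob (0 : R) 1]_x f x = \int[mu]_x (f x * (normal_pdf 0 1 x)%:E).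
Proof.
move=> mf f0.
have numu := @normal_prob_dominates R 0 1.
rewrite -(Radon_Nikodym_SigmaFinite.change_of_variables numu)//.
have fint := Radon_Nikodym_SigmaFinite.f_integrable numu.
apply: ge0_ae_eq_integral => //.
- by apply: emeasurable_funM => //; exact: measurable_int fint.
- by apply: emeasurable_funM => //; apply/measurable_EFinP; exact: measurable_normal_pdf.
- by move=> x _; rewrite mule_ge0// Radon_Nikodym_SigmaFinite.f_ge0.
- by move=> x _; rewrite mule_ge0// lee_fin normal_pdf_ge0.
- apply: ae_eqe_mul2l; apply: integral_ae_eq => //.
  + by apply/measurable_EFinP; exact: measurable_normal_pdf.
  + by move=> A _ mA; rewrite -Radon_Nikodym_SigmaFinite.f_integral.
Qed.

End lebesgue_translation.

Section row_fubini.
Local Open Scope ereal_scope.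
Context {R : realType}.
Implicit Types mu : {sigma_finite_measure set (measurableTypeR R) -> \bar R}.

Definition upd n (j : 'I_n) (t : R) (x : 'rV[R]_n) : 'rV[R]_n :=
  \row_i (if i == j then t else x ord0 i).

Lemma updE n (j i : 'I_n) t x : upd j t x ord0 i = if i == j then t else x ord0 i.
Proof. by rewrite mxE. Qed.

Lemma row_cons0 n a (v : 'rV[R]_n) : row_cons (a, v) ord0 ord0 = a.
Proof. by rewrite mxE unlift_none. Qed.

Lemma row_consS n a (v : 'rV[R]_n) i : row_cons (a, v) ord0 (lift ord0 i) = v ord0 i.
Proof. by rewrite mxE liftK. Qed.

Lemma upd_cons0 n t a (v : 'rV[R]_n) : upd ord0 t (row_cons (a, v)) = row_cons (t, v).
Proof.
apply/rowP => i; rewrite updE; case: (unliftP ord0 i) => [j|] ->.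
  by rewrite !row_consS.
by rewrite eqxx row_cons0.
Qed.

Lemma upd_consS n (j : 'I_n) t a (v : 'rV[R]_n) :
  upd (lift ord0 j) t (row_cons (a, v)) = row_cons (a, upd j t v).
Proof.
apply/rowP => i; rewrite updE; case: (unliftP ord0 i) => [k|] ->.
  by rewrite !row_consS (inj_eq lift_inj) updE.
by rewrite !row_cons0.
Qed.

Lemma measurable_row_cons1 n (v : 'rV[R]_n) :
  measurable_fun [set: measurableTypeR R] (fun a : measurableTypeR R => row_cons (a, v)).
Proof. by apply: measurableT_comp; [exact: measurable_row_cons|exact: pair2_measurable]. Qed.

Lemma measurable_row_cons2 n (a : measurableTypeR R) :
  measurable_fun [set: 'rV[R]_n] (fun v => row_cons (a, v)).
Proof. by apply: measurableT_comp; [exact: measurable_row_cons|exact: pair1_measurable]. Qed.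

Lemma ge0_integral_row1 mu n (g : 'rV[R]_n.+1 -> \bar R) :
  measurable_fun [set: 'rV[R]_n.+1] g -> (forall x, 0 <= g x) ->
  \int[power_measure mu n.+1]_x g x =
  \int[mu]_a \int[power_measure mu n]_v g (row_cons (a, v)).
Proof.
move=> mg g0 /=.
rewrite ge0_integral_pushforward//; last exact: measurable_row_cons.
rewrite preimage_setT fubini_tonelli1//.
  by apply: measurableT_comp => //; exact: measurable_row_cons.
by move=> x; exact: g0.
Qed.

Lemma ge0_integral_row2 mu n (g : 'rV[R]_n.+1 -> \bar R) :
  measurable_fun [set: 'rV[R]_n.+1] g -> (forall x, 0 <= g x) ->
  \int[power_measure mu n.+1]_x g x =
  \int[power_measure mu n]_v \int[mu]_a g (row_cons (a, v)).
Proof.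
move=> mg g0 /=.
rewrite ge0_integral_pushforward//; last exact: measurable_row_cons.
rewrite preimage_setT fubini_tonelli2//.
  by apply: measurableT_comp => //; exact: measurable_row_cons.
by move=> x; exact: g0.
Qed.

(** Fubini along coordinate j without naming the integral over the other coordinates. Induction
    peels off coordinate 0 as the outer integral when j lies in the tail, and as the inner one when
    j = 0. *)
Lemma eq_ge0_integral_upd mu n (j : 'I_n) (u v : 'rV[R]_n -> \bar R) :
  measurable_fun [set: 'rV[R]_n] u -> (forall x, 0 <= u x) ->
  measurable_fun [set: 'rV[R]_n] v -> (forall x, 0 <= v x) ->
  (forall x, \int[mu]_t u (upd j t x) = \int[mu]_t v (upd j t x)) ->
  \int[power_measure mu n]_x u x = \int[power_measure mu n]_x v x.
Proof.
elim: n j u v => [[]//|n IH] j u v mu' u0 mv v0 uv.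
case: (unliftP ord0 j) uv => [k ->|->] uv.
  rewrite (ge0_integral_row1 mu mu' u0) (ge0_integral_row1 mu mv v0); apply: eq_integral => a _.
  apply: (IH k) => //.
  - by apply: measurableT_comp => //; exact: measurable_row_cons2.
  - by apply: measurableT_comp => //; exact: measurable_row_cons2.
  - move=> x; have := uv (row_cons (a, x)).
    by under eq_integral do rewrite upd_consS; under [in RHS]eq_integral do rewrite upd_consS.
rewrite (ge0_integral_row2 mu mu' u0) (ge0_integral_row2 mu mv v0); apply: eq_integral => x _.
(* The entry 0 is a placeholder that [upd ord0] overwrites. *)
have := uv (row_cons (0%R, x)).
by under eq_integral do rewrite upd_cons0; under [in RHS]eq_integral do rewrite upd_cons0.
Qed.

End row_fubini.

(** * Open sets and continuous functions are measurable for the coordinate sigma-algebra *)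

Section row_open.
Context {R : realType} {n : nat}.
Implicit Types x : 'rV[R]_n.

Lemma measurable_row_coord (B : 'I_n -> set R) : (forall i, measurable (B i)) ->
  measurable [set x : 'rV[R]_n | forall i, B i (x ord0 i)].
Proof.
move=> mB; rewrite (_ : [set x | _] = \bigcap_(i in [set: 'I_n])
    ((fun x : 'rV[R]_n => x ord0 i) @^-1` B i)).
  apply: fin_bigcap_measurable => // i _.
  rewrite -[X in measurable X]setTI; exact: measurable_coord.
by apply/seteqP; split => [x Ax i _|x Ax i]; exact: Ax.
Qed.

(** Grid cube of side 1 / (q.1 + 1) with corner q.2 / (q.1 + 1), written without division; the index
    type is countable. *)
Let cell (q : nat * 'rV[int]_n) : set 'rV[R]_n :=
  [set x | forall i, (x ord0 i * q.1.+1%:R) \in `[(q.2 ord0 i)%:~R, (q.2 ord0 i + 1)%:~R[].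

Let measurable_cell q : measurable (cell q).
Proof.
apply: (measurable_row_coord (B := fun i => [set t | (t * q.1.+1%:R) \in `[(q.2 ord0 i)%:~R, (q.2 ord0 i + 1)%:~R[])) => i.
rewrite [X in measurable X](_ : _ = setT `&` (fun t => t * q.1.+1%:R) @^-1` `[(q.2 ord0 i)%:~R, (q.2 ord0 i + 1)%:~R[%classic); last first.
  by rewrite setTI.
exact: measurable_funM.
Qed.

(** The sigma-algebra is generated by the coordinates, so open sets must be reached by countable
    operations: an open set is the union of the grid cubes that it contains. *)
Lemma open_measurable_row (U : set 'rV[R]_n) : open U -> measurable U.
Proof.
move=> oU.
rewrite (_ : U = \bigcup_q (if `[< cell q `<=` U >] then cell q else set0)); last first.
  apply/seteqP; split => [x Ux|x [q] /= _]; last first.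
    by case: ifPn => [/asboolP qU /qU|].
  have /nbhs_ballP[e /= e0 eU] : nbhs x U by exact: open_nbhs_nbhs.
  (* The mesh is finer than the radius e, so the cube containing x stays inside the sup-norm ball
     around x. *)
  pose k := Num.trunc (e^-1).
  have ke : k.+1%:R^-1 < e.
    by rewrite invf_plt ?posrE// truncnS_gt.
  pose q := (k, \row_i Num.floor (x ord0 i * k.+1%:R)) : nat * 'rV[int]_n.
  have xq : cell q x by move=> i /=; rewrite mxE in_itv/= floor_itv.
  exists q => //; case: ifPn => // /negP; apply: contra_notP => _.
  apply/asboolP => y yq; apply: eU; split => // a i; have -> : a = ord0 by exact: ord1.
  have k0 : 0 < k.+1%:R :> R by [].
  apply: lt_trans ke; rewrite /ball/=.
  have := xq i; have := yq i; rewrite /= !in_itv/=; set m := _ ord0 i.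
  rewrite intrD => /andP[y1 y2] /andP[x1 x2].
  rewrite -(ltr_pM2r k0) mulVf ?gt_eqF// -(gtr0_norm k0) -normrM ltr_norml.
  by rewrite mulrBl; lra.
apply: countable_bigcupT_measurable; first exact: countableP.
by move=> q; case: ifPn.
Qed.

Lemma closed_measurable_row (U : set 'rV[R]_n) : closed U -> measurable U.
Proof.
by move=> cU; rewrite -(setCK U); apply: measurableC; apply: open_measurable_row; exact: closed_openC.
Qed.

Lemma continuous_measurable_row (g : 'rV[R]_n -> R) : continuous g ->
  measurable_fun [set: 'rV[R]_n] g.
Proof.
move=> cg; apply: measurability; first exact: (@RGenOpens.measurableE R).
move=> _ [_ [a [b ->]] <-]; rewrite setTI; apply: open_measurable_row.
by move/continuousP: cg; apply; exact: interval_open.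
Qed.

Lemma measurable_fun_addrow (v : 'rV[R]_n) :
  measurable_fun [set: 'rV[R]_n] (fun x => x + v).
Proof.
apply: measurable_fun_row => i; under eq_fun do rewrite mxE.
by apply: measurable_funD => //; exact: measurable_coord.
Qed.

Definition evec (j : 'I_n) : 'rV[R]_n := delta_mx ord0 j.

Lemma evecE (j i : 'I_n) : evec j ord0 i = (i == j)%:R.
Proof. by rewrite mxE eqxx. Qed.

Lemma add_evecE (x : 'rV[R]_n) h (j i : 'I_n) :
  (x + h *: evec j) ord0 i = if i == j then x ord0 j + h else x ord0 i.
Proof.
rewrite !mxE eqxx; case: eqVneq => [->|_]/=; first by rewrite mulr1.
by rewrite mulr0 addr0.
Qed.

Lemma upd_add (j : 'I_n) t h x : upd j t x + h *: evec j = upd j (t + h) x.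
Proof. by apply/rowP => i; rewrite add_evecE !updE eqxx; case: eqP. Qed.

Lemma measurable_upd (j : 'I_n) x :
  measurable_fun [set: measurableTypeR R] (fun t : measurableTypeR R => upd j t x).
Proof.
apply: measurable_fun_row => i; under eq_fun do rewrite updE.
case: (i == j) => /=; [exact: measurable_id|exact: measurable_cst].
Qed.

End row_open.

(** * The Gaussian measure: translation, density, exponential moments *)

Section gauss.
Local Open Scope ereal_scope.
Context {R : realType}.
Local Notation mu := (@lebesgue_measure R).

Local Notation rho := (normal_pdf (0 : R) 1).

Lemma normal_pdf01E t : rho t = (normal_peak 1 * expR (- t ^+ 2 / 2))%R.
Proof. by rewrite normal_pdfE ?oner_neq0// /normal_fun subr0 expr1n. Qed.

Lemma normal_pdf01_gt0 t : (0 < rho t)%R.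
Proof. by rewrite normal_pdf01E mulr_gt0 ?expR_gt0// normal_peak_gt0 ?oner_neq0. Qed.

(** On a line, substitute t + h in the right-hand integral and complete the square: rho (t + h) *
    exp (h (t + h) - h^2 / 2) = rho t. Nonnegative extended-real g covers positive parts, negative
    parts and indicators. *)
Lemma ge0_integral_gauss_shift n (j : 'I_n) h (g : 'rV[R]_n -> \bar R) :
  measurable_fun [set: 'rV[R]_n] g -> (forall x, 0 <= g x) ->
  \int[gauss_row R n]_x g (x + h *: evec j)%R =
  \int[gauss_row R n]_x (g x * (expR (h * x ord0 j - h ^+ 2 / 2))%:E).
Proof.
move=> mg g0.
have mE : measurable_fun [set: 'rV[R]_n] (fun x : 'rV[R]_n => (expR (h * x ord0 j - h ^+ 2 / 2))%:E).
  apply/measurable_EFinP; apply: measurableT_comp => //; apply: measurable_funB => //.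
  by apply: measurable_funM => //; exact: measurable_coord.
have mgE : measurable_fun [set: 'rV[R]_n] (fun x : 'rV[R]_n => g x * (expR (h * x ord0 j - h ^+ 2 / 2))%:E).
  exact: emeasurable_funM.
have mr : measurable_fun [set: measurableTypeR R] (fun x => (rho x)%:E).
  by apply/measurable_EFinP; exact: measurable_normal_pdf.
apply: (eq_ge0_integral_upd (j := j)) => //.
- by apply: measurableT_comp => //; exact: measurable_fun_addrow.
- by move=> x; rewrite mule_ge0// lee_fin expR_ge0.
move=> x; under eq_integral do rewrite upd_add.
have mgu : measurable_fun [set: measurableTypeR R] (fun t : measurableTypeR R => g (upd j t x)).
  by apply: measurableT_comp => //; exact: measurable_upd.
rewrite !ge0_integral_normal//; last 3 first.
- by apply: (measurableT_comp mgE); exact: measurable_upd.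
- by move=> t; rewrite mule_ge0// lee_fin expR_ge0.
- by apply: (measurableT_comp mgu); exact: measurable_funD.
rewrite -[RHS](ge0_integral_lebesgue_shift h); last 2 first.
- apply: emeasurable_funM => //.
  by apply: (measurableT_comp mgE); exact: measurable_upd.
- by move=> t; rewrite mule_ge0 ?lee_fin ?normal_pdf_ge0// mule_ge0// lee_fin expR_ge0.
apply: eq_integral => t _; rewrite -muleA; congr (_ * _).
rewrite -EFinM updE eqxx !normal_pdf01E; congr EFin.
by rewrite mulrCA -expRD; congr (_ * expR _)%R; field.
Qed.

Definition gdens n (x : 'rV[R]_n) : R := (\prod_(i < n) rho (x ord0 i))%R.

Lemma gdens_gt0 n (x : 'rV[R]_n) : (0 < gdens x)%R.
Proof. by apply: prodr_gt0 => i _; exact: normal_pdf01_gt0. Qed.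

Lemma measurable_gdens n : measurable_fun [set: 'rV[R]_n] (@gdens n).
Proof.
apply: measurable_prod => i _.
by apply: measurableT_comp; [exact: measurable_normal_pdf|exact: measurable_coord].
Qed.

Lemma gdens_cons n a (v : 'rV[R]_n) : gdens (row_cons (a, v)) = (rho a * gdens v)%R.
Proof.
rewrite /gdens big_ord_recl row_cons0; congr (_ * _)%R.
by apply: eq_bigr => i _; rewrite row_consS.
Qed.

Lemma ge0_integral_gauss n (g : 'rV[R]_n -> \bar R) :
  measurable_fun [set: 'rV[R]_n] g -> (forall x, 0 <= g x) ->
  \int[gauss_row R n]_x g x = \int[lebesgue_row R n]_x (g x * (gdens x)%:E).
Proof.
elim: n g => [|n IH] g mg g0.
  by apply: eq_integral => x _; rewrite /gdens big_ord0 mule1.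
have mG : measurable_fun [set: 'rV[R]_n.+1] (fun x => g x * (gdens x)%:E).
  by apply: emeasurable_funM => //; apply/measurable_EFinP; exact: measurable_gdens.
have G0 (x : 'rV[R]_n.+1) : 0 <= g x * (gdens x)%:E.
  by rewrite mule_ge0// lee_fin ltW// gdens_gt0.
rewrite (ge0_integral_row2 _ mg g0) (ge0_integral_row2 _ mG G0) IH; last 2 first.
- apply: (@measurable_fun_fubini_tonelli_G _ _ _ _ R (normal_prob (0 : R) 1) (g \o @row_cons R n)).
    by apply: measurableT_comp => //; exact: measurable_row_cons.
  by move=> x; exact: g0.
- by move=> x; apply: integral_ge0.
apply: eq_integral => v _.
rewrite ge0_integral_normal//; last first.
  by apply: (measurableT_comp mg); exact: measurable_row_cons1.
rewrite -ge0_integralZr//; last 3 first.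
- apply: emeasurable_funM; first exact: (measurableT_comp mg (measurable_row_cons1 v)).
  by apply/measurable_EFinP; exact: measurable_normal_pdf.
- by move=> a _; rewrite mule_ge0// lee_fin normal_pdf_ge0.
- by rewrite lee_fin ltW// gdens_gt0.
by apply: eq_integral => t _; rewrite gdens_cons EFinM muleA.
Qed.


Lemma gauss_row_setT n : gauss_row R n setT = 1.
Proof.
rewrite (_ : setT = [set x : 'rV[R]_n | forall i, (fun=> setT) i (x ord0 i)]); last first.
  by apply/seteqP; split.
by rewrite (@power_measureE _ _ _ (fun=> setT))// big1// => i _; exact: probability_setT.
Qed.

Lemma gauss_dominates n (N : set 'rV[R]_n) : measurable N ->
  lebesgue_row R n N = 0 -> gauss_row R n N = 0.
Proof.
move=> mN N0.
have <- : \int[gauss_row R n]_x (\1_N x)%:E = gauss_row R n N.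
  by rewrite integral_indic// setIT.
have mI : measurable_fun [set: 'rV[R]_n] (fun x => (\1_N x)%:E : \bar R).
  by apply/measurable_EFinP; exact: measurable_indic.
rewrite ge0_integral_gauss//.
rewrite (@ge0_negligible_integral _ _ _ _ setT N)//.
- rewrite integral0_eq// => x [_ /= Nx]; rewrite indicE memNset// mul0e//.
- apply: emeasurable_funM => //.
  by apply/measurable_EFinP; exact: measurable_gdens.
- by move=> x _; rewrite mule_ge0// lee_fin ltW// gdens_gt0.
Qed.

(* The l^1 norm makes the weight a product over coordinates. *)
Definition expgrowth n (c : R) (x : 'rV[R]_n) : R := expR (c * \sum_(i < n) `|x ord0 i|)%R.

Lemma measurable_expgrowth n c : measurable_fun [set: 'rV[R]_n] (@expgrowth n c).
Proof.
apply: measurableT_comp => //; apply: measurable_funM => //.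
by apply: measurable_sum => i; apply: measurableT_comp => //; exact: measurable_coord.
Qed.

Lemma normal_exp_abs_lty (c : R) :
  \int[normal_prob (0 : R) 1]_t (expR (c * `|t|))%:E < +oo.
Proof.
have m1 : measurable_fun [set: measurableTypeR R] (fun t : measurableTypeR R => (expR (c * `|t|))%:E).
  by apply/measurable_EFinP; apply: measurableT_comp => //; exact: measurable_funM.
rewrite ge0_integral_normal//.
(* The variance 2 comes from c |t| - t^2 / 2 <= c^2 - t^2 / 4, that is (c - |t| / 2)^2 >= 0: the
   right side has the exponent of a N(0, 2) density, and [K] collects the constants. *)
pose s : R := Num.sqrt 2.
have s0 : s != 0%R by rewrite sqrtr_eq0 -ltNge.
pose K := (normal_peak 1 * expR (c ^+ 2) / normal_peak s)%R.
have ps : (0 < normal_peak s)%R by exact: normal_peak_gt0.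
apply: (@le_lt_trans _ _ (\int[mu]_t (K%:E * (normal_pdf 0 s t)%:E))); last first.
  rewrite ge0_integralZl_EFin//; last 3 first.
  - by move=> t _; rewrite lee_fin normal_pdf_ge0.
  - by apply/measurable_EFinP; exact: measurable_normal_pdf.
  - by rewrite divr_ge0 ?mulr_ge0 ?expR_ge0 ?normal_peak_ge0.
  by rewrite integral_normal_pdf// mule1 ltry.
apply: ge0_le_integral => //.
- by move=> t _; rewrite mule_ge0 ?lee_fin ?expR_ge0 ?normal_pdf_ge0.
- apply: emeasurable_funM => //.
  by apply/measurable_EFinP; exact: measurable_normal_pdf.
- apply: emeasurable_funM => //.
  by apply/measurable_EFinP; exact: measurable_normal_pdf.
move=> t _; rewrite -!EFinM lee_fin normal_pdf01E normal_pdfE// /normal_fun subr0.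
have -> (e : R) : (K * (normal_peak s * e) = normal_peak 1 * (expR (c ^+ 2) * e))%R.
  by rewrite /K; field; rewrite gt_eqF.
rewrite sqr_sqrtr// mulrCA.
rewrite ler_pM2l ?normal_peak_gt0 ?oner_neq0// -!expRD ler_expR.
have := sqr_ge0 (c - `|t| / 2)%R; rewrite sqrrB expr_div_n real_normK ?num_real//.
lra.
Qed.

Lemma expgrowth_lty n c : \int[gauss_row R n]_x (expgrowth c x)%:E < +oo.
Proof.
elim: n => [|n IH].
  rewrite (eq_integral (cst 1)); last first.
    by move=> x _; rewrite /expgrowth big_ord0 mulr0 expR0.
  by rewrite integral_cst// mul1e [X in X < _](@gauss_row_setT 0) ltry.
rewrite ge0_integral_row1//; last 2 first.
- by apply/measurable_EFinP; exact: measurable_expgrowth.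
- by move=> x; rewrite lee_fin expR_ge0.
under eq_integral.
  move=> a _.
  under eq_integral.
    move=> v _; rewrite /expgrowth big_ord_recl row_cons0 mulrDr expRD.
    under eq_bigr do rewrite row_consS.
    rewrite EFinM; over.
  rewrite ge0_integralZl_EFin ?expR_ge0//; last first.
    by apply/measurable_EFinP; exact: measurable_expgrowth.
  over.
rewrite ge0_integralZr//.
- by apply: lte_mul_pinfty => //; [apply: integral_ge0 => x _; rewrite lee_fin expR_ge0
    |rewrite ge0_fin_numE ?normal_exp_abs_lty//; apply: integral_ge0 => x _; rewrite lee_fin expR_ge0].
- by apply/measurable_EFinP; apply: measurableT_comp => //; exact: measurable_funM.
- by apply: integral_ge0 => x _; rewrite lee_fin expR_ge0.
Qed.

End gauss.

(** * Functions of exponential growth and the Stein identity *)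

Section tame.
Context {R : realType} {n : nat}.
Implicit Types (g h : 'rV[R]_n -> R) (x : 'rV[R]_n).
Local Notation gam := (gauss_row R n).

(** This class contains the coordinates and the Cameron-Martin weights, is stable under products and
    translations, and all its members are Gaussian integrable. *)
Definition tame g := measurable_fun [set: 'rV[R]_n] g /\
  exists C c : R, forall x, `|g x| <= C * expgrowth c x.

(** A real-valued integral, hence [fine] of the extended one; it is the true expectation as soon as
    the argument is tame. *)
Definition gE g : R := \int[gam]_x g x.

Lemma expgrowth_gt0 (c : R) x : 0 < expgrowth c x.
Proof. exact: expR_gt0. Qed.

Lemma le_expgrowth (c c' : R) x : c <= c' -> expgrowth c x <= expgrowth c' x.
Proof. by move=> cc'; rewrite ler_expR ler_wpM2r// sumr_ge0. Qed.

Lemma expgrowthD (c c' : R) x : expgrowth (c + c') x = expgrowth c x * expgrowth c' x.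
Proof. by rewrite /expgrowth mulrDl expRD. Qed.

(** Nonnegative constants are what allow bounds to be added, multiplied and weakened. *)
Lemma tame_bound g : tame g -> exists C c : R, [/\ 0 <= C, 0 <= c & forall x, `|g x| <= C * expgrowth c x].
Proof.
move=> [_ [C [c gC]]]; exists `|C|, `|c|; split => // x.
rewrite (le_trans (gC x))// (@le_trans _ _ (`|C| * expgrowth c x))//.
  by rewrite ler_wpM2r ?(ltW (expgrowth_gt0 _ _))// ler_norm.
by rewrite ler_wpM2l// le_expgrowth// ler_norm.
Qed.

Lemma tame_cst (c : R) : tame (cst c).
Proof.
split; first exact: measurable_cst.
by exists `|c|, 0 => x /=; rewrite /expgrowth mul0r expR0 mulr1.
Qed.

Lemma abs_coord_le_sum x (i : 'I_n) : `|x ord0 i| <= \sum_(k < n) `|x ord0 k|.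
Proof. by rewrite (bigD1 i)//= lerDl sumr_ge0. Qed.

Lemma tame_coord (i : 'I_n) : tame (fun x => x ord0 i).
Proof.
split; first exact: measurable_coord.
exists 1, 1 => x; rewrite mul1r /expgrowth mul1r.
rewrite (le_trans (abs_coord_le_sum x i))//.
by rewrite (le_trans _ (expR_ge1Dx _))// lerDr.
Qed.

Lemma tameD g h : tame g -> tame h -> tame (g \+ h).
Proof.
move=> tg th; have [C [c [C0 c0 gC]]] := tame_bound tg.
have [C' [c' [C'0 c'0 hC]]] := tame_bound th.
split; first exact: measurable_funD tg.1 th.1.
exists (C + C'), (c + c') => x /=; rewrite (le_trans (ler_normD _ _))// mulrDl lerD//.
  by rewrite (le_trans (gC x))// ler_wpM2l// le_expgrowth// lerDl.
by rewrite (le_trans (hC x))// ler_wpM2l// le_expgrowth// lerDr.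
Qed.

Lemma tameM g h : tame g -> tame h -> tame (g \* h).
Proof.
move=> tg th; have [C [c [C0 c0 gC]]] := tame_bound tg.
have [C' [c' [C'0 c'0 hC]]] := tame_bound th.
split; first exact: measurable_funM tg.1 th.1.
by exists (C * C'), (c + c') => x /=; rewrite expgrowthD mulrACA normrM ler_pM.
Qed.

Lemma tameZ (a : R) g : tame g -> tame (fun x => a * g x).
Proof. by move=> tg; exact: (tameM (tame_cst a) tg). Qed.

Lemma tameN g : tame g -> tame (fun x => - g x).
Proof.
by move=> tg; rewrite (_ : (fun x => _) = (fun x => (-1) * g x));
  [exact: tameZ|apply/funext => x; rewrite mulN1r].
Qed.

Lemma tameB g h : tame g -> tame h -> tame (g \- h).
Proof. by move=> tg th; exact: (tameD tg (tameN th)). Qed.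

Lemma tame_sum (I : Type) (s : seq I) (P : pred I) (g : I -> 'rV[R]_n -> R) :
  (forall i, P i -> tame (g i)) -> tame (fun x => \sum_(i <- s | P i) g i x).
Proof.
move=> tg; rewrite (_ : (fun x => _) = \big[(fun a b => a \+ b)/cst 0]_(i <- s | P i) g i).
  by elim/big_ind : _ => //; [exact: tame_cst|exact: tameD].
apply/funext => x; elim: s => [|a s IH]; first by rewrite !big_nil.
by rewrite !big_cons; case: ifP => // _; rewrite IH.
Qed.

Lemma sum_abs_shift x (t : R) (j : 'I_n) :
  \sum_(i < n) `|(x + t *: evec j) ord0 i| <= \sum_(i < n) `|x ord0 i| + `|t|.
Proof.
rewrite (bigD1 j)//= [in leRHS](bigD1 j)//= add_evecE eqxx addrAC lerD ?ler_normD//.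
by apply: ler_sum => i ij; rewrite add_evecE (negbTE ij).
Qed.

Lemma expgrowth_shift (c : R) x (t : R) (j : 'I_n) : 0 <= c ->
  expgrowth c (x + t *: evec j) <= expR (c * `|t|) * expgrowth c x.
Proof.
by move=> c0; rewrite /expgrowth -expRD ler_expR -mulrDr ler_wpM2l// [leRHS]addrC sum_abs_shift.
Qed.

Lemma tame_shift g (t : R) (j : 'I_n) : tame g -> tame (fun x => g (x + t *: evec j)).
Proof.
move=> tg; have [C [c [C0 c0 gC]]] := tame_bound tg.
split; first by apply: (measurableT_comp tg.1); exact: measurable_fun_addrow.
exists (C * expR (c * `|t|)), c => x.
by rewrite (le_trans (gC _))// -mulrA ler_wpM2l// expgrowth_shift.
Qed.

Lemma tame_expcoord (a b : R) (j : 'I_n) : tame (fun x => expR (a * x ord0 j + b)).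
Proof.
split.
  apply: measurableT_comp => //; apply: measurable_funD => //; apply: measurable_funM => //.
  exact: measurable_coord.
exists (expR b), `|a| => x; rewrite ger0_norm ?expR_ge0// expRD mulrC ler_pM2l ?expR_gt0//.
rewrite ler_expR (le_trans (ler_norm _))// normrM ler_wpM2l//.
exact: abs_coord_le_sum.
Qed.

Lemma integrable_expgrowth (C c : R) :
  gam.-integrable [set: 'rV[R]_n] (fun x => (C * expgrowth c x)%:E).
Proof.
apply: (@eq_integrable _ _ _ _ _ _ (fun x => C%:E * (expgrowth c x)%:E)%E) => //.
apply: integrableZl => //; apply/integrableP; split.
  by apply/measurable_EFinP; exact: measurable_expgrowth.
under eq_integral do rewrite gee0_abs ?lee_fin ?(ltW (expgrowth_gt0 _ _))//.
exact: expgrowth_lty.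
Qed.

Lemma tame_integrable g : tame g -> gam.-integrable [set: 'rV[R]_n] (EFin \o g).
Proof.
move=> tg; have [C [c [C0 c0 gC]]] := tame_bound tg.
apply: (le_integrable _ _ _ (integrable_expgrowth C c)) => //.
  by apply/measurable_EFinP; exact: tg.1.
by move=> x _ /=; rewrite lee_fin (le_trans (gC x))// ler_norm.
Qed.

Lemma EFin_gE g : tame g -> (gE g)%:E = (\int[gam]_x (g x)%:E)%E.
Proof. by move=> tg; rewrite fineK//; apply: integrable_fin_num => //; exact: tame_integrable. Qed.

Lemma gED g h : tame g -> tame h -> gE (g \+ h) = gE g + gE h.
Proof. by move=> tg th; apply: RintegralD => //; exact: tame_integrable. Qed.

Lemma gEB g h : tame g -> tame h -> gE (g \- h) = gE g - gE h.
Proof. by move=> tg th; apply: RintegralB => //; exact: tame_integrable. Qed.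

Lemma gEZ (a : R) g : tame g -> gE (fun x => a * g x) = a * gE g.
Proof. by move=> tg; apply: RintegralZl => //; exact: tame_integrable. Qed.

Lemma eq_gE g h : g =1 h -> gE g = gE h.
Proof. by move=> /funext ->. Qed.

Lemma gE_sum (I : Type) (s : seq I) (P : pred I) (g : I -> 'rV[R]_n -> R) :
  (forall i, P i -> tame (g i)) ->
  gE (fun x => \sum_(i <- s | P i) g i x) = \sum_(i <- s | P i) gE (g i).
Proof.
move=> tg; elim: s => [|a s IH].
  rewrite big_nil (@eq_gE _ (fun x => 0 * cst 0 x)) => [|x]; last by rewrite big_nil mul0r.
  by rewrite gEZ ?mul0r//; exact: tame_cst.
rewrite big_cons; case: ifP => Pa; last first.
  by rewrite -IH; apply: eq_gE => x; rewrite big_cons Pa.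
rewrite -IH -gED//; first by apply: eq_gE => x; rewrite big_cons Pa.
- exact: tg.
- exact: tame_sum.
Qed.

(** The weight is positive, so it commutes with taking positive and negative parts, and each part
    obeys the nonnegative formula. *)
Lemma gE_shift g (t : R) (j : 'I_n) : tame g ->
  gE (fun x => g (x + t *: evec j)) = gE (fun x => g x * expR (t * x ord0 j - t ^+ 2 / 2)).
Proof.
move=> tg; rewrite /gE /Rintegral; congr fine.
rewrite [LHS]integralE [RHS]integralE; congr (_ - _)%E.
  have mg : measurable_fun [set: 'rV[R]_n] ((EFin \o g)^\+)%E.
    by apply: measurable_funepos; apply/measurable_EFinP; exact: tg.1.
  have H := (ge0_integral_gauss_shift j t mg (fun x => funepos_ge0 _ x)).
  apply: etrans; last (apply: etrans; first exact: H).
    by apply: eq_integral => x _; rewrite !funeposE.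
  apply: eq_integral => x _; rewrite !funeposE/= -!EFin_max -EFinM; congr EFin.
  by rewrite -{2}(mul0r (expR (t * x ord0 j - t ^+ 2 / 2))) maxr_pMl ?expR_ge0.
have mg : measurable_fun [set: 'rV[R]_n] ((EFin \o g)^\-)%E.
  by apply: measurable_funeneg; apply/measurable_EFinP; exact: tg.1.
have H := (ge0_integral_gauss_shift j t mg (fun x => funeneg_ge0 _ x)).
apply: etrans; last (apply: etrans; first exact: H).
  by apply: eq_integral => x _; rewrite !funenegE.
apply: eq_integral => x _; rewrite !funenegE/= -!EFin_max -EFinM; congr EFin.
by rewrite -{2}(mul0r (expR (t * x ord0 j - t ^+ 2 / 2))) maxr_pMl ?expR_ge0// mulNr.
Qed.

(** An exponential bound uniform in k is itself Gaussian integrable, so it serves as the dominating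
    function. *)
Lemma gE_cvg (u : nat -> 'rV[R]_n -> R) (v : 'rV[R]_n -> R) (C c : R) :
  (forall k, tame (u k)) -> tame v -> (forall k x, `|u k x| <= C * expgrowth c x) ->
  {ae gam, forall x, u k x @[k --> \oo] --> v x} ->
  gE (u k) @[k --> \oo] --> gE v.
Proof.
move=> tu tv uC uv.
have [|||||] := @dominated_convergence _ _ _ gam _ measurableT (fun k => EFin \o u k) (EFin \o v)
  (fun x => (C * expgrowth c x)%:E).
- by move=> k; apply/measurable_EFinP; exact: (tu k).1.
- by apply/measurable_EFinP; exact: tv.1.
- by apply: filterS uv => x uvx _; apply/cvg_EFin; [near=> k|exact: uvx].
- exact: integrable_expgrowth.
- by apply: aeW => x k _ /=; rewrite lee_fin.
move=> _ _; rewrite -EFin_gE// => /fine_cvg.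
by apply: cvg_trans.
Unshelve. all: by end_near. Qed.

(** [D] is separate data because it is tied to f only almost everywhere. The third clause dominates
    the difference quotients as t -> 0; differentiability almost everywhere alone would admit
    Cantor-type functions, for which integration by parts fails. *)
Definition reg (f : 'rV[R]_n -> R) (D : 'I_n -> 'rV[R]_n -> R) : Prop :=
  [/\ tame f, forall j, tame (D j),
      exists C c : R, forall j x t, `|t| <= 1 ->
        `|f (x + t *: evec j) - f x| <= `|t| * (C * expgrowth c x) &
      forall j, {ae gam, forall x, is_derive x (evec j) f (D j x)}].

Definition dq (j : 'I_n) (t : R) (f : 'rV[R]_n -> R) x : R :=
  t^-1 * (f (x + t *: evec j) - f x).

Lemma tame_dq j t f : tame f -> tame (dq j t f).
Proof. by move=> tf; apply: tameZ; apply: tameB => //; exact: tame_shift. Qed.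

Lemma dq_bound f D : reg f D -> exists C c : R, [/\ 0 <= C, 0 <= c & forall j x t, `|t| <= 1 ->
  `|dq j t f x| <= C * expgrowth c x].
Proof.
move=> [_ _ [C [c fC]] _]; exists `|C|, `|c|; split => // j x t t1.
(* At t = 0 the convention 0^-1 = 0 makes the quotient 0, so the bound covers this value too. *)
have [->|t0] := eqVneq t 0.
  by rewrite /dq invr0 mul0r normr0 mulr_ge0// ltW// expgrowth_gt0.
rewrite normrM normfV ler_pdivrMl ?normr_gt0// (le_trans (fC _ _ _ _))//.
rewrite ler_wpM2l// (@le_trans _ _ (`|C| * expgrowth c x))//.
  by rewrite ler_wpM2r ?ler_norm// ltW// expgrowth_gt0.
by rewrite ler_wpM2l// le_expgrowth// ler_norm.
Qed.

Lemma cvg_dnbhs0 (t : nat -> R) : (forall k, t k != 0) -> t k @[k --> \oo] --> 0 ->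
  t k @[k --> \oo] --> 0^'.
Proof.
move=> t0 tk A /= [e e0 eA]; suff : \forall k \near \oo, A (t k) by [].
near=> k; apply: (eA (t k)) => /=; last by rewrite t0.
near: k; move/cvgrPdist_lt : (tk); exact.
Unshelve. all: by end_near. Qed.

Lemma dq_cvg (f : 'rV[R]_n -> R) x j (a : R) (t : nat -> R) : is_derive x (evec j) f a ->
  (forall k, t k != 0) -> t k @[k --> \oo] --> 0 ->
  dq j (t k) f x @[k --> \oo] --> a.
Proof.
move=> [df fa] t0 tk.
have /cvg_ex[l fl] := df.
have la : l = a by rewrite -fa /derive; apply/esym/cvg_lim.
rewrite -la.
have := cvg_comp _ _ (cvg_dnbhs0 t0 tk) fl; apply: cvg_trans; apply: near_eq_cvg; near=> k => /=.
by rewrite /dq (addrC x).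
Unshelve. all: by end_near. Qed.

(** Dominated convergence works along sequences, so t -> 0 is taken along this one: never 0, and at
    most 1 as the bounds in [reg] require. *)
Definition hseq (k : nat) : R := k.+1%:R^-1.

Lemma hseq_neq0 k : hseq k != 0.
Proof. by rewrite invr_neq0// pnatr_eq0. Qed.

Lemma hseq_gt0 k : 0 < hseq k.
Proof. by rewrite invr_gt0. Qed.

Lemma hseq_le1 k : hseq k <= 1.
Proof. by rewrite invf_le1// ler1n. Qed.

Lemma hseq_cvg0 : hseq k @[k --> \oo] --> 0.
Proof. exact: cvg_harmonic. Qed.

(* Difference quotient in t of the Cameron-Martin density at t = 0. *)
Definition wq (j : 'I_n) (t : R) (x : 'rV[R]_n) : R :=
  t^-1 * (expR (t * x ord0 j - t ^+ 2 / 2) - 1).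

Lemma tame_expshift j t : tame (fun x => expR (t * x ord0 j - t ^+ 2 / 2)).
Proof. exact: tame_expcoord. Qed.

Lemma tame_wq j t : tame (wq j t).
Proof. by apply: tameZ; apply: tameB; [exact: tame_expshift|exact: tame_cst]. Qed.

(** Both signs come from 1 + y <= exp y: at y = -u it gives exp u * (1 - u) <= 1, used for u >= 0,
    and at y = u it gives 1 - exp u <= -u, used for u < 0. *)
Lemma norm_expRB1_le (u : R) : `|expR u - 1| <= `|u| * expR `|u|.
Proof.
have [u0|u0] := leP 0 u.
  rewrite (ger0_norm u0) ger0_norm ?subr_ge0 -?expR0 ?ler_expR// expR0.
  have := expR_ge1Dx (- u); rewrite expRN => h.
  have e0 := expR_gt0 u.
  have : expR u * (1 + - u) <= 1 by rewrite -ler_pdivlMl// mulr1.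
  by lra.
rewrite (ltr0_norm u0) ler0_norm; last by rewrite subr_le0 -expR0 ler_expR ltW.
rewrite opprB.
have h := expR_ge1Dx u.
have : 1 <= expR (- u) by rewrite -expR0 ler_expR oppr_ge0 ltW.
have u0' : 0 < - u by rewrite oppr_gt0.
move=> e1; rewrite (@le_trans _ _ (- u))//; first lra.
by rewrite ler_peMr// ltW.
Qed.

Lemma wq_bound j t x : `|t| <= 1 -> `|wq j t x| <= expR 2 * expgrowth 2 x.
Proof.
move=> t1; have [->|t0] := eqVneq t 0.
  by rewrite /wq invr0 mul0r normr0 mulr_ge0 ?expR_ge0// ltW// expgrowth_gt0.
rewrite normrM normfV ler_pdivrMl ?normr_gt0//.
set s := \sum_(i < n) `|x ord0 i|.
have s0 : 0 <= s by exact: sumr_ge0.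
have xs : `|x ord0 j| <= s by exact: abs_coord_le_sum.
rewrite (le_trans (norm_expRB1_le _))//.
have tx : `|t * x ord0 j - t ^+ 2 / 2| <= `|t| * (1 + s).
  rewrite (_ : t * x ord0 j - _ = t * (x ord0 j - t / 2)); last by field.
  rewrite normrM ler_wpM2l// (le_trans (ler_normB _ _))// addrC lerD//.
  by rewrite normrM [`|2^-1|]ger0_norm; lra.
apply: (@le_trans _ _ ((`|t| * (1 + s)) * expR (1 + s))).
  apply: ler_pM => //; rewrite ?expR_ge0// ler_expR (le_trans tx)//.
  by rewrite ler_piMl// addr_ge0.
rewrite -mulrA ler_wpM2l// /expgrowth -/s -expRD.
(* The polynomial factor 1 + s is absorbed by a second exponential; this doubling is the origin of
   both constants 2. *)
apply: (@le_trans _ _ (expR (1 + s) * expR (1 + s))).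
  by rewrite ler_wpM2r ?expR_ge0// (le_trans _ (expR_ge1Dx _))// lerDr.
by rewrite -expRD ler_expR; lra.
Qed.

(** The limit is the derivative at t = 0 of exp (t x_j - t^2 / 2). *)
Lemma wq_cvg j x (t : nat -> R) : (forall k, t k != 0) -> t k @[k --> \oo] --> 0 ->
  wq j (t k) x @[k --> \oo] --> x ord0 j.
Proof.
move=> t0 tk.
have : is_derive (0 : R) (1 : R) (fun t : R => expR (t * x ord0 j - t ^+ 2 / 2)) (x ord0 j).
  apply: is_derive_eq.
  rewrite (_ : 0 * x ord0 j - 0 ^+ 2 / 2 = 0); last by ring.
  rewrite expR0 mul1r expr0n/= !(scaler0,scale0r,addr0,add0r,subr0).
  by rewrite /GRing.scale/= mulr1.
move=> [df fa].
have /cvg_ex[l fl] := df.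
have la : l = x ord0 j by rewrite -fa /derive; apply/esym/cvg_lim.
have := cvg_comp _ _ (cvg_dnbhs0 t0 tk) fl; rewrite la; apply: cvg_trans; apply: near_eq_cvg; near=> k => /=.
rewrite /wq scaler1 addr0 mul0r expr0n/= mul0r subr0 expR0//.
Unshelve. all: by end_near. Qed.

(** Discrete integration by parts: Cameron-Martin moves the increment from f to the density. The
    Stein identity is its limit as t -> 0. *)
Lemma gE_dq f (t : R) (j : 'I_n) : tame f ->
  gE (dq j t f) = gE (fun x => f x * wq j t x).
Proof.
move=> tf; rewrite /dq gEZ; last by apply: tameB => //; exact: tame_shift.
rewrite gEB//; last exact: tame_shift.
rewrite gE_shift// -gEB//; last by apply: tameM => //; exact: tame_expshift.
rewrite -gEZ; last by apply: tameB => //; apply: tameM => //; exact: tame_expshift.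
by apply: eq_gE => x; rewrite /wq /=; ring.
Qed.

Lemma stein_identity f D j : reg f D -> gE (D j) = gE (fun x => x ord0 j * f x).
Proof.
move=> rf; have [tf tD fC fD] := rf.
have [C [c [C0 c0 dqC]]] := dq_bound rf.
have [C' [c' [C'0 c'0 fC']]] := tame_bound tf.
have h1 : gE (dq j (hseq k) f) @[k --> \oo] --> gE (D j).
  apply: (gE_cvg (C := C) (c := c)) => //.
  - by move=> k; exact: tame_dq.
  - by move=> k x; apply: dqC; rewrite ger0_norm ?hseq_le1// ltW// hseq_gt0.
  - apply: filterS (fD j) => x fx; apply: dq_cvg => //; [exact: hseq_neq0|exact: hseq_cvg0].
have h2 : gE (dq j (hseq k) f) @[k --> \oo] --> gE (fun x => x ord0 j * f x).
  under eq_fun do rewrite gE_dq//.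
  apply: (gE_cvg (C := C' * expR 2) (c := c' + 2)).
  - by move=> k; apply: tameM => //; exact: tame_wq.
  - by apply: tameM => //; exact: tame_coord.
  - move=> k x; rewrite normrM expgrowthD mulrACA ler_pM// wq_bound//.
    by rewrite ger0_norm ?hseq_le1// ltW// hseq_gt0.
  - apply: aeW => x; rewrite mulrC; apply: cvgMr.
    by apply: wq_cvg; [exact: hseq_neq0|exact: hseq_cvg0].
exact: cvg_unique h1 h2.
Qed.

End tame.

(** * Stability of [reg], Gaussian integration by parts, and the identity for regular fields *)

Section reg_theory.
Context {R : realType} {n : nat}.
Implicit Types (f g : 'rV[R]_n -> R) (x : 'rV[R]_n) (D : 'I_n -> 'rV[R]_n -> R).
Local Notation gam := (gauss_row R n).

(** By Cameron-Martin the translate of a null set has as measure the integral of a weight over the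
    null set, hence 0. *)
Lemma gauss_ae_shift (P : 'rV[R]_n -> Prop) (t : R) (j : 'I_n) :
  {ae gam, forall x, P x} -> {ae gam, forall x, P (x + t *: evec j)}.
Proof.
move=> [A [mA A0 PA]].
pose B := (fun x : 'rV[R]_n => x + t *: evec j) @^-1` A.
have mB : measurable B.
  by rewrite -[X in measurable X]setTI; exact: measurable_fun_addrow.
exists B; split => //; last by move=> x /= Px; exact: PA.
have mI : measurable_fun [set: 'rV[R]_n] (fun x => (\1_A x)%:E : \bar R).
  by apply/measurable_EFinP; exact: measurable_indic.
have : (\int[gam]_x (\1_A (x + t *: evec j))%:E = gam B)%E.
  rewrite -[in RHS](setIT B) -(integral_indic gam measurableT mB).
  by apply: eq_integral.
move=> <-; rewrite (@ge0_integral_gauss_shift _ _ _ _ (fun x => (\1_A x)%:E))//.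
rewrite (@ge0_negligible_integral _ _ _ _ setT A)//.
- by rewrite integral0_eq// => x [_ /= Nx]; rewrite indicE memNset// mul0e.
- apply: emeasurable_funM => //; apply/measurable_EFinP.
  by have [] := @tame_expshift R n j t.
Qed.

Lemma is_derive_shift f x v w (a : R) :
  is_derive (x + w) v f a -> is_derive x v (fun y => f (y + w)) a.
Proof.
move=> [df fa].
have E : (fun h : R => h^-1 *: (((fun y => f (y + w)) \o shift x) (h *: v) - f (x + w))) =
         (fun h : R => h^-1 *: ((f \o shift (x + w)) (h *: v) - f (x + w))).
  by apply/funext => h /=; rewrite addrA.
by split; rewrite /derivable /derive E.
Qed.

Lemma is_derive_coord x (i j : 'I_n) :
  is_derive x (evec j) (fun x : 'rV[R]_n => x ord0 i) (i == j)%:R.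
Proof.
have E : (fun h : R => h^-1 *: (((fun x : 'rV[R]_n => x ord0 i) \o shift x) (h *: evec j) - x ord0 i))
    @ 0^' --> ((i == j)%:R : R).
  apply: cvg_near_cst; near=> h => /=.
  have h0 : h != 0 by near: h; exact: nbhs_dnbhs_neq.
  rewrite (addrC (h *: _)) add_evecE; case: eqP => [->|_]; last by rewrite subrr scaler0.
  by rewrite addrAC subrr add0r /GRing.scale/= mulVf.
split; first by apply/cvg_ex; exists (i == j)%:R.
exact/cvg_lim.
Unshelve. all: by end_near. Qed.

Lemma reg_diff_bound f D : reg f D -> exists C c : R, [/\ 0 <= C, 0 <= c & forall j x t, `|t| <= 1 ->
  `|f (x + t *: evec j) - f x| <= `|t| * (C * expgrowth c x)].
Proof.
move=> [_ _ [C [c fC]] _]; exists `|C|, `|c|; split => // j x t t1.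
rewrite (le_trans (fC _ _ _ t1))// ler_wpM2l//.
apply: (@le_trans _ _ (`|C| * expgrowth c x)).
  by rewrite ler_wpM2r ?ler_norm// ltW// expgrowth_gt0.
by rewrite ler_wpM2l// le_expgrowth// ler_norm.
Qed.

Lemma regB f g Df Dg : reg f Df -> reg g Dg ->
  reg (f \- g) (fun j x => Df j x - Dg j x).
Proof.
move=> rf rg; have [C [c [C0 c0 fC]]] := reg_diff_bound rf.
have [C' [c' [C'0 c'0 gC]]] := reg_diff_bound rg.
case: rf => tf tDf _ df; case: rg => tg tDg _ dg; split.
- exact: tameB.
- by move=> j; exact: tameB.
- exists (C + C'), (c + c') => j x t t1 /=.
  rewrite (_ : _ - (_ - _) = (f (x + t *: evec j) - f x) - (g (x + t *: evec j) - g x)); last by ring.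
  rewrite (le_trans (ler_normB _ _))// mulrDl mulrDr lerD//.
    by rewrite (le_trans (fC _ _ _ t1))// !ler_wpM2l// le_expgrowth// lerDl.
  by rewrite (le_trans (gC _ _ _ t1))// !ler_wpM2l// le_expgrowth// lerDr.
- by move=> j; apply: filterS2 (df j) (dg j) => x hf hg; exact: is_deriveB.
Qed.

Lemma regZ f Df (a : R) : reg f Df -> reg (fun x => a * f x) (fun j x => a * Df j x).
Proof.
move=> rf; have [C [c [C0 c0 fC]]] := reg_diff_bound rf.
case: rf => tf tDf _ df; split.
- exact: tameZ.
- by move=> j; exact: tameZ.
- exists (`|a| * C), c => j x t t1 /=; rewrite -mulrBr normrM -(mulrA `|a|) [leRHS]mulrCA.
  by rewrite ler_wpM2l// fC.
- by move=> j; apply: filterS (df j) => x hf; exact: is_deriveZ.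
Qed.

Lemma reg_shift f Df (t : R) (i : 'I_n) : reg f Df ->
  reg (fun x => f (x + t *: evec i)) (fun j x => Df j (x + t *: evec i)).
Proof.
move=> rf; have [C [c [C0 c0 fC]]] := reg_diff_bound rf.
case: rf => tf tDf _ df; split.
- exact: tame_shift.
- by move=> j; exact: tame_shift.
- exists (C * expR (c * `|t|)), c => j x s s1 /=; rewrite addrAC.
  by rewrite (le_trans (fC _ _ _ s1))// ler_wpM2l// -mulrA ler_wpM2l// expgrowth_shift.
- move=> j; apply: filterS (gauss_ae_shift t i (df j)) => x hf.
  exact: is_derive_shift.
Qed.

(** Difference quotients commute with derivatives exactly; this is what replaces second derivatives
    in [delta_swap]. *)
Lemma reg_dq f Df (t : R) (i : 'I_n) : reg f Df -> reg (dq i t f) (fun j => dq i t (Df j)).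
Proof. by move=> rf; apply: regZ; apply: regB => //; exact: reg_shift. Qed.

Lemma regM f g Df Dg : reg f Df -> reg g Dg ->
  reg (f \* g) (fun j x => f x * Dg j x + g x * Df j x).
Proof.
move=> rf rg; have [C [c [C0 c0 fC]]] := reg_diff_bound rf.
have [C' [c' [C'0 c'0 gC]]] := reg_diff_bound rg.
case: rf => tf tDf _ df; case: rg => tg tDg _ dg.
have [A [a [A0 a0 fA]]] := tame_bound tf.
have [B [b [B0 b0 gB]]] := tame_bound tg.
split.
- exact: tameM.
- by move=> j; apply: tameD; exact: tameM.
(* The increment of the product is split as (increment of f) times shifted g, plus f times
   (increment of g); [expR b] pays for bounding g at the shifted point with |t| <= 1. *)
- exists (C * (B * expR b) + A * C'), ((c + b) + (a + c')) => j x t t1 /=.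
  rewrite (_ : _ - _ = (f (x + t *: evec j) - f x) * g (x + t *: evec j) +
     f x * (g (x + t *: evec j) - g x)); last by ring.
  rewrite (le_trans (ler_normD _ _))// [X in _ <= _ * X]mulrDl [leRHS]mulrDr lerD// normrM.
    apply: (@le_trans _ _ ((`|t| * (C * expgrowth c x)) * (B * expR b * expgrowth b x))).
      apply: ler_pM => //; first exact: fC.
      rewrite (le_trans (gB _))// -mulrA ler_wpM2l//.
      rewrite (le_trans (expgrowth_shift _ _ _ b0))// ler_wpM2r ?(ltW (expgrowth_gt0 _ _))//.
      by rewrite ler_expR ler_piMr.
    rewrite -mulrA ler_wpM2l// mulrACA -expgrowthD ler_wpM2l ?mulr_ge0 ?expR_ge0//.
    by rewrite le_expgrowth// lerDl addr_ge0.
  apply: (@le_trans _ _ (A * expgrowth a x * (`|t| * (C' * expgrowth c' x)))).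
    by apply: ler_pM => //; exact: gC.
  rewrite mulrCA ler_wpM2l// mulrACA -expgrowthD ler_wpM2l ?mulr_ge0//.
  by rewrite le_expgrowth// lerDr addr_ge0.
- by move=> j; apply: filterS2 (df j) (dg j) => x hf hg; exact: is_deriveM.
Qed.

Lemma reg_coord (i : 'I_n) : reg (fun x => x ord0 i) (fun j => cst (i == j)%:R).
Proof.
split.
- exact: tame_coord.
- by move=> j; exact: tame_cst.
- exists 1, 0 => j x t t1; rewrite mul1r /expgrowth mul0r expR0 mulr1 add_evecE.
  by case: eqP => [->|_]; rewrite ?(addrAC _ t) ?subrr ?add0r ?normr0.
- by move=> j; apply: aeW => x; exact: is_derive_coord.
Qed.

(** The adjoint of the i-th derivative in L^2 of the Gaussian measure, as [gauss_ibp] shows. *)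
Definition delta (i : 'I_n) f D x : R := x ord0 i * f x - D i x.

Lemma tame_delta f D i : reg f D -> tame (delta i f D).
Proof.
by move=> [tf tD _ _]; apply: tameB => //; apply: tameM => //; exact: tame_coord.
Qed.

(** The Stein identity for the product f g, with the term g * D_i f moved to the other side. *)
Lemma gauss_ibp f g Df Dg i : reg f Df -> reg g Dg ->
  gE (fun x => delta i f Df x * g x) = gE (fun x => f x * Dg i x).
Proof.
move=> rf rg; have /= := stein_identity i (regM rf rg).
have [tf tDf _ _] := rf; have [tg tDg _ _] := rg.
rewrite (_ : (fun x => f x * Dg i x + _) = (fun x => f x * Dg i x) \+ (fun x => g x * Df i x))//.
rewrite gED; [|exact: tameM|exact: tameM] => E.
have -> : gE (fun x => delta i f Df x * g x) = gE (fun x => x ord0 i * (f x * g x)) - gE (fun x => g x * Df i x).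
  rewrite -gEB; [|by apply: tameM; [exact: tame_coord|exact: tameM]|exact: tameM].
  by apply: eq_gE => x; rewrite /delta /=; ring.
by rewrite -E addrK.
Qed.

(** If g had second derivatives, both sides would equal E[f D_i D_j g]. Instead,
    E[delta_i f * dq_j g] = E[f * dq_j (D_i g)] by parts, a translation by -t e_j moves the quotient
    onto f, and t -> 0 turns it into delta_j f. *)
Lemma delta_swap f g Df Dg (i j : 'I_n) : reg f Df -> reg g Dg ->
  gE (fun x => delta i f Df x * Dg j x) = gE (fun x => delta j f Df x * Dg i x).
Proof.
move=> rf rg.
have [tf tDf _ df] := rf; have [tg tDg _ dg] := rg.
have [C [c [C0 c0 dqC]]] := dq_bound rg.
have [B [b [B0 b0 dfB]]] := tame_bound (tame_delta i rf).
have h1 : gE (fun x => delta i f Df x * dq j (hseq k) g x) @[k --> \oo] -->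
    gE (fun x => delta i f Df x * Dg j x).
  apply: (gE_cvg (C := B * C) (c := b + c)).
  - by move=> k; apply: tameM; [exact: tame_delta|exact: tame_dq].
  - by apply: tameM => //; exact: tame_delta.
  - move=> k x; rewrite normrM expgrowthD mulrACA ler_pM// dqC//.
    by rewrite ger0_norm ?hseq_le1// ltW// hseq_gt0.
  - apply: filterS (dg j) => x gx; apply: cvgMr; apply: dq_cvg => //.
      exact: hseq_neq0.
    exact: hseq_cvg0.
have [C1 [c1 [C10 c10 dqfC]]] := dq_bound rf.
have [A [a [A0 a0 DgA]]] := tame_bound (tDg i).
have [A' [a' [A'0 a'0 fA']]] := tame_bound tf.
have t1 k : `|hseq k : R| <= 1 by rewrite ger0_norm ?hseq_le1// ltW// hseq_gt0.
have t1' k : `|- hseq k : R| <= 1 by rewrite normrN.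
(* With t = [hseq k] this is (f (x - t e_j) * weight - f x) / t, where the weight is exp (t x_j -
   t^2 / 2): what remains on f once Cameron-Martin has translated the quotient away from D_i g. *)
pose u k x : R := f (x + (- hseq k) *: evec j) * wq j (hseq k) x - dq j (- hseq k) f x.
have tu k : tame (u k).
  by apply: tameB; [apply: tameM; [exact: tame_shift|exact: tame_wq]|exact: tame_dq].
have h2 : gE (fun x => u k x * Dg i x) @[k --> \oo] --> gE (fun x => delta j f Df x * Dg i x).
  apply: (gE_cvg (C := (A' * expR a' * expR 2 + C1) * A) (c := ((a' + 2) + c1) + a)).
  - by move=> k; apply: tameM.
  - by apply: tameM => //; exact: tame_delta.
  - move=> k x; rewrite normrM expgrowthD mulrACA ler_pM// (le_trans (ler_normB _ _))//.
    rewrite mulrDl lerD//.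
      rewrite normrM.
      apply: (@le_trans _ _ ((A' * expR a' * expgrowth a' x) * (expR 2 * expgrowth 2 x))).
        apply: ler_pM => //; last exact: wq_bound.
        rewrite (le_trans (fA' _))// -mulrA ler_wpM2l//.
        rewrite (le_trans (expgrowth_shift _ _ _ a'0))// ler_wpM2r ?(ltW (expgrowth_gt0 _ _))//.
        by rewrite ler_expR ler_piMr.
      rewrite mulrACA -expgrowthD ler_wpM2l ?mulr_ge0 ?expR_ge0//.
      by rewrite le_expgrowth// lerDl.
    rewrite (le_trans (dqfC _ _ _ (t1' k)))// ler_wpM2l// le_expgrowth//.
    by rewrite lerDr addr_ge0.
  - apply: filterS (df j) => x fx; apply: cvgMl; rewrite /delta.
    have hN0 k : - hseq k != 0 :> R by rewrite oppr_eq0 hseq_neq0.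
    have hNc : - hseq k @[k --> \oo] --> (0 : R) by rewrite -oppr0; apply: cvgN; exact: hseq_cvg0.
    have dqx := dq_cvg fx hN0 hNc.
    apply: cvgB => //; rewrite mulrC; apply: cvgM; last first.
      by apply: wq_cvg; [exact: hseq_neq0|exact: hseq_cvg0].
    (* Convergence of f along the direction e_j is drawn from its derivative at x, since [reg]
       includes no continuity. *)
    rewrite (_ : (fun k => f _) = (fun k => f x + - hseq k * dq j (- hseq k) f x)); last first.
      by apply/funext => k; rewrite /dq mulrA divff// mul1r addrCA subrr addr0.
    rewrite -[X in _ --> X]addr0 -(mul0r (Df j x)); apply: cvgD; first exact: cvg_cst.
    exact: cvgM.
suff E k : gE (fun x => delta i f Df x * dq j (hseq k) g x) = gE (fun x => u k x * Dg i x).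
  by move: h1; rewrite (funext E) => h1; exact: cvg_unique h1 h2.
rewrite (gauss_ibp i rf (reg_dq (hseq k) j rg)).
set t : R := hseq k.
have tsf : tame (fun x => f (x + - t *: evec j)) by exact: tame_shift.
have tfg : tame (fun x => f (x + - t *: evec j) * Dg i x) by exact: tameM.
(* Writing f x as f at x + t e_j - t e_j exhibits the first term as the translate of a single
   function, ready for [gE_shift]. *)
transitivity (t^-1 * (gE (fun x => f (x + t *: evec j + - t *: evec j) * Dg i (x + t *: evec j)) -
   gE (fun x => f x * Dg i x))).
  rewrite -gEB; [|exact: (tame_shift t j tfg)|exact: tameM].
  rewrite -gEZ; last by apply: tameB; [exact: (tame_shift t j tfg)|exact: tameM].
  by apply: eq_gE => x /=; rewrite scaleNr addrK /dq; ring.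
rewrite (gE_shift t j tfg) -gEB; [|by apply: tameM => //; exact: tame_expshift|exact: tameM].
rewrite -gEZ; last first.
  by apply: tameB; apply: tameM => //; exact: tame_expshift.
apply: eq_gE => x /=; rewrite /u /dq /wq -/t.
have t0 : t != 0 by exact: hseq_neq0.
by rewrite invrN; ring.
Qed.

(** Split delta_j g = x_j g - D_j g. By parts the first piece gives 1_(i = j) f g + x_j f D_i g; by
    the swap the second gives x_j f D_i g - D_j f D_i g. The terms x_j f D_i g cancel. *)
Lemma delta_delta f g Df Dg (i j : 'I_n) : reg f Df -> reg g Dg ->
  gE (fun x => delta i f Df x * delta j g Dg x) =
  (i == j)%:R * gE (fun x => f x * g x) + gE (fun x => Df j x * Dg i x).
Proof.
move=> rf rg; have [tf tDf _ df] := rf; have [tg tDg _ dg] := rg.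
have tdf k := tame_delta k rf; have tdg k := tame_delta k rg.
have tc k : tame (fun x : 'rV[R]_n => x ord0 k) by exact: tame_coord.
transitivity (gE (fun x => delta i f Df x * (x ord0 j * g x)) - gE (fun x => delta i f Df x * Dg j x)).
  rewrite -gEB; [|by do 2 apply: tameM => //|exact: tameM].
  by apply: eq_gE => x /=; rewrite -mulrBr.
rewrite (delta_swap i j rf rg) (gauss_ibp i rf (regM (reg_coord j) rg))/=.
rewrite -gEZ; last exact: tameM.
rewrite -gEB; [| |exact: tameM]; last first.
  apply: tameM => //; apply: tameD; apply: tameM => //; exact: tame_cst.
rewrite -gED; [|by apply: tameZ; exact: tameM|exact: tameM].
by apply: eq_gE => x; rewrite /delta/= (eq_sym j i); ring.
Qed.

Lemma second_order_identity (f : 'I_n -> 'rV[R]_n -> R) (D : 'I_n -> 'I_n -> 'rV[R]_n -> R) :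
  (forall i, reg (f i) (D i)) ->
  gE (fun x => (\sum_(i < n) delta i (f i) (D i) x) ^+ 2) =
  gE (fun x => \sum_(i < n) f i x ^+ 2) +
  gE (fun x => \sum_(i < n) \sum_(j < n) D i j x * D j i x).
Proof.
move=> rf.
have tf i : tame (f i) by case: (rf i).
have tD i j : tame (D i j) by case: (rf i).
have td i : tame (delta i (f i) (D i)) by exact: tame_delta.
transitivity (\sum_(i < n) \sum_(j < n) gE (fun x => delta i (f i) (D i) x * delta j (f j) (D j) x)).
  transitivity (gE (fun x => \sum_(i < n) \sum_(j < n) delta i (f i) (D i) x * delta j (f j) (D j) x)).
    apply: eq_gE => x; rewrite expr2 mulr_suml; apply: eq_bigr => i _.
    by rewrite mulr_sumr.
  rewrite gE_sum; last by move=> i _; apply: tame_sum => j _; exact: tameM.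
  by apply: eq_bigr => i _; rewrite gE_sum// => j _; exact: tameM.
transitivity (\sum_(i < n) (gE (fun x => f i x ^+ 2) + \sum_(j < n) gE (fun x => D i j x * D j i x))).
  apply: eq_bigr => i _.
  under eq_bigr do rewrite (delta_delta _ _ (rf _) (rf _)).
  rewrite big_split/=; congr (_ + _).
  rewrite (bigD1 i)//= eqxx mul1r big1 ?addr0// => j ij.
  by rewrite eq_sym (negbTE ij) mul0r.
rewrite big_split/=; congr (_ + _).
  by rewrite gE_sum// => i _; exact: tameM.
rewrite gE_sum; last by move=> i _; apply: tame_sum => j _; exact: tameM.
by apply: eq_bigr => i _; rewrite gE_sum// => j _; exact: tameM.
Qed.

End reg_theory.

(** * The Hilbert space L^2 *)

Section L2.
Context {R : realType} {d : measure_display} {T : measurableType d}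
  (mu : {measure set T -> \bar R}).
Implicit Types u v w : T -> R.

(** Members are functions rather than classes, so limits are unique only almost everywhere. *)
Definition L2 u := measurable_fun [set: T] u /\ (\int[mu]_x (u x ^+ 2)%:E < +oo)%E.

Definition ip u v : R := \int[mu]_x (u x * v x).

Lemma sqr_integrable u : L2 u -> mu.-integrable [set: T] (fun x => (u x ^+ 2)%:E).
Proof.
move=> [mu_u iu]; apply/integrableP; split.
  by apply/measurable_EFinP; exact: measurable_funX.
by under eq_integral do rewrite gee0_abs ?lee_fin ?sqr_ge0//.
Qed.

Lemma mul_integrable u v : L2 u -> L2 v -> mu.-integrable [set: T] (EFin \o (u \* v)).
Proof.
move=> Lu Lv.
apply: (le_integrable _ _ _ (integrableD measurableT (sqr_integrable Lu) (sqr_integrable Lv))) => //.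
  by apply/measurable_EFinP; exact: measurable_funM Lu.1 Lv.1.
move=> x _ /=; rewrite lee_fin normrM [leRHS]ger0_norm ?addr_ge0 ?sqr_ge0//.
rewrite -[u x ^+ 2]real_normK ?num_real// -[v x ^+ 2]real_normK ?num_real//.
have := sqr_ge0 (`|u x| - `|v x|); have := sqr_ge0 `|u x|; have := sqr_ge0 `|v x|.
by rewrite sqrrB; lra.
Qed.

Lemma L2P u : measurable_fun [set: T] u -> mu.-integrable [set: T] (fun x => (u x ^+ 2)%:E) -> L2 u.
Proof. by move=> mu_u iu; split => //; exact: integrable_lty iu. Qed.

Lemma L2D u v : L2 u -> L2 v -> L2 (u \+ v).
Proof.
move=> Lu Lv; apply: L2P; first exact: measurable_funD Lu.1 Lv.1.
apply: (@eq_integrable _ _ _ _ _ measurableT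
  (fun x => (u x ^+ 2)%:E + ((u \* v) x)%:E + (((u \* v) x)%:E + (v x ^+ 2)%:E))%E).
  by move=> x _; rewrite -!EFinD; congr EFin => /=; ring.
by apply: integrableD => //; apply: integrableD => //;
  solve [exact: sqr_integrable|exact: mul_integrable].
Qed.

Lemma L2Z (a : R) u : L2 u -> L2 (fun x => a * u x).
Proof.
move=> Lu; apply: L2P; first by apply: measurable_funM => //; exact: Lu.1.
apply: (@eq_integrable _ _ _ _ _ measurableT (fun x => (a ^+ 2)%:E * (u x ^+ 2)%:E)%E).
  by move=> x _; rewrite -EFinM; congr EFin; rewrite exprMn.
by apply: integrableZl => //; exact: sqr_integrable.
Qed.

Lemma L2B u v : L2 u -> L2 v -> L2 (u \- v).
Proof.
move=> Lu Lv; rewrite (_ : u \- v = u \+ (fun x => (-1) * v x)).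
  by apply: L2D => //; exact: L2Z.
by apply/funext => x /=; rewrite mulN1r.
Qed.

Lemma L2_0 : L2 (cst 0).
Proof.
split; first exact: measurable_cst.
by rewrite integral0_eq ?ltry// => x _; rewrite /= expr0n.
Qed.

Lemma L2_sum (I : Type) (s : seq I) (P : pred I) (u : I -> T -> R) :
  (forall i, P i -> L2 (u i)) -> L2 (fun x => \sum_(i <- s | P i) u i x).
Proof.
move=> Lu; rewrite (_ : (fun x => _) = \big[(fun a b => a \+ b)/cst 0]_(i <- s | P i) u i).
  by elim/big_ind : _ => //; [exact: L2_0|exact: L2D].
apply/funext => x; elim: s => [|a s IH]; first by rewrite !big_nil.
by rewrite !big_cons; case: ifP => // _; rewrite IH.
Qed.

Lemma ipC u v : ip u v = ip v u.
Proof. by apply: eq_Rintegral => x _; rewrite mulrC. Qed.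

Lemma eq_ip u u' v v' : u =1 u' -> v =1 v' -> ip u v = ip u' v'.
Proof. by move=> /funext -> /funext ->. Qed.

Lemma ipDl u v w : L2 u -> L2 v -> L2 w -> ip (u \+ v) w = ip u w + ip v w.
Proof.
move=> Lu Lv Lw; rewrite /ip -RintegralD//.
- by apply: eq_Rintegral => x _ /=; rewrite mulrDl.
- exact: mul_integrable.
- exact: mul_integrable.
Qed.

Lemma ipZl a u w : L2 u -> L2 w -> ip (fun x => a * u x) w = a * ip u w.
Proof.
move=> Lu Lw; rewrite /ip -RintegralZl//; last exact: mul_integrable.
by apply: eq_Rintegral => x _ /=; rewrite mulrA.
Qed.

Lemma ipBl u v w : L2 u -> L2 v -> L2 w -> ip (u \- v) w = ip u w - ip v w.
Proof.
move=> Lu Lv Lw; rewrite /ip -RintegralB//.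
- by apply: eq_Rintegral => x _ /=; rewrite mulrBl.
- exact: mul_integrable.
- exact: mul_integrable.
Qed.

Lemma ipBr u v w : L2 u -> L2 v -> L2 w -> ip w (u \- v) = ip w u - ip w v.
Proof. by move=> *; rewrite ipC ipBl// ![ip _ w]ipC. Qed.

Lemma ip_ge0 u : 0 <= ip u u.
Proof. by apply: Rintegral_ge0 => x _; rewrite -expr2 sqr_ge0. Qed.

Lemma EFin_ip u v : L2 u -> L2 v -> (ip u v)%:E = (\int[mu]_x (u x * v x)%:E)%E.
Proof. by move=> Lu Lv; rewrite fineK//; apply: integrable_fin_num => //; exact: mul_integrable. Qed.

Lemma ip_CS u v : L2 u -> L2 v -> ip u v ^+ 2 <= ip u u * ip v v.
Proof.
move=> Lu Lv.
have H t : 0 <= ip u u - 2 * t * ip u v + t ^+ 2 * ip v v.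
  have Lt : L2 (fun x => t * v x) by exact: L2Z.
  have := ip_ge0 (u \- (fun x => t * v x)).
  rewrite ipBl//; last exact: L2B.
  rewrite !ipBr// [ip (fun x => t * v x) u]ipC [ip u (fun x => t * v x)]ipC !ipZl//.
  rewrite [ip v (fun x => t * v x)]ipC ipZl// [ip v u]ipC => h; apply: le_trans h _.
  by rewrite le_eqVlt; apply/orP; left; apply/eqP; ring.
have := ip_ge0 v; rewrite le_eqVlt => /predU1P[v0|v0].
  have [->|b0] := eqVneq (ip u v) 0; first by rewrite expr0n/= mulr_ge0// ip_ge0.
  (* With [ip v v] = 0 the quadratic in t is affine, and this t makes its value -1, a
     contradiction. *)
  have := H ((ip u u + 1) / (2 * ip u v)); rewrite -v0.
  rewrite (_ : _ + _ = -1); first by lra.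
  by field.
(* The minimiser of the quadratic in t. *)
have := H (ip u v / ip v v).
rewrite (_ : _ + _ = (ip u u * ip v v - ip u v ^+ 2) / ip v v); last first.
  by field; rewrite gt_eqF.
by rewrite pmulr_lge0 ?invr_gt0// subr_ge0.
Qed.

Lemma ip_CS_norm u v : L2 u -> L2 v -> `|ip u v| <= Num.sqrt (ip u u) * Num.sqrt (ip v v).
Proof.
move=> Lu Lv; rewrite -sqrtrM ?ip_ge0// -sqrtr_sqr ler_sqrt ?mulr_ge0 ?ip_ge0//.
exact: ip_CS.
Qed.

Definition cvgL2 (u : nat -> T -> R) v :=
  ip (u k \- v) (u k \- v) @[k --> \oo] --> 0.

(** Expand both arguments around their limits; Cauchy-Schwarz makes the three error terms vanish. *)
Lemma ip_cvg (u v : nat -> T -> R) u' v' :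
  (forall k, L2 (u k)) -> (forall k, L2 (v k)) -> L2 u' -> L2 v' ->
  cvgL2 u u' -> cvgL2 v v' -> ip (u k) (v k) @[k --> \oo] --> ip u' v'.
Proof.
move=> Lu Lv Lu' Lv' uu' vv'.
have LB k : L2 (u k \- u') by exact: L2B.
have LB' k : L2 (v k \- v') by exact: L2B.
have E k : ip (u k) (v k) = ip u' v' + (ip (u k \- u') (v k \- v') + (ip (u k \- u') v' + ip u' (v k \- v'))).
  by rewrite !(ipBl, ipBr)//; ring.
rewrite (funext E) -[X in _ --> X]addr0; apply: cvgD; first exact: cvg_cst.
have su : Num.sqrt (ip (u k \- u') (u k \- u')) @[k --> \oo] --> 0.
  by rewrite -sqrtr0; apply: continuous_cvg => //; exact: sqrt_continuous.
have sv : Num.sqrt (ip (v k \- v') (v k \- v')) @[k --> \oo] --> 0.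
  by rewrite -sqrtr0; apply: continuous_cvg => //; exact: sqrt_continuous.
apply/norm_cvg0P.
have S : Num.sqrt (ip (u k \- u') (u k \- u')) * Num.sqrt (ip (v k \- v') (v k \- v')) +
   (Num.sqrt (ip (u k \- u') (u k \- u')) * Num.sqrt (ip v' v') +
   Num.sqrt (ip u' u') * Num.sqrt (ip (v k \- v') (v k \- v'))) @[k --> \oo] --> 0.
  rewrite -[X in _ --> X](_ : 0 * 0 + (0 * Num.sqrt (ip v' v') + Num.sqrt (ip u' u') * 0) = 0); last by ring.
  apply: cvgD; first exact: cvgM.
  by apply: cvgD; apply: cvgM => //; exact: cvg_cst.
apply: (squeeze_cvgr _ (cvg_cst 0) S); near=> k; rewrite normr_ge0/=.
by rewrite (le_trans (ler_normD _ _))// lerD ?ip_CS_norm// (le_trans (ler_normD _ _))// lerD// ip_CS_norm.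
Unshelve. all: by end_near. Qed.

End L2.

(** * Completeness of L^2 for a measure of total mass 1 *)

Section limn_einf_bounds.
Context {R : realType}.
Local Open Scope ereal_scope.
Implicit Types a : nat -> \bar R.

Lemma limn_einf_le a (c : \bar R) M : (forall m, (M <= m)%N -> a m <= c) -> limn_einf a <= c.
Proof.
move=> ac; rewrite limn_einf_lim; apply: lime_le; first exact: is_cvg_einfs.
exists M => // m /= Mm; apply: le_trans (ac _ Mm).
by apply: ereal_inf_lbound; exists m => //=.
Qed.

Lemma limn_einf_ge0 a : (forall m, 0 <= a m) -> 0 <= limn_einf a.
Proof.
move=> a0; rewrite limn_einf_lim; apply: lime_ge; first exact: is_cvg_einfs.
by apply: nearW => m; apply: le_ereal_inf_tmp => _ [k _ <-].
Qed.

End limn_einf_bounds.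

Section L2_complete.
Context {R : realType} {d : measure_display} {T : measurableType d}
  (mu : {measure set T -> \bar R}).
Hypothesis mu1 : mu [set: T] = 1%E.
Implicit Types u v w : T -> R.
Local Notation L2 := (L2 mu).
Local Notation ip := (ip mu).

Lemma L2_cst (c : R) : L2 (cst c).
Proof.
split; first exact: measurable_cst.
by rewrite (eq_integral (cst (c ^+ 2)%:E))// integral_cst// mu1 mule1 ltry.
Qed.

Lemma L2_norm u : L2 u -> L2 (fun x => `|u x|).
Proof.
move=> [mu_u iu]; split; first exact: measurableT_comp.
by under eq_integral do rewrite real_normK ?num_real//.
Qed.

Lemma L2_integrable u : L2 u -> mu.-integrable [set: T] (EFin \o u).
Proof.
move=> Lu; apply: (@eq_integrable _ _ _ _ _ measurableT (EFin \o (u \* cst 1))).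
  by move=> x _ /=; rewrite mulr1.
by apply: mul_integrable => //; exact: L2_cst.
Qed.

Lemma integral_norm_le u : L2 u -> (\int[mu]_x `|u x|%:E <= (Num.sqrt (ip u u))%:E)%E.
Proof.
move=> Lu; have Ln := L2_norm Lu.
have := ip_CS_norm Ln (L2_cst 1).
have -> : ip (cst 1) (cst 1) = 1.
  by rewrite /ip /= mulr1 Rintegral_cst//= mul1r mu1.
have -> : ip (fun x => `|u x|) (fun x => `|u x|) = ip u u.
  by apply: eq_Rintegral => x _; rewrite -normrM -expr2 ger0_norm ?sqr_ge0.
rewrite sqrtr1 mulr1 -lee_fin; apply: le_trans.
have -> : (\int[mu]_x `|u x|%:E = (ip (fun x => `|u x|) (cst 1))%:E)%E.
  by rewrite EFin_ip//; [apply: eq_integral => x _ /=; rewrite mulr1|exact: L2_cst].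
by rewrite lee_fin ler_norm.
Qed.

(** Riesz-Fischer: a subsequence with summable increments converges almost everywhere, and Fatou
    turns the Cauchy estimate against later terms into one against the limit. Total mass 1 lets the
    L^2 norm bound the L^1 norm of the increments. *)
Lemma L2_complete (u : nat -> T -> R) : (forall k, L2 (u k)) ->
  (forall e : R, 0 < e -> exists N, forall k l, (N <= k)%N -> (N <= l)%N ->
     ip (u k \- u l) (u k \- u l) < e) ->
  exists2 v, L2 v & cvgL2 mu u v.
Proof.
move=> Lu cauchy.
(* [ip] is a squared norm: the bound 4^-(m+1) makes the increments at most 2^-(m+1) in norm, which
   is summable. *)
have /choice[N NP] : forall m : nat, exists N, forall k l, (N <= k)%N -> (N <= l)%N ->
     ip (u k \- u l) (u k \- u l) <= (4 ^- m.+1 : R).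
  move=> m; have [|N NP] := cauchy (4 ^- m.+1); first by rewrite invr_gt0 exprn_gt0.
  by exists N => k l Nk Nl; apply: ltW; exact: NP.
(* The running maximum lets every index [p l] with l >= m pass the threshold [N m]. *)
pose p m := (\max_(i < m.+1) N i)%N.
have Np m l : (m <= l)%N -> (N m <= p l)%N.
  move=> ml; have ml' : (m < l.+1)%N by [].
  exact: (leq_bigmax_cond (F := fun i : 'I_l.+1 => N i) (Ordinal ml')).
pose w m := u (p m).
have Lw m : L2 (w m) by exact: Lu.
pose du m := w m.+1 \- w m.
have Ldu m : L2 (du m) by exact: L2B.
have dusmall m : (\int[mu]_x `|du m x|%:E <= (2 ^- m.+1)%:E)%E.
  rewrite (le_trans (integral_norm_le (Ldu m)))// lee_fin.
  have -> : 2 ^- m.+1 = Num.sqrt (4 ^- m.+1) :> R.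
    have -> : 4 ^- m.+1 = (2 ^- m.+1) ^+ 2 :> R.
      have -> : 4 = 2 ^+ 2 :> R by rewrite expr2 -natrM.
      by rewrite exprVn exprAC.
    by rewrite sqrtr_sqr ger0_norm.
  rewrite ler_sqrt ?invr_ge0 ?exprn_ge0//; apply: NP; exact: Np.
have mdu m : measurable_fun [set: T] (fun x => `|du m x|%:E : \bar R).
  by apply/measurable_EFinP; apply: measurableT_comp => //; exact: (Ldu m).1.
pose S x := (\big[+%E/0%E]_(0 <= m <oo) (`|du m x|%:E))%E.
have mS : measurable_fun [set: T] S by exact: ge0_emeasurable_sum.
have Sfin : {ae mu, forall x, S x \is a fin_num}.
  have : mu.-integrable [set: T] S.
    apply/integrableP; split => //.
    rewrite (eq_integral S); last by move=> x _; rewrite gee0_abs//; apply: nneseries_ge0.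
    rewrite integral_nneseries//.
    apply: (@le_lt_trans _ _ (\big[+%E/0%E]_(0 <= m <oo) (2 ^- m.+1)%:E)%E).
      apply: lee_nneseries => [m _ _|m _]; last exact: dusmall.
      by apply: integral_ge0 => x _; rewrite lee_fin.
    rewrite (eq_eseriesr (g := fun m => (1 / (2 ^ m.+1)%:R)%:E)); last first.
      by move=> m _; rewrite div1r natrX.
    by rewrite (le_lt_trans (epsilon_trick0 _ _))// ltry.
  by move=> /integrable_ae => /(_ measurableT); apply: filterS => x; exact.
have wcvg : {ae mu, forall x, cvgn (w ^~ x)}.
  apply: filterS Sfin => x Sx.
  have : cvgn (series (fun m => du m x)).
    apply: normed_cvg.
    have -> : [normed series (fun m => du m x)] = (fun k => \sum_(0 <= m < k) `|du m x|) by [].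
    apply: nondecreasing_is_cvgn.
      by apply/nondecreasing_seqP => k; rewrite big_nat_recr//= lerDl.
    exists (fine (S x)) => _ [k _ <-].
    rewrite -lee_fin fineK// -sumEFin.
    exact: nneseries_lim_ge.
  move=> cs.
  have -> : w ^~ x = (fun k => w 0%N x + series (fun m => du m x) k).
    apply/funext => k; rewrite /series/= /du telescope_sumr//; ring.
  by apply: is_cvgD => //; exact: is_cvg_cst.
(* An upper limit is measurable without any convergence; the values where the subsequence diverges
   lie on a null set. *)
pose v x := fine (limn_esup (fun m => (w m x)%:E)).
have mv : measurable_fun [set: T] v.
  apply: measurableT_comp => //; apply: measurable_fun_limn_esup => m.
  by apply/measurable_EFinP; exact: (Lw m).1.
have wv : {ae mu, forall x, w m x @[m --> \oo] --> v x}.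
  apply: filterS wcvg => x /cvg_ex[l xl].
  have E : (w m x)%:E @[m --> \oo] --> l%:E by apply/cvg_EFin => //; near=> m.
  suff -> : v x = l by [].
  by rewrite /v is_cvg_limn_esupE; [rewrite (cvg_lim _ E)|apply/cvg_ex; exists l%:E].
have key M k : (N M <= k)%N -> (\int[mu]_x ((u k x - v x) ^+ 2)%:E <= (4 ^- M.+1)%:E)%E.
  move=> Mk.
  have -> : (\int[mu]_x ((u k x - v x) ^+ 2)%:E = \int[mu]_x limn_einf (fun m => ((u k x - w m x) ^+ 2)%:E))%E.
    apply: ge0_ae_eq_integral => //.
    - by apply/measurable_EFinP; apply: measurable_funX; apply: measurable_funB => //; exact: (Lu k).1.
    - rewrite /limn_einf; apply: measurableT_comp => //.
      apply: (measurable_fun_limn_esup (f := fun m x => - ((u k x - w m x) ^+ 2)%:E)%E) => m.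
      apply: measurableT_comp => //.
      by apply/measurable_EFinP; apply: measurable_funX; apply: measurable_funB; [exact: (Lu k).1|exact: (Lw m).1].
    - by move=> x _; rewrite lee_fin sqr_ge0.
    - by move=> x _; apply: limn_einf_ge0 => m; rewrite lee_fin sqr_ge0.
    - apply: filterS wv => x xv _; apply/esym.
      have E : ((u k x - w m x) ^+ 2)%:E @[m --> \oo] --> ((u k x - v x) ^+ 2)%:E.
        apply/cvg_EFin; first by near=> m.
        by apply: cvgM; apply: cvgB => //; exact: cvg_cst.
      by rewrite is_cvg_limn_einfE; [exact/cvg_lim|apply/cvg_ex; exists (((u k x - v x) ^+ 2)%:E)].
  apply: le_trans (fatou mu measurableT _ _) _.
  - move=> m; apply/measurable_EFinP; apply: measurable_funX.
    by apply: measurable_funB; [exact: (Lu k).1|exact: (Lw m).1].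
  - by move=> m x _; rewrite lee_fin sqr_ge0.
  apply: (limn_einf_le (M := M)) => m Mm.
  rewrite (eq_integral (fun x => ((u k \- w m) x * (u k \- w m) x)%:E)) => [|x _].
    by rewrite -EFin_ip; [rewrite lee_fin; apply: NP => //; exact: Np|exact: L2B|exact: L2B].
  by rewrite expr2.
have Luv M k : (N M <= k)%N -> L2 (u k \- v).
  move=> Mk; split; first by apply: measurable_funB => //; exact: (Lu k).1.
  by rewrite (le_lt_trans (key M k Mk))// ltry.
have Lv : L2 v.
  rewrite (_ : v = u (N 0%N) \- (u (N 0%N) \- v)).
    by apply: L2B => //; exact: (Luv 0%N).
  by apply/funext => x /=; rewrite subKr.
exists v => //; apply/cvgrPdist_le => e e0.
have [M Me] : exists M : nat, (4 : R) ^- M.+1 <= e.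
  have /cvgrPdist_le/(_ e e0)[M _ HM] := @cvg_expr R (4^-1) ltac:(by rewrite ger0_norm ?invr_ge0// invf_lt1// ltr1n).
  exists M; have := HM M.+1 (leqnSn M); rewrite sub0r normrN ger0_norm ?exprn_ge0 ?invr_ge0//.
  by rewrite exprVn.
exists (N M) => // k /= Mk; rewrite sub0r normrN ger0_norm ?ip_ge0//.
rewrite (le_trans _ Me)// -lee_fin EFin_ip; [|exact: (Luv M)|exact: (Luv M)].
apply: le_trans (key M k Mk); rewrite le_eqVlt; apply/orP; left; apply/eqP.
by apply: eq_integral => x _ /=; rewrite expr2.
Unshelve. all: by end_near. Qed.

End L2_complete.

(** * Smooth functions of subexponential growth *)

Section mvt.
Context {R : realType} {n : nat}.
Implicit Types (f : 'rV[R]_n -> R) (x v : 'rV[R]_n).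

Lemma is_derive_line f x v (s a : R) :
  is_derive (x + s *: v) v f a -> is_derive s (1 : R) (fun s : R => f (x + s *: v)) a.
Proof.
move=> [df fa].
have E : (fun h : R => h^-1 *: (((fun s : R => f (x + s *: v)) \o shift s) (h *: (1 : R)) - f (x + s *: v))) =
         (fun h : R => h^-1 *: ((f \o shift (x + s *: v)) (h *: v) - f (x + s *: v))).
  apply/funext => h /=; congr (_ *: (f _ - _)).
  by rewrite scalerDl addrCA -[h *: (1 : R)]/(h * 1) mulr1.
by split; rewrite /derivable /derive E.
Qed.

(** The mean value theorem on the line through x. Recording only |s| <= |t| treats both signs of t
    alike and suffices for growth bounds. *)
Lemma mvt_line f x v (t : R) : (forall y, derivable f y v) ->
  exists2 s : R, `|s| <= `|t| & f (x + t *: v) - f x = t * 'D_v f (x + s *: v).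
Proof.
move=> df.
pose g s := f (x + s *: v).
have dg s : is_derive s (1 : R) g ('D_v f (x + s *: v)).
  by apply: is_derive_line; exact: DeriveDef.
have cg : continuous g.
  by move=> s; apply/differentiable_continuous/derivable1_diffP; case: (dg s).
have [t0|t0] := leP 0 t.
  have [s /= + E] := @MVT_segment R g _ 0 t t0 (fun s _ => dg s) ltac:(by apply: continuous_subspaceT => s; exact: cg).
  rewrite in_itv/= => /andP[s0 st]; exists s; first by rewrite !ger0_norm.
  by move: E; rewrite /g scale0r addr0 subr0 mulrC.
have [s /= + E] := @MVT_segment R g _ t 0 (ltW t0) (fun s _ => dg s) ltac:(by apply: continuous_subspaceT => s; exact: cg).
rewrite in_itv/= => /andP[ts s0]; exists s; first by rewrite ler0_norm// ler0_norm ?lerN2// ltW.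
apply: oppr_inj; rewrite opprB; move: E; rewrite /g scale0r addr0 sub0r => ->.
by rewrite mulrN mulrC.
Qed.

Lemma enorm_le_sum x : enorm x <= \sum_(i < n) `|x ord0 i|.
Proof.
rewrite /enorm -[leRHS]ger0_norm ?sumr_ge0// -sqrtr_sqr ler_sqrt ?sqr_ge0//.
rewrite expr2 mulr_suml; apply: ler_sum => i _.
rewrite -real_normK ?num_real// expr2 ler_wpM2l//.
exact: abs_coord_le_sum.
Qed.

Lemma subexponential_growth f : subexponential f -> exists C c : R, forall x, `|f x| <= C * expgrowth c x.
Proof.
move=> [C [c fC]]; exists `|C|, `|c| => x; rewrite (le_trans (fC x))//.
apply: (@le_trans _ _ (`|C| * expR (c * enorm x))).
  by rewrite ler_wpM2r ?expR_ge0// ler_norm.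
rewrite ler_wpM2l// ler_expR (@le_trans _ _ (`|c| * enorm x))//.
  by rewrite ler_wpM2r ?ler_norm// sqrtr_ge0.
by rewrite ler_wpM2l// enorm_le_sum.
Qed.

Lemma derive_sum_partial f x v : differentiable f x ->
  'D_v f x = \sum_(j < n) v ord0 j * partial j f x.
Proof.
move=> df; rewrite deriveE// [v in LHS]row_sum_delta linear_sum; apply: eq_bigr => j _.
by rewrite linearZ /partial deriveE.
Qed.

Lemma reg_C1 f : tame f -> (forall x j, derivable f x (evec j)) ->
  (forall j, tame (partial j f)) -> reg f (fun j => partial j f).
Proof.
move=> tf df tp; split => //.
  have /choice[C /= /choice[c CP]] : forall j, exists C c, [/\ 0 <= C, 0 <= c & forall x, `|partial j f x| <= C * expgrowth c x].
    by move=> j; exact: tame_bound.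
  (* The sums dominate all the nonnegative [C j] and [c j] at once, so one pair of constants serves
     every direction. *)
  pose K := \sum_j C j; pose k := \sum_j c j.
  have K0 : 0 <= K by apply: sumr_ge0 => j _; case: (CP j).
  have k0 : 0 <= k by apply: sumr_ge0 => j _; case: (CP j).
  exists (K * expR k), k => j x t t1.
  have [s st ->] := mvt_line x t (fun y => df y j).
  rewrite normrM ler_wpM2l//; have [Cj cj H] := CP j.
  rewrite (le_trans (H _))// -mulrA; apply: ler_pM => //; first exact: ltW (expgrowth_gt0 _ _).
    by rewrite /K (bigD1 j)//= lerDl sumr_ge0// => i _; case: (CP i).
  apply: (@le_trans _ _ (expgrowth k (x + s *: evec j))).
    by apply: le_expgrowth; rewrite /k (bigD1 j)//= lerDl sumr_ge0// => i _; case: (CP i).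
  rewrite (le_trans (expgrowth_shift _ _ _ k0))// ler_wpM2r ?(ltW (expgrowth_gt0 _ _))//.
  by rewrite ler_expR ler_piMr// (le_trans st).
by move=> j; apply: aeW => x; exact: DeriveDef.
Qed.

(** Growth passes from the gradient to f by the mean value theorem on the segment from 0 to x; the
    extra 1 in the exponent absorbs the factor |x_j|. *)
Lemma tame_C1 f : (forall x, differentiable f x) ->
  (forall j, exists C c : R, forall x, `|partial j f x| <= C * expgrowth c x) -> tame f.
Proof.
move=> df fC; split.
  by apply: continuous_measurable_row => x; exact: differentiable_continuous.
have /choice[C /= /choice[c CP]] : forall j, exists C c, [/\ 0 <= C, 0 <= c & forall x, `|partial j f x| <= C * expgrowth c x].
  move=> j; have [C [c h]] := fC j; exists `|C|, `|c|; split => // x.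
  rewrite (le_trans (h x))// (@le_trans _ _ (`|C| * expgrowth c x))//.
    by rewrite ler_wpM2r ?(ltW (expgrowth_gt0 _ _))// ler_norm.
  by rewrite ler_wpM2l// le_expgrowth// ler_norm.
pose K := \sum_j C j; pose k := \sum_j c j.
have K0 : 0 <= K by apply: sumr_ge0 => j _; case: (CP j).
have k0 : 0 <= k by apply: sumr_ge0 => j _; case: (CP j).
exists (`|f 0| + K), (1 + k) => x.
have [|s] := @mvt_line f 0 x 1; first by move=> y; exact: diff_derivable.
rewrite normr1 => s1; rewrite scale1r !add0r mul1r derive_sum_partial// => E.
rewrite (_ : f x = f 0 + (f x - f 0)); last by rewrite addrC subrK.
rewrite (le_trans (ler_normD _ _))// mulrDl lerD//.
  by rewrite ler_peMr// -expR0 ler_expR mulr_ge0 ?sumr_ge0// addr_ge0.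
rewrite {}E (le_trans (ler_norm_sum _ _ _))// mulr_suml ler_sum// => j _.
have [Cj cj H] := CP j; rewrite normrM mulrC.
apply: (@le_trans _ _ (C j * expgrowth k x * expgrowth 1 x)); last first.
  by rewrite -mulrA -expgrowthD addrC.
apply: ler_pM => //.
  rewrite (le_trans (H _))// ler_wpM2l//.
  apply: (@le_trans _ _ (expgrowth k (s *: x))).
    by apply: le_expgrowth; rewrite /k (bigD1 j)//= lerDl sumr_ge0// => i _; case: (CP i).
  rewrite ler_expR ler_wpM2l//; apply: ler_sum => i _.
  by rewrite mxE normrM ler_piMl.
rewrite /expgrowth mul1r (le_trans (abs_coord_le_sum x j))//.
by rewrite (le_trans _ (expR_ge1Dx _))// lerDr.
Qed.

Lemma continuous_supp_bounded f (K : set 'rV[R]_n) : compact K -> continuous f ->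
  (forall x, ~ K x -> f x = 0) -> exists M, forall x, `|f x| <= M.
Proof.
move=> cK cf f0.
have cfK : {within K, continuous f} by exact: continuous_subspaceT.
have /compact_bounded[M [_ HM]] := continuous_compact cfK cK.
exists (`|M| + 1) => x; have [Kx|Kx] := pselect (K x).
  by apply: (HM (`|M| + 1)); [rewrite ltr_pwDr// ler_norm|exists x].
by rewrite f0// normr0 addr_ge0.
Qed.

Lemma tame_supp f (K : set 'rV[R]_n) : compact K -> continuous f ->
  (forall x, ~ K x -> f x = 0) -> tame f.
Proof.
move=> cK cf f0; have [M HM] := continuous_supp_bounded cK cf f0.
split; first exact: continuous_measurable_row.
by exists M, 0 => x; rewrite /expgrowth mul0r expR0 mulr1.
Qed.

Lemma partial_supp f (K : set 'rV[R]_n) j : closed K ->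
  (forall x, ~ K x -> f x = 0) -> forall x, ~ K x -> partial j f x = 0.
Proof.
move=> cK f0 x Kx; rewrite /partial -(derive_cst (0 : R) x (delta_mx ord0 j)).
apply: near_eq_derive.
have : nbhs x (~` K) by apply: open_nbhs_nbhs; split => //; exact: closed_openC.
by apply: filterS => y Ky; rewrite f0.
Qed.

Lemma test_functionP f : test_function f ->
  exists K, [/\ compact K, closed K, forall x, ~ K x -> f x = 0,
   forall x, differentiable f x & forall j, continuous (partial j f)].
Proof.
move=> [Cf cK]; set K := closure _ in cK; exists K.
have f0 x : ~ K x -> f x = 0.
  by move=> Kx; apply/eqP; apply: contra_notT Kx => fx; exact: subset_closure.
have clK : closed K by exact: closed_closure.
have [df Cp] := Cf 1%N.
by split.
Qed.

Lemma reg_supp f (K : set 'rV[R]_n) : compact K -> closed K -> (forall x, ~ K x -> f x = 0) ->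
  (forall x, differentiable f x) -> (forall j, continuous (partial j f)) ->
  reg f (fun j => partial j f).
Proof.
move=> cK clK f0 df cp; apply: reg_C1.
- apply: (tame_supp cK) => // x; exact: differentiable_continuous.
- by move=> x j; exact: diff_derivable.
- by move=> j; apply: (tame_supp cK) => // x Kx; exact: partial_supp f0 x Kx.
Qed.

Lemma reg_test f : test_function f -> reg f (fun j => partial j f).
Proof. by move=> /test_functionP[K [cK clK f0 df cp]]; exact: (reg_supp cK). Qed.

Lemma reg_C2 f : Cclass 2 f -> (forall j, subexponential (partial j f)) ->
  reg f (fun j => partial j f).
Proof.
move=> [df Cf] sf; apply: reg_C1.
- by apply: tame_C1 => // j; exact: subexponential_growth.
- by move=> x j; exact: diff_derivable.
- move=> j; split; last exact: subexponential_growth.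
  by apply: continuous_measurable_row => x; apply: differentiable_continuous; case: (Cf j).
Qed.

End mvt.

(** * From the Gaussian measure to the random vector z *)

Section transfer.
Context {R : realType} {n : nat} {d : measure_display} {Omega : measurableType d}
  {P : probability Omega R} {z : {RV P >-> 'rV[R]_n}}.
Hypothesis hz : forall A : set 'rV[R]_n, measurable A ->
       distribution P z A = gauss_row R n A.
Local Notation gam := (gauss_row R n).

Lemma ge0_integral_RV (g : 'rV[R]_n -> \bar R) :
  measurable_fun [set: 'rV[R]_n] g -> (forall x, (0 <= g x)%E) ->
  (\int[P]_w g (z w) = \int[gam]_x g x)%E.
Proof.
move=> mg g0; rewrite -[LHS](@ge0_integral_distribution _ _ _ _ _ P z g mg g0).
by apply: eq_measure_integral => A mA _; exact: hz.
Qed.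

Lemma integrable_RV (g : 'rV[R]_n -> R) :
  gam.-integrable [set: 'rV[R]_n] (EFin \o g) -> P.-integrable [set: Omega] (EFin \o (g \o z)).
Proof.
move=> /integrableP[/measurable_EFinP mg ig]; apply/integrableP; split.
  by apply/measurable_EFinP; exact: measurableT_comp.
rewrite (ge0_integral_RV (g := fun x => `|(g x)%:E|%E))//.
by apply: measurableT_comp => //; exact/measurable_EFinP.
Qed.

Lemma integral_RV (g : 'rV[R]_n -> R) :
  gam.-integrable [set: 'rV[R]_n] (EFin \o g) ->
  (\int[P]_w (g (z w))%:E = \int[gam]_x (g x)%:E)%E.
Proof.
move=> ig; have /integrableP[mg _] := ig.
rewrite -[LHS](@integral_distribution _ _ _ _ _ P z (EFin \o g) mg (integrable_RV ig)).
by apply: eq_measure_integral => A mA _; exact: hz.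
Qed.

(** Only the last expectation has an integrand of variable sign, so integrability is asked for it
    alone; the squares transfer to P as nonnegative integrals. *)
Lemma second_order_stein_gauss (f : 'I_n -> 'rV[R]_n -> R) (D : 'I_n -> 'I_n -> 'rV[R]_n -> R) :
  (forall i, measurable_fun [set: 'rV[R]_n] (f i)) ->
  (forall i j, measurable_fun [set: 'rV[R]_n] (D i j)) ->
  gam.-integrable [set: 'rV[R]_n] (EFin \o (fun x => \sum_(i < n) \sum_(j < n) D i j x * D j i x)) ->
  (\int[gam]_x ((\sum_(i < n) delta i (f i) (D i) x) ^+ 2)%:E =
   \int[gam]_x (\sum_(i < n) f i x ^+ 2)%:E +
   \int[gam]_x (\sum_(i < n) \sum_(j < n) D i j x * D j i x)%:E)%E ->
  second_order_stein P z f D.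
Proof.
move=> mf mD iD E; split; first exact: (integrable_RV iD).
have md i : measurable_fun [set: 'rV[R]_n] (delta i (f i) (D i)).
  apply: measurable_funB => //; apply: measurable_funM => //; exact: measurable_coord.
have H1 := integral_RV iD; cbv beta in H1.
have mf2 : measurable_fun [set: 'rV[R]_n] (fun x => (\sum_(i < n) f i x ^+ 2)%:E : \bar R).
  by apply/measurable_EFinP; apply: measurable_sum => i; exact: measurable_funX.
have H2 := ge0_integral_RV mf2 (fun x => ltac:(by rewrite lee_fin sumr_ge0// => i _; rewrite sqr_ge0)).
cbv beta in H2.
have mdd : measurable_fun [set: 'rV[R]_n] (fun x => ((\sum_(i < n) delta i (f i) (D i) x) ^+ 2)%:E : \bar R).
  by apply/measurable_EFinP; apply: measurable_funX; exact: measurable_sum.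
have H3 := ge0_integral_RV mdd (fun x => ltac:(by rewrite lee_fin sqr_ge0)).
have EE (X : Omega -> R) : ('E_P[X] = \int[P]_w (X w)%:E)%E by rewrite unlock.
rewrite !EE H1 H2 -E -H3.
by apply: eq_integral => w _; rewrite -sumrB.
Qed.

Lemma second_order_stein_reg (f : 'I_n -> 'rV[R]_n -> R) (D : 'I_n -> 'I_n -> 'rV[R]_n -> R) :
  (forall i, reg (f i) (D i)) -> second_order_stein P z f D.
Proof.
move=> rf.
have tf i : tame (f i) by case: (rf i).
have tD i j : tame (D i j) by case: (rf i).
have tDD : tame (fun x => \sum_(i < n) \sum_(j < n) D i j x * D j i x).
  by apply: tame_sum => i _; apply: tame_sum => j _; exact: tameM.
have tf2 : tame (fun x => \sum_(i < n) f i x ^+ 2).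
  by apply: tame_sum => i _; exact: tameM.
have td : tame (fun x => (\sum_(i < n) delta i (f i) (D i) x) ^+ 2).
  by apply: tameM; apply: tame_sum => i _; exact: tame_delta.
apply: second_order_stein_gauss.
- by move=> i; case: (tf i).
- by move=> i j; case: (tD i j).
- exact: tame_integrable.
- by rewrite -!EFin_gE// -EFinD second_order_identity.
Qed.

End transfer.

(** * Weak partial derivatives *)

Section weak.
Context {R : realType} {n : nat}.
Implicit Types (f g h chi : 'rV[R]_n -> R) (x v : 'rV[R]_n).
Local Notation gam := (gauss_row R n).
Local Notation lam := (lebesgue_row R n).

(** Only a directional derivative of g is at hand, so the one-variable chain rule is applied to s
    |-> g (x + s v) at s = 0. *)
Lemma is_derive_comp_real (F : R -> R) g x v (a b : R) :
  is_derive x v g a -> is_derive (g x) (1 : R) F b ->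
  is_derive x v (fun y => F (g y)) (b * a).
Proof.
move=> dg dF.
have dl : is_derive (0 : R) (1 : R) (fun s : R => g (x + s *: v)) a.
  by apply: is_derive_line; rewrite scale0r addr0.
have dF' : is_derive (g (x + 0 *: v)) (1 : R) F b by rewrite scale0r addr0.
have [dc cE] := is_derive1_comp dF' dl.
have E : (fun h : R => h^-1 *: (((fun y => F (g y)) \o shift x) (h *: v) - F (g x))) =
         (fun h : R => h^-1 *: (((F \o (fun s : R => g (x + s *: v))) \o shift (0 : R)) (h *: (1 : R)) -
            (F \o (fun s : R => g (x + s *: v))) 0)).
  apply/funext => h /=; rewrite addr0 scale0r addr0 (addrC _ x).
  by rewrite -[h *: (1 : R)]/(h * 1) mulr1.
split; first by rewrite /derivable E.
by rewrite -cE /derive E.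
Qed.

Lemma continuous_rowD f g : continuous f -> continuous g -> continuous (fun x => f x + g x).
Proof. by move=> cf cg; exact: (fun x : 'rV[R]_n => cvgD (cf x) (cg x)). Qed.

Lemma continuous_rowM f g : continuous f -> continuous g -> continuous (fun x => f x * g x).
Proof. by move=> cf cg; exact: (fun x : 'rV[R]_n => cvgM (cf x) (cg x)). Qed.

(* Integrating against the Gaussian measure, the test function chi / gdens turns
   Gaussian integration by parts into the weak derivative for Lebesgue measure. *)
Definition winv x : R := (gdens x)^-1.

Lemma winv_gt0 x : 0 < winv x.
Proof. by rewrite invr_gt0 gdens_gt0. Qed.

(** In this form, a constant times the exponential of a polynomial, the reciprocal density can be
    differentiated directly. *)
Lemma winvE : winv = (fun x => (normal_peak (1 : R)) ^- n * expR (\sum_(i < n) x ord0 i ^+ 2 / 2)).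
Proof.
apply/funext => x; rewrite /winv /gdens.
under eq_bigr do rewrite normal_pdf01E.
rewrite big_split/= -expR_sum prodr_const card_ord invfM; congr (_ * _).
by rewrite -expRN -sumrN; congr expR; apply: eq_bigr => i _; rewrite mulNr opprK.
Qed.

Let sumsq_fct : (fun x : 'rV[R]_n => \sum_(i < n) x ord0 i ^+ 2 / 2) =
  \sum_(i < n) (fun x : 'rV[R]_n => x ord0 i ^+ 2 / 2).
Proof. by apply/funext => x; rewrite fct_sumE. Qed.

Lemma differentiable_winv x : differentiable winv x.
Proof.
rewrite winvE; apply: differentiableM => //.
apply: (@differentiable_comp _ _ _ _ (fun x : 'rV[R]_n => \sum_(i < n) x ord0 i ^+ 2 / 2) expR).
  rewrite sumsq_fct; apply: differentiable_sum => i.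
  rewrite (_ : (fun x0 : 'rV[R]_n => x0 ord0 i ^+ 2 / 2) = (fun x0 => x0 ord0 i * x0 ord0 i * 2^-1)) //.
  by apply: differentiableM => //; apply: differentiableM; exact: differentiable_coord.
by apply/derivable1_diffP; exact: derivable_expR.
Qed.

Lemma partial_winv x j : is_derive x (evec j) winv (x ord0 j * winv x).
Proof.
have dS : is_derive x (evec j) (fun x : 'rV[R]_n => \sum_(i < n) x ord0 i ^+ 2 / 2) (x ord0 j).
  have dc i := is_derive_coord x i j.
  rewrite sumsq_fct.
  have H i : is_derive x (evec j) (fun x : 'rV[R]_n => x ord0 i ^+ 2 / 2) (x ord0 i * (i == j)%:R).
    apply: is_derive_eq.
    by rewrite /GRing.scale/=; field.
  apply: (is_derive_eq (is_derive_sum H)).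
  rewrite (bigD1 j)//= eqxx mulr1 big1 ?addr0// => i /negbTE ->.
  by rewrite mulr0.
have : is_derive x (evec j) (fun x : 'rV[R]_n => expR (\sum_(i < n) x ord0 i ^+ 2 / 2))
   (x ord0 j * expR (\sum_(i < n) x ord0 i ^+ 2 / 2)).
  apply: (is_derive_eq (is_derive_comp_real dS (is_derive_expR _))).
  by rewrite mulrC.
move=> H; rewrite winvE.
apply: (is_derive_eq (is_deriveZ (normal_peak (1 : R) ^- n) H)).
by rewrite /GRing.scale/= mulrCA.
Qed.

Lemma measurable_winv : measurable_fun [set: 'rV[R]_n] winv.
Proof.
by apply: continuous_measurable_row => x; apply: differentiable_continuous; exact: differentiable_winv.
Qed.

Lemma ge0_integral_lebesgue_row (g : 'rV[R]_n -> \bar R) :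
  measurable_fun [set: 'rV[R]_n] g -> (forall x, (0 <= g x)%E) ->
  (\int[lam]_x g x = \int[gam]_x (g x * (winv x)%:E))%E.
Proof.
move=> mg g0; rewrite ge0_integral_gauss//; last 2 first.
- by apply: emeasurable_funM => //; apply/measurable_EFinP; exact: measurable_winv.
- by move=> x; rewrite mule_ge0// lee_fin ltW// winv_gt0.
by apply: eq_integral => x _; rewrite -muleA -EFinM mulVf ?mule1// gt_eqF// gdens_gt0.
Qed.

(** [winv] is positive, so the change of measure acts separately on positive and negative parts;
    this is an identity of extended integrals. *)
Lemma integral_lebesgue_row g : measurable_fun [set: 'rV[R]_n] g ->
  (\int[lam]_x (g x)%:E = \int[gam]_x (g x * winv x)%:E)%E.
Proof.
move=> mg; have mEg : measurable_fun [set: 'rV[R]_n] (EFin \o g) by exact/measurable_EFinP.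
rewrite [LHS]integralE [RHS]integralE; congr (_ - _)%E.
  rewrite (ge0_integral_lebesgue_row (measurable_funepos mEg) (fun x => funepos_ge0 _ x)).
  apply: eq_integral => x _; rewrite !funeposE/= -!EFin_max -EFinM; congr EFin.
  by rewrite -{2}(mul0r (winv x)) maxr_pMl// ltW// winv_gt0.
rewrite (ge0_integral_lebesgue_row (measurable_funeneg mEg) (fun x => funeneg_ge0 _ x)).
apply: eq_integral => x _; rewrite !funenegE/= -!EFin_max -EFinM; congr EFin.
by rewrite -{2}(mul0r (winv x)) maxr_pMl ?(ltW (winv_gt0 _))// mulNr.
Qed.

Lemma tame_L2 g : tame g -> L2 gam g.
Proof.
move=> tg; apply: L2P; first by case: tg.
exact: (tame_integrable (tameM tg tg)).
Qed.

(** The reciprocal density is bounded on compact sets, and L^2 is contained in L^1 for a measure of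
    mass 1. *)
Lemma L2_locally_integrable g : L2 gam g -> locally_integrable_row g.
Proof.
move=> Lg; have mg := Lg.1; split=> // K cK.
have mK : measurable K.
  by apply: closed_measurable_row; apply: compact_closed => //; exact: norm_hausdorff.
have cw : {within K, continuous winv}.
  by apply: continuous_subspaceT => x; apply: differentiable_continuous; exact: differentiable_winv.
have /compact_bounded[M [_ HM]] := continuous_compact cw cK.
pose B := `|M| + 1.
have wB x : K x -> winv x <= B.
  move=> Kx; rewrite (le_trans (ler_norm _))//.
  by apply: (HM B); [rewrite ltr_pwDr// ler_norm|exists x].
have mgn : measurable_fun [set: 'rV[R]_n] (fun x => `|g x|%:E : \bar R).
  by apply/measurable_EFinP; exact: measurableT_comp.
have mr : measurable_fun [set: 'rV[R]_n] ((fun x => `|g x|%:E : \bar R) \_ K).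
  apply/(measurable_restrictT _ mK) => //; exact: measurable_funTS.
rewrite integral_mkcond ge0_integral_lebesgue_row//; last first.
  by move=> x; rewrite patchE; case: ifP.
apply: (@le_lt_trans _ _ (\int[gam]_x (B%:E * `|g x|%:E))%E).
  apply: ge0_le_integral => //.
  - by move=> x _; rewrite patchE; case: ifP => // _; rewrite ?mul0e// mule_ge0// lee_fin ltW// winv_gt0.
  - by apply: emeasurable_funM => //; apply/measurable_EFinP; exact: measurable_winv.
  - exact: measurable_funeM.
  move=> x _; rewrite patchE; case: ifPn => [|_]; last by rewrite mul0e mule_ge0// lee_fin addr_ge0.
  by rewrite inE => Kx; rewrite muleC lee_wpmul2r// lee_fin wB.
rewrite ge0_integralZl_EFin//; last by rewrite addr_ge0.
have /integrableP[_] := L2_integrable (@gauss_row_setT R n) Lg.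
by move=> h; rewrite lte_mul_pinfty// ?lee_fin ?addr_ge0.
Qed.

Lemma reg_zeta chi : test_function chi ->
  reg (fun x => chi x * winv x) (fun j x => partial j chi x * winv x + chi x * (x ord0 j * winv x)).
Proof.
move=> /test_functionP[K [cK clK f0 df cp]].
have cw : continuous winv by move=> x; apply: differentiable_continuous; exact: differentiable_winv.
have cchi : continuous chi by move=> x; exact: differentiable_continuous.
have dz x j : is_derive x (evec j) (fun x => chi x * winv x)
    (partial j chi x * winv x + chi x * (x ord0 j * winv x)).
  have hc : is_derive x (evec j) chi (partial j chi x) by split => //; exact: diff_derivable.
  apply: (is_derive_eq (is_deriveM hc (partial_winv x j))).
  by rewrite /GRing.scale/=; ring.
have E : (fun j x => partial j chi x * winv x + chi x * (x ord0 j * winv x)) =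
    (fun j => partial j (fun x => chi x * winv x)).
  by apply/funext => j; apply/funext => x; apply/esym; exact: derive_val.
rewrite E; apply: (reg_supp cK) => //.
- by move=> x Kx; rewrite f0// mul0r.
- by move=> x; apply: differentiableM => //; exact: differentiable_winv.
move=> j; rewrite -(congr1 (fun F => F j) E).
apply: continuous_rowD; first exact: continuous_rowM.
apply: continuous_rowM => //; apply: continuous_rowM => //.
exact: coord_continuous.
Qed.

(** For z = chi * winv the terms with x_j cancel and [delta j z Dz] is - partial j chi * winv. Thus
    [gauss_ibp] for each [phi k] is already the weak derivative formula, and continuity of [ip]
    carries it to g and h. *)
Lemma weak_partial_L2 (phi : nat -> 'rV[R]_n -> R) (D : nat -> 'I_n -> 'rV[R]_n -> R) g h j :
  (forall k, reg (phi k) (D k)) -> L2 gam g -> L2 gam h ->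
  cvgL2 gam phi g -> cvgL2 gam (fun k => D k j) h -> weak_partial j g h.
Proof.
move=> rphi Lg Lh phig Dh; split; [exact: L2_locally_integrable|exact: L2_locally_integrable|].
move=> chi tchi; have rz := reg_zeta tchi.
set z := fun x => chi x * winv x in rz.
set Dz := (fun j => _) in rz.
have Lphi k : L2 gam (phi k) by apply: tame_L2; case: (rphi k).
have LD k : L2 gam (D k j) by apply: tame_L2; case: (rphi k).
have Lz : L2 gam z by apply: tame_L2; case: rz.
have Ldz : L2 gam (delta j z Dz) by apply: tame_L2; exact: tame_delta.
have cst0 u : L2 gam u -> cvgL2 gam (fun=> u) u.
  move=> Lu; rewrite /cvgL2 (_ : (fun=> _) = fun=> 0); first exact: cvg_cst.
  by apply/funext => _; rewrite ipBl//; [rewrite subrr|exact: L2B].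
have c1 := ip_cvg (fun=> Ldz) Lphi Ldz Lg (cst0 _ Ldz) phig.
have c2 := ip_cvg (fun=> Lz) LD Lz Lh (cst0 _ Lz) Dh.
have E k : ip gam (delta j z Dz) (phi k) = ip gam z (D k j) by exact: (gauss_ibp j rz (rphi k)).
rewrite (funext E) in c1.
have {c1 c2 E} E : ip gam (delta j z Dz) g = ip gam z h by exact: cvg_unique c1 c2.
have [K [_ _ _ dchi cp]] := test_functionP tchi.
have cchi : continuous chi by move=> x; exact: differentiable_continuous.
rewrite !integral_lebesgue_row; last 2 first.
- by apply: measurable_funM; [exact: Lh.1|exact: continuous_measurable_row].
- by apply: measurable_funM; [exact: Lg.1|exact: continuous_measurable_row].
transitivity (- ip gam (delta j z Dz) g)%:E.
  rewrite -mulN1r -ipZl// EFin_ip//; last exact: L2Z.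
  apply: eq_integral => x _; congr EFin.
  by rewrite /delta /z /Dz; ring.
rewrite E EFinN EFin_ip//; congr (- _)%E; apply: eq_integral => x _; congr EFin.
by rewrite /z; ring.
Qed.
End weak.

(** * Smooth bumps approximating indicators of open boxes *)

Section smooth_step.
Context {R : realType}.
Implicit Types (P Q : {poly R}) (t : R).

(* With P ranging over all polynomials this family is closed under
   differentiation, which gives smoothness by induction. *)
Definition sstep P t : R := if 0 < t then P.[t^-1] * expR (- t^-1) else 0.

(** With s = 1 / t, the derivative in t of P(s) exp(-s) is (P(s) - P'(s)) s^2 exp(-s). *)
Definition sstep_der P : {poly R} := (P - P^`()) * 'X^2.

(** The inequality t <= exp t at t = s / (k + 1), raised to the power k + 1. *)
Lemma exprn_expRN_le k (s : R) : 0 <= s -> s ^+ k.+1 * expR (- s) <= k.+1%:R ^+ k.+1.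
Proof.
move=> s0; have k0 : 0 < k.+1%:R :> R by [].
rewrite expRN ler_pdivrMr ?expR_gt0//.
pose t := s / k.+1%:R; have -> : s = k.+1%:R * t by rewrite /t mulrC divfK// gt_eqF.
have t0 : 0 <= t by rewrite divr_ge0// ltW.
rewrite expRM_natl exprMn; apply: ler_wpM2l; first exact: exprn_ge0.
apply: lerXn2r; rewrite ?nnegrE ?expR_ge0//.
by rewrite (le_trans _ (expR_ge1Dx _))// lerDr.
Qed.

(** A linear bound is enough to control the difference quotient at 0, because it is available for
    every polynomial, in particular for P times 'X. *)
Lemma sstep_le P : exists2 C : R, 0 <= C & forall t, `|sstep P t| <= C * `|t|.
Proof.
exists (\sum_(k < size P) `|P`_k| * k.+1%:R ^+ k.+1).
  by apply: sumr_ge0 => k _; rewrite mulr_ge0// exprn_ge0.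
move=> t; rewrite /sstep; case: ifPn => [t0|_]; last by rewrite normr0 mulr_ge0// sumr_ge0// => k _; rewrite mulr_ge0// exprn_ge0.
have s0 : 0 < t^-1 by rewrite invr_gt0.
rewrite normrM (gtr0_norm (expR_gt0 _)) (gtr0_norm t0) horner_coef.
apply: (@le_trans _ _ (\sum_(k < size P) (`|P`_k| * t^-1 ^+ k) * expR (- t^-1))).
  rewrite -mulr_suml ler_wpM2r ?expR_ge0// (le_trans (ler_norm_sum _ _ _))//.
  by apply: ler_sum => k _; rewrite normrM [`|_ ^+ _|]ger0_norm// exprn_ge0// ltW.
rewrite mulr_suml; apply: ler_sum => k _; rewrite -!mulrA ler_wpM2l//.
rewrite -ler_pdivrMr// mulrC mulrA -exprS.
by apply: exprn_expRN_le; exact: ltW.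
Qed.

Lemma sstep_le0 P t : t <= 0 -> sstep P t = 0.
Proof. by move=> t0; rewrite /sstep ltNge t0. Qed.

Lemma is_derive_sstep P t : is_derive t (1 : R) (sstep P) (sstep (sstep_der P) t).
Proof.
have [t0|t0|t0] := ltgtP 0 t.
- have H : is_derive t (1 : R) (fun t => P.[t^-1] * expR (- t^-1)) (sstep (sstep_der P) t).
    have tN : t != 0 by rewrite gt_eqF.
    have dV : is_derive t (1 : R) (fun t : R => t^-1) (- t ^- 2).
      by apply: (is_derive_eq (is_deriveV tN (is_derive_id _ _))); rewrite /GRing.scale/= mulr1.
    have dE : is_derive t (1 : R) (fun t : R => expR (- t^-1)) (expR (- t^-1) * (- - t ^- 2)).
      by apply: (is_derive1_comp (f := expR) (g := fun t : R => - t^-1)).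
    have dP : is_derive t (1 : R) (fun t : R => P.[t^-1]) (P^`().[t^-1] * - t ^- 2).
      by apply: (is_derive1_comp (f := horner P) (g := fun t : R => t^-1)).
    apply: (is_derive_eq (is_deriveM dP dE)).
    rewrite /sstep t0 /sstep_der !hornerE /GRing.scale/=; field.
    exact: tN.
  have E : \near t, P.[t^-1] * expR (- t^-1) = sstep P t.
    by near=> u; rewrite /sstep ifT//; near: u; exact: lt_nbhsr.
  exact: near_eq_is_derive E H.
- rewrite sstep_le0 ?ltW//.
  have E : \near t, cst (0 : R) t = sstep P t.
    by near=> u; rewrite sstep_le0// ltW//; near: u; exact: lt_nbhsl.
  exact: near_eq_is_derive E (is_derive_cst (0 : R) t 1).
rewrite sstep_le0 -t0//.
(* For h > 0 the quotient [sstep P h] / h is [sstep (P * 'X) h], so its linear bound gives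
   derivative 0 at the origin. *)
have [C C0 HC] := sstep_le (P * 'X).
have E : (fun h : R => h^-1 *: ((sstep P \o shift 0) (h *: (1 : R)) - sstep P 0)) @ 0^' --> (0 : R).
  apply/cvgrPdist_le => e e0.
  have C1 : 0 < C + 1 by rewrite ltr_wpDl.
  near=> h; rewrite sub0r normrN /= addr0 -[h *: (1 : R)]/(h * 1) mulr1.
  rewrite (sstep_le0 _ (lexx 0)) subr0 -[h^-1 *: _]/(h^-1 * _).
  have he : `|h| <= e / (C + 1).
    near: h; apply: nbhs_dnbhs; apply/nbhs_ballP; exists (e / (C + 1)) => /=; first by rewrite divr_gt0.
    by move=> h; rewrite /ball/= sub0r normrN => /ltW.
  have [h0|h0] := leP h 0; first by rewrite (sstep_le0 _ h0) mulr0 normr0 ltW.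
  rewrite (_ : h^-1 * sstep P h = sstep (P * 'X) h); last first.
    by rewrite /sstep h0 hornerM hornerX mulrA [h^-1 * _]mulrC.
  rewrite (le_trans (HC _))// (@le_trans _ _ ((C + 1) * `|h|))//.
    by rewrite ler_wpM2r// lerDl.
  by rewrite mulrC -ler_pdivlMr.
split; first by apply/cvg_ex; exists 0.
exact/cvg_lim.
Unshelve. all: by end_near. Qed.

End smooth_step.

Section Cclass_theory.
Context {R : realType} {n : nat}.
Implicit Types (f g : 'rV[R]_n -> R) (x : 'rV[R]_n).

Lemma Cclass_continuous k f : Cclass k f -> continuous f.
Proof. by case: k => [//|k] [df _] x; exact: differentiable_continuous. Qed.

Lemma Cclass_partial k f j : Cclass k.+1 f -> Cclass k (partial j f).
Proof. by move=> [_]; exact. Qed.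

Lemma Cclass_differentiable k f : Cclass k.+1 f -> forall x, differentiable f x.
Proof. by case. Qed.

Lemma CclassS k f : Cclass k.+1 f -> Cclass k f.
Proof.
elim: k f => [|k IH] f; first by move=> Cf; exact: Cclass_continuous Cf.
by move=> [df Cf]; split => // j; exact: IH.
Qed.

Lemma Cclass_cst k (c : R) : Cclass k (cst c : 'rV[R]_n -> R).
Proof.
elim: k c => [|k IH] c; first by move=> x; exact: cst_continuous.
split => [x|j]; first exact: differentiable_cst.
rewrite (_ : partial j _ = cst 0)//.
by apply/funext => x; exact: derive_cst.
Qed.

Lemma CclassD k f g : Cclass k f -> Cclass k g -> Cclass k (fun x => f x + g x).
Proof.
elim: k f g => [|k IH] f g; first exact: continuous_rowD.
move=> Cf Cg; have df := Cclass_differentiable Cf; have dg := Cclass_differentiable Cg.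
split => [x|j]; first exact: differentiableD.
rewrite (_ : partial j _ = fun x => partial j f x + partial j g x).
  by apply: IH; exact: Cclass_partial.
by apply/funext => x; rewrite /partial deriveD//; exact: diff_derivable.
Qed.

Lemma CclassM k f g : Cclass k f -> Cclass k g -> Cclass k (fun x => f x * g x).
Proof.
elim: k f g => [|k IH] f g; first exact: continuous_rowM.
move=> Cf Cg; have df := Cclass_differentiable Cf; have dg := Cclass_differentiable Cg.
split => [x|j]; first exact: differentiableM.
rewrite (_ : partial j _ = fun x => f x * partial j g x + g x * partial j f x).
  by apply: CclassD; apply: IH; solve [exact: CclassS|exact: Cclass_partial].
by apply/funext => x; rewrite /partial deriveM//; exact: diff_derivable.
Qed.

Lemma is_derive_affine (c d : R) (i j : 'I_n) x :
  is_derive x (evec j) (fun x : 'rV[R]_n => c * x ord0 i + d) (c * (i == j)%:R).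
Proof.
have dc := is_derive_coord x i j.
apply: (is_derive_eq (is_deriveD (is_deriveZ c dc) (is_derive_cst d x (evec j)))).
by rewrite addr0.
Qed.

Lemma Cclass_sstep k (P : {poly R}) (c d : R) (i : 'I_n) :
  Cclass k (fun x => sstep P (c * x ord0 i + d)).
Proof.
have dd (Q : {poly R}) x : differentiable (fun x : 'rV[R]_n => sstep Q (c * x ord0 i + d)) x.
  apply: (@differentiable_comp _ _ _ _ (fun x : 'rV[R]_n => c * x ord0 i + d) (sstep Q)).
    apply: differentiableD => //; apply: differentiableM => //; exact: differentiable_coord.
  by apply/derivable1_diffP; case: (is_derive_sstep Q (c * x ord0 i + d)).
elim: k P => [|k IH] P; first by move=> x; exact: differentiable_continuous.
split => // j.
rewrite (_ : partial j _ = fun x => cst (c * (i == j)%:R) x * sstep (sstep_der P) (c * x ord0 i + d)).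
  by apply: CclassM; [exact: Cclass_cst|exact: IH].
apply/funext => x /=; rewrite mulrC.
exact: (@derive_val _ _ _ _ _ _ _ (is_derive_comp_real (is_derive_affine c d i j x) (is_derive_sstep P _))).
Qed.

Lemma Cclass_prod k (I : Type) (s : seq I) (P : pred I) (f : I -> 'rV[R]_n -> R) :
  (forall i, P i -> Cclass k (f i)) -> Cclass k (fun x => \prod_(i <- s | P i) f i x).
Proof.
move=> Cf; rewrite (_ : (fun x => _) = \big[(fun a b x => a x * b x)/cst 1]_(i <- s | P i) f i).
  by elim/big_ind : _ => //; [exact: Cclass_cst|exact: CclassM].
apply/funext => x; elim: s => [|a s IH]; first by rewrite !big_nil.
by rewrite !big_cons; case: ifP => // _; rewrite IH.
Qed.

End Cclass_theory.

Section bump.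
Context {R : realType} {n : nat}.
Implicit Types (a b x : 'rV[R]_n).

Definition obox a b : set 'rV[R]_n := [set x | forall i, a ord0 i < x ord0 i < b ord0 i].

(** Since [sstep 1 t] tends to 1 as t grows, the factor m + 1 pushes the product to 1 inside the box
    while it stays 0 outside. The arguments are expanded to the affine form c x_i + d of
    [Cclass_sstep]. *)
Definition bump a b (m : nat) x : R :=
  \prod_(i < n) (sstep 1 (m.+1%:R * x ord0 i + - m.+1%:R * a ord0 i) *
                 sstep 1 (- m.+1%:R * x ord0 i + m.+1%:R * b ord0 i)).

Lemma sstep1_01 (t : R) : 0 <= sstep 1 t <= 1.
Proof.
rewrite /sstep; case: ifPn => [t0|_]; last by rewrite lexx ler01.
by rewrite hornerC mul1r expR_ge0/= -expR0 ler_expR oppr_le0 invr_ge0 ltW.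
Qed.

Lemma bump_01 a b m x : 0 <= bump a b m x <= 1.
Proof.
have s0 (t : R) : 0 <= sstep 1 t by case/andP: (sstep1_01 t).
apply/andP; split; first by apply: prodr_ge0 => i _; exact: mulr_ge0.
apply: prodr_ile1 => i _; have /andP[h1 h2] := sstep1_01 (m.+1%:R * x ord0 i + - m.+1%:R * a ord0 i).
have /andP[h3 h4] := sstep1_01 (- m.+1%:R * x ord0 i + m.+1%:R * b ord0 i).
by rewrite mulr_ge0//= mulr_ile1.
Qed.

Lemma bump_out a b m x : ~ obox a b x -> bump a b m x = 0.
Proof.
move=> /existsNP[i /negP]; rewrite negb_and -!leNgt => h.
have m0 : 0 < m.+1%:R :> R by [].
rewrite /bump (bigD1 i)//=; case/orP: h => h.
  rewrite (sstep_le0 _ (t := _ + - _ * _)) ?mul0r//.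
  by rewrite mulNr -mulrBr pmulr_rle0// subr_le0.
rewrite [X in _ * X * _](sstep_le0 _) ?mulr0 ?mul0r//.
by rewrite mulNr addrC -mulrBr pmulr_rle0// subr_le0.
Qed.

Lemma bump_in a b x : obox a b x -> bump a b m x @[m --> \oo] --> (1 : R).
Proof.
move=> abx.
(* On the box every factor is an exponential exp (-1 / t), so the product collapses to exp (- S / (m
   + 1)). *)
pose S := \sum_(i < n) ((x ord0 i - a ord0 i)^-1 + (b ord0 i - x ord0 i)^-1).
have E m : bump a b m x = expR (- (m.+1%:R^-1 * S)).
  have m0 : 0 < m.+1%:R :> R by [].
  rewrite /bump /S mulr_sumr -sumrN expR_sum; apply: eq_bigr => i _.
  have /andP[ax xb] := abx i.
  rewrite /sstep !ifT; last 2 first.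
  - by rewrite mulNr addrC -mulrBr mulr_gt0// subr_gt0.
  - by rewrite mulNr -mulrBr mulr_gt0// subr_gt0.
  rewrite !hornerC !mul1r -expRD; congr expR.
  have h1 : x ord0 i - a ord0 i != 0 by rewrite subr_eq0 gt_eqF.
  have h2 : b ord0 i - x ord0 i != 0 by rewrite subr_eq0 gt_eqF.
  set M := m.+1%:R.
  rewrite (_ : M * _ + - M * _ = M * (x ord0 i - a ord0 i)); last by ring.
  rewrite (_ : - M * _ + M * _ = M * (b ord0 i - x ord0 i)); last by ring.
  by rewrite !invfM; ring.
rewrite (funext E) -[X in _ --> X]expR0; apply: continuous_cvg; first exact: continuous_expR.
rewrite -oppr0 -(mul0r S); apply: cvgN; apply: cvgM; last exact: cvg_cst.
exact: cvg_harmonic.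
Qed.

Lemma test_function_bump a b m : test_function (bump a b m).
Proof.
split.
  by move=> k; apply: Cclass_prod => i _; apply: CclassM; exact: Cclass_sstep.
apply: bounded_closed_compact; last exact: closed_closure.
pose B : R := \sum_(i < n) (`|a ord0 i| + `|b ord0 i|).
have B0 : 0 <= B by apply: sumr_ge0 => i _; rewrite addr_ge0.
have cB : closed [set x : 'rV[R]_n | `|x| <= B].
  rewrite (_ : [set x | _] = closed_ball_ Num.norm (0 : 'rV[R]_n) B); first exact: closed_closed_ball_.
  by apply/seteqP; split => x; rewrite /closed_ball_/= sub0r normrN.
have sB : closure [set x | bump a b m x != 0] `<=` [set x : 'rV[R]_n | `|x| <= B].
  rewrite [X in _ `<=` X](closure_id _).1//; apply: closure_subset => x /= bx.
  have {bx} abx : obox a b x by apply: contrapT => /(bump_out m) bx0; rewrite bx0 eqxx in bx.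
  rewrite /Num.norm/= mx_normrE; apply: bigmax_le => // -[k i] _ /=.
  rewrite (ord1 k) (_ : (0 : 'I_1) = ord0)//; have /andP[ax xb] := abx i.
  apply: (@le_trans _ _ (`|a ord0 i| + `|b ord0 i|)); last first.
    by rewrite /B (bigD1 i)//= lerDl sumr_ge0// => l _; rewrite addr_ge0.
  have := ler_norm (b ord0 i); have := ler_norm (- a ord0 i); rewrite normrN => h1 h2.
  have h3 := normr_ge0 (a ord0 i); have h4 := normr_ge0 (b ord0 i).
  by rewrite ler_norml; apply/andP; split; lra.
exists B; split; first by rewrite num_real.
by move=> M BM x /sB /= xB; rewrite (le_trans xB)// ltW.
Qed.

End bump.

Section obox_generate.
Context {R : realType} {n : nat}.
Implicit Types (a b x : 'rV[R]_n).

Definition oboxes : set (set 'rV[R]_n) := [set B | exists a b, B = obox a b].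

Lemma oboxI a b a' b' : obox a b `&` obox a' b' =
  obox (\row_i Num.max (a ord0 i) (a' ord0 i)) (\row_i Num.min (b ord0 i) (b' ord0 i)).
Proof.
apply/seteqP; split => x /=.
  move=> [h h'] i; rewrite !mxE gt_max lt_min.
  by have /andP[-> ->] := h i; have /andP[-> ->] := h' i.
move=> h; split => i; have := h i; rewrite !mxE gt_max lt_min.
  by move=> /andP[/andP[-> _] /andP[-> _]].
by move=> /andP[/andP[_ ->] /andP[_ ->]].
Qed.

Lemma setI_closed_oboxes : setI_closed oboxes.
Proof. by move=> _ _ [a [b ->]] [a' [b' ->]]; rewrite oboxI; eexists; eexists. Qed.

Lemma measurable_obox a b : measurable (obox a b).
Proof.
apply: (measurable_row_coord (B := fun i => [set t | a ord0 i < t < b ord0 i])) => i.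
rewrite (_ : [set t | _] = `]a ord0 i, b ord0 i[%classic)//.
Qed.

Lemma bound_coord x : exists N : nat, forall i, - N%:R < x ord0 i < N%:R.
Proof.
exists (Num.trunc (\sum_(i < n) `|x ord0 i|)).+1 => i.
rewrite -ltr_norml (le_lt_trans (abs_coord_le_sum x i))//.
by rewrite truncnS_gt.
Qed.

(** It suffices to treat the preimage of an open interval under one coordinate; such a slab is the
    union over N of the boxes whose other sides are (-N, N). *)
Lemma measurable_row_obox (A : set 'rV[R]_n) : measurable A -> <<s oboxes >> A.
Proof.
move: A; apply: smallest_sub; first exact: smallest_sigma_algebra.
rewrite -bigcup_seq/=; apply: bigcup_sub => i _ _ [Y mY <-]; rewrite setTI.
have {mY} : <<s @RGenOpens.G R >> Y.
  by have : (@ocitv R).-sigma.-measurable Y := mY; rewrite RGenOpens.measurableE.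
move: Y; apply: smallest_sub.
  split => [|Y HY|F HF].
  - by rewrite preimage_set0; exact: sigma_algebra0.
  - by rewrite setTD preimage_setC -setTD; exact: sigma_algebraCD.
  - by rewrite preimage_bigcup; exact: sigma_algebra_bigcup.
move=> _ [a [b ->]] /=.
rewrite (_ : _ @^-1` _ = \bigcup_N obox
  (\row_k if k == i then a else - N%:R) (\row_k if k == i then b else N%:R)).
  apply: sigma_algebra_bigcup => N; apply: sub_sigma_algebra.
  by eexists; eexists.
apply/seteqP; split => x /=.
  rewrite in_itv/= => xab; have [N HN] := bound_coord x; exists N => // k.
  by rewrite !mxE; case: eqP => [->|].
by move=> [N _ /(_ i)]; rewrite !mxE eqxx in_itv.
Qed.

End obox_generate.

(** * Almost everywhere uniqueness of weak derivatives *)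

Section weak_unique.
Context {R : realType} {n : nat}.
Implicit Types (u h v chi : 'rV[R]_n -> R) (a b x : 'rV[R]_n).
Local Notation lam := (lebesgue_row R n).

(** These boxes exhaust R^n, and a locally integrable function is integrable on each of them. *)
Let D (N : nat) : set 'rV[R]_n := obox (const_mx (- N%:R)) (const_mx N%:R).

Lemma locally_integrable_obox u a b : locally_integrable_row u ->
  lam.-integrable (obox a b) (EFin \o u).
Proof.
move=> [mu_u iu].
pose B : R := \sum_(i < n) (`|a ord0 i| + `|b ord0 i|).
pose K : set 'rV[R]_n := closed_ball_ Num.norm (0 : 'rV[R]_n) B.
have clK : closed K by exact: closed_closed_ball_.
have cK : compact K.
  apply: bounded_closed_compact => //; exists B; split; first by rewrite num_real.
  by move=> M BM x; rewrite /K /closed_ball_/= sub0r normrN => xB; rewrite (le_trans xB)// ltW.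
have B0 : 0 <= B by apply: sumr_ge0 => i _; rewrite addr_ge0.
have mK : measurable K by exact: closed_measurable_row.
apply: (integrableS mK); first exact: measurable_obox.
  move=> x abx; rewrite /K /closed_ball_ /= sub0r normrN /Num.norm/= mx_normrE; apply: bigmax_le => // -[k i] _ /=.
  rewrite (ord1 k) (_ : (0 : 'I_1) = ord0)//; have /andP[ax xb] := abx i.
  apply: (@le_trans _ _ (`|a ord0 i| + `|b ord0 i|)); last first.
    by rewrite /B (bigD1 i)//= lerDl sumr_ge0// => l _; rewrite addr_ge0.
  have := ler_norm (b ord0 i); have := ler_norm (- a ord0 i); rewrite normrN => h1 h2.
  have h3 := normr_ge0 (a ord0 i); have h4 := normr_ge0 (b ord0 i).
  by rewrite ler_norml; apply/andP; split; lra.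
apply/integrableP; split; last exact: iu.
by apply/measurable_EFinP; exact: measurable_funTS.
Qed.

Lemma integral_bump u a b m : locally_integrable_row u ->
  (\int[lam]_x (u x * bump a b m x)%:E = \int[lam]_(x in obox a b) (u x * bump a b m x)%:E)%E.
Proof.
move=> lu; rewrite [RHS]integral_mkcond; apply: eq_integral => x _.
rewrite patchE; case: ifPn => //; rewrite notin_setE => /(bump_out m) ->.
by rewrite mulr0.
Qed.

Lemma measurable_bump a b m : measurable_fun [set: 'rV[R]_n] (bump a b m).
Proof.
have [Cb _] := test_function_bump a b m.
exact: continuous_measurable_row (Cb 0%N).
Qed.

Lemma integrable_bump u a b m : locally_integrable_row u ->
  lam.-integrable (obox a b) (fun x => (u x * bump a b m x)%:E).
Proof.
move=> lu; have [mu_u _] := lu.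
apply: (le_integrable (measurable_obox a b) _ _ (locally_integrable_obox a b lu)).
  apply/measurable_EFinP; apply: measurable_funTS; apply: measurable_funM => //.
  exact: measurable_bump.
move=> x _ /=; rewrite lee_fin normrM ler_piMr//.
by have /andP[b0 b1] := bump_01 a b m x; rewrite ger0_norm.
Qed.

(** Test against the bumps and let m grow; bumps lie in [0, 1], so |u - h|, integrable on the box,
    dominates. *)
Lemma integral_obox_eq0 u h a b : locally_integrable_row u -> locally_integrable_row h ->
  (forall chi, test_function chi ->
    (\int[lam]_x (u x * chi x)%:E = \int[lam]_x (h x * chi x)%:E)%E) ->
  (\int[lam]_(x in obox a b) (u x - h x)%:E = 0)%E.
Proof.
move=> lu lh uh; have mo := measurable_obox a b.
have E m : (\int[lam]_(x in obox a b) ((u x - h x) * bump a b m x)%:E = 0)%E.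
  transitivity (\int[lam]_(x in obox a b) ((u x * bump a b m x)%:E - (h x * bump a b m x)%:E))%E.
    by apply: eq_integral => x _; rewrite mulrBl EFinB.
  have iu := integrable_bump a b m lu; have ih := integrable_bump a b m lh.
  rewrite integralB//; rewrite -!integral_bump// uh//; last exact: test_function_bump.
  by rewrite subee// integral_bump//; exact: integrable_fin_num.
have iv : lam.-integrable (obox a b) (fun x => (u x - h x)%:E).
  exact: (integrableB mo (locally_integrable_obox a b lu) (locally_integrable_obox a b lh)).
have [mu_u _] := lu; have [mh _] := lh.
have [|||||] := @dominated_convergence _ _ _ lam _ mo
  (fun m x => ((u x - h x) * bump a b m x)%:E) (fun x => (u x - h x)%:E)
  (fun x => `|(u x - h x)%:E|)%E.
- move=> m; apply/measurable_EFinP; apply: measurable_funTS; apply: measurable_funM => //.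
    exact: measurable_funB.
  exact: measurable_bump.
- by apply/measurable_EFinP; apply: measurable_funTS; exact: measurable_funB.
- apply: aeW => x abx; apply/cvg_EFin; first by near=> m.
  rewrite -[X in _ --> X]mulr1; apply: cvgM; first exact: cvg_cst.
  exact: bump_in.
- exact: integrable_abse.
- apply: aeW => x m _; rewrite lee_fin normrM ler_piMr//.
  by have /andP[b0 b1] := bump_01 a b m x; rewrite ger0_norm.
move=> _ _; rewrite (_ : [sequence _]_m = cst 0%E); last by apply/funext => m; rewrite /= E.
move=> c; apply/esym; apply: cvg_unique c => //; exact: cvg_cst.
Unshelve. all: by end_near. Qed.

(** Boxes are closed under intersection and generate the sigma-algebra, so a Dynkin argument gives u
    - h zero integral over every measurable part of (-N, N)^n, where it therefore vanishes almost
    everywhere. *)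
Lemma weak_unique u h : locally_integrable_row u -> locally_integrable_row h ->
  (forall chi, test_function chi ->
    (\int[lam]_x (u x * chi x)%:E = \int[lam]_x (h x * chi x)%:E)%E) ->
  {ae lam, forall x, u x = h x}.
Proof.
move=> lu lh uh.
have mD N : measurable (D N) by exact: measurable_obox.
have iv N : lam.-integrable (D N) (fun x => (u x - h x)%:E).
  exact: (integrableB (mD N) (locally_integrable_obox _ _ lu) (locally_integrable_obox _ _ lh)).
(* Cutting with [D N] makes u - h integrable, as countable additivity of a signed integral
   requires. *)
pose L N := [set A : set 'rV[R]_n | measurable A /\ (\int[lam]_(x in A `&` D N) (u x - h x)%:E = 0)%E].
have dL N : dynkin (L N).
  split.
  - by split => //; rewrite setTI; exact: integral_obox_eq0.
  - move=> A [mA A0]; split; first exact: measurableC.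
    have : (\int[lam]_(x in (A `&` D N) `|` (~` A `&` D N)) (u x - h x)%:E = 0)%E.
      by rewrite -setIUl setUv setTI; exact: integral_obox_eq0.
    rewrite integral_setU//=; [|exact: measurableI|by apply: measurableI => //; exact: measurableC| | ].
    + by rewrite A0 add0e.
    + by rewrite -setIUl setUv setTI; have /integrableP[] := iv N.
    + by rewrite disj_set2E -setIIl setICr set0I.
  - move=> F tF HF; split; first by apply: bigcup_measurable => k _; case: (HF k).
    rewrite setI_bigcupl integral_bigcup//.
    + by apply: eseries0 => k _ _; case: (HF k).
    + exact: trivIset_setIr.
    + by move=> k; apply: measurableI => //; case: (HF k).
    + apply: (integrableS (mD N)) => //; last by move=> x [k _ []].
      by apply: bigcup_measurable => k _; apply: measurableI => //; case: (HF k).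
have LA N A : measurable A -> (\int[lam]_(x in A `&` D N) (u x - h x)%:E = 0)%E.
  move=> /measurable_row_obox.
  rewrite -(setI_closed_g_dynkin_g_sigma_algebra (@setI_closed_oboxes R n)).
  suff : <<d @oboxes R n >> `<=` L N by move=> sub /sub [].
  apply: smallest_sub => // _ [a [b ->]]; split; first exact: measurable_obox.
  by rewrite /D oboxI; exact: integral_obox_eq0.
have aeN N : {ae lam, forall x, D N x -> (u x - h x)%:E = 0%E :> \bar R}.
  apply: (@integral_ae_eq _ _ _ lam _ (mD N) (cst 0%E) (fun x => (u x - h x)%:E)) => //.
  by move=> A AD mA; rewrite integral0 -(LA N A mA) setIidl.
have : {ae lam, forall x, forall N, D N x -> (u x - h x)%:E = 0%E :> \bar R}.
  exact: ae_foralln.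
apply: filterS => x H; have [N HN] := bound_coord x.
have /eqP : (u x - h x)%:E = 0%E :> \bar R by apply: (H N) => i; rewrite !mxE.
by rewrite eqe subr_eq0 => /eqP.
Qed.

Lemma weak_partial_unique j (g D1 D2 : 'rV[R]_n -> R) :
  weak_partial j g D1 -> weak_partial j g D2 -> {ae lam, forall x, D1 x = D2 x}.
Proof.
move=> [lg l1 H1] [_ l2 H2]; apply: weak_unique => // chi tchi.
by apply: oppe_inj; rewrite -H1// -H2.
Qed.

End weak_unique.

(** * Passage to the limit in L^2 *)

Section L2_limits.
Context {R : realType} {d : measure_display} {T : measurableType d}
  (mu : {measure set T -> \bar R}).
Implicit Types u v w : T -> R.
Local Notation L2 := (L2 mu).
Local Notation ip := (ip mu).
Local Notation cvgL2 := (cvgL2 mu).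

Lemma ae_eq_L2 u v : measurable_fun [set: T] v -> {ae mu, forall x, v x = u x} -> L2 u -> L2 v.
Proof.
move=> mv vu [mu_u iu]; split => //.
rewrite (_ : (\int[mu]_x (v x ^+ 2)%:E = \int[mu]_x (u x ^+ 2)%:E)%E)//.
apply: ge0_ae_eq_integral => //.
- by apply/measurable_EFinP; exact: measurable_funX.
- by apply/measurable_EFinP; exact: measurable_funX.
- by move=> x _; rewrite lee_fin sqr_ge0.
- by move=> x _; rewrite lee_fin sqr_ge0.
- by apply: filterS vu => x -> _.
Qed.

Lemma ae_eq_ip u v u' v' : L2 u -> L2 v -> L2 u' -> L2 v' ->
  {ae mu, forall x, u x = u' x} -> {ae mu, forall x, v x = v' x} -> ip u v = ip u' v'.
Proof.
move=> Lu Lv Lu' Lv' uu' vv'; congr fine.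
apply: ae_eq_integral => //.
- by have /integrableP[] := mul_integrable Lu Lv.
- by have /integrableP[] := mul_integrable Lu' Lv'.
- by apply: filterS2 uu' vv' => x -> -> _.
Qed.

(** The parallelogram identity with the square of u - v dropped. *)
Lemma ip_sqD u v : L2 u -> L2 v -> ip (u \+ v) (u \+ v) <= 2 * ip u u + 2 * ip v v.
Proof.
move=> Lu Lv; have := ip_ge0 mu (u \- v).
have Ld := L2D Lu Lv; have Lb := L2B Lu Lv.
rewrite ipBl// !ipBr// (ipDl Lu Lv Ld) ![ip _ (u \+ v)]ipC !(ipDl Lu Lv)// (ipC mu v u).
lra.
Qed.

(** This stands in for the triangle inequality, which squared norms satisfy up to the factor 2. *)
Lemma ip_dist u v w : L2 u -> L2 v -> L2 w ->
  ip (u \- v) (u \- v) <= 2 * ip (u \- w) (u \- w) + 2 * ip (v \- w) (v \- w).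
Proof.
move=> Lu Lv Lw.
have L1 : L2 (u \- w) by exact: L2B.
have L2' : L2 (fun x => (-1) * (v \- w) x) by apply: L2Z; exact: L2B.
have := ip_sqD L1 L2'.
rewrite (eq_ip mu (u' := u \- v) (v' := u \- v)); last 2 first.
- by move=> x /=; ring.
- by move=> x /=; ring.
move=> h; apply: le_trans h _; rewrite lerD2l ler_wpM2l//.
by rewrite le_eqVlt; apply/orP; left; apply/eqP; apply: eq_Rintegral => x _; ring.
Qed.

Lemma cvgL2_unique (u : nat -> T -> R) v w : (forall k, L2 (u k)) -> L2 v -> L2 w ->
  cvgL2 u v -> cvgL2 u w -> {ae mu, forall x, v x = w x}.
Proof.
move=> Lu Lv Lw uv uw.
have H k : ip (v \- w) (v \- w) <= 2 * ip (u k \- v) (u k \- v) + 2 * ip (u k \- w) (u k \- w).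
  rewrite (le_trans (ip_dist Lv Lw (Lu k)))//.
  have E a : ip (a \- u k) (a \- u k) = ip (u k \- a) (u k \- a).
    by apply: eq_Rintegral => x _ /=; ring.
  by rewrite !E.
have i0 : ip (v \- w) (v \- w) = 0.
  apply/eqP; rewrite eq_le ip_ge0 andbT.
  have c : (2 * ip (u k \- v) (u k \- v) + 2 * ip (u k \- w) (u k \- w)) @[k --> \oo] --> (2 * 0 + 2 * 0 : R).
    by apply: cvgD; apply: cvgM => //; exact: cvg_cst.
  rewrite (_ : 0 = 2 * 0 + 2 * 0 :> R); last by ring.
  by rewrite -(cvg_lim _ c)//; apply: limr_ge; [apply/cvg_ex; eexists; exact: c|exact: nearW].
have Lvw := L2B Lv Lw.
have : (\int[mu]_x `|((v x - w x) * (v x - w x))%:E| = 0)%E.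
  have := EFin_ip Lvw Lvw; rewrite i0 => E; rewrite [RHS]E; apply: eq_integral => x _.
  by rewrite gee0_abs// lee_fin -expr2 sqr_ge0.
have mvw : measurable_fun [set: T] (fun x => ((v x - w x) * (v x - w x))%:E).
  by apply/measurable_EFinP; apply: measurable_funM; exact: Lvw.1.
move=> /(ae_eq_integral_abs mu measurableT mvw); apply: filterS => x /(_ I).
by move=> /eqP; rewrite eqe mulf_eq0 orbb subr_eq0 => /eqP.
Qed.

Lemma cvgL2D (u v : nat -> T -> R) u' v' : (forall k, L2 (u k)) -> (forall k, L2 (v k)) ->
  L2 u' -> L2 v' -> cvgL2 u u' -> cvgL2 v v' -> cvgL2 (fun k => u k \+ v k) (u' \+ v').
Proof.
move=> Lu Lv Lu' Lv' uu' vv'.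
have c : (2 * ip (u k \- u') (u k \- u') + 2 * ip (v k \- v') (v k \- v')) @[k --> \oo] --> (0 : R).
  rewrite (_ : 0 = 2 * 0 + 2 * 0 :> R); last by ring.
  by apply: cvgD; apply: cvgM => //; exact: cvg_cst.
apply: (squeeze_cvgr _ (cvg_cst 0) c); apply: nearW => k; rewrite ip_ge0/=.
have L1 : L2 (u k \- u') by exact: L2B.
have L2' : L2 (v k \- v') by exact: L2B.
apply: le_trans (ip_sqD L1 L2'); rewrite le_eqVlt; apply/orP; left; apply/eqP.
by apply: eq_Rintegral => x _ /=; ring.
Qed.

Lemma cvgL2_cst u : cvgL2 (fun=> u) u.
Proof.
rewrite /cvgL2 (_ : (fun=> _) = fun=> 0); first exact: cvg_cst.
apply/funext => _; rewrite /ip (_ : \int[mu]_x _ = \int[mu]_x 0).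
  by rewrite /Rintegral integral0.
by apply: eq_Rintegral => x _ /=; rewrite subrr mul0r.
Qed.

Lemma cvgL2_sum (I : Type) (s : seq I) (u : nat -> I -> T -> R) (u' : I -> T -> R) :
  (forall k i, L2 (u k i)) -> (forall i, L2 (u' i)) -> (forall i, cvgL2 (u ^~ i) (u' i)) ->
  cvgL2 (fun k x => \sum_(i <- s) u k i x) (fun x => \sum_(i <- s) u' i x).
Proof.
move=> Lu Lu' uu'; elim: s => [|a s IH].
  rewrite (_ : (fun k => _) = (fun k => cst 0)); last first.
    by apply/funext => k; apply/funext => x; rewrite big_nil.
  rewrite (_ : (fun x => _) = cst 0); first exact: cvgL2_cst.
  by apply/funext => x; rewrite big_nil.
rewrite (_ : (fun k => _) = (fun k => u k a \+ (fun x => \sum_(i <- s) u k i x))); last first.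
  by apply/funext => k; apply/funext => x; rewrite big_cons.
rewrite (_ : (fun x => _) = u' a \+ (fun x => \sum_(i <- s) u' i x)); last first.
  by apply/funext => x; rewrite big_cons.
apply: cvgL2D => //.
- by move=> k; exact: L2_sum.
- exact: L2_sum.
Qed.

Lemma L2M_bounded (m u : T -> R) : measurable_fun [set: T] m -> (forall x, `|m x| <= 1) ->
  L2 u -> L2 (fun x => m x * u x) /\ ip (fun x => m x * u x) (fun x => m x * u x) <= ip u u.
Proof.
move=> mm m1 Lu.
have mmu : measurable_fun [set: T] (fun x => m x * u x) by apply: measurable_funM => //; exact: Lu.1.
have le x : (m x * u x) ^+ 2 <= u x ^+ 2.
  rewrite exprMn ler_piMl ?sqr_ge0// -real_normK ?num_real//.
  by rewrite -[leRHS](expr1n _ 2) lerXn2r ?nnegrE.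
have L : L2 (fun x => m x * u x).
  split => //; apply: le_lt_trans Lu.2; apply: ge0_le_integral => //.
  - by move=> x _; rewrite lee_fin sqr_ge0.
  - by apply/measurable_EFinP; exact: measurable_funX.
  - by apply/measurable_EFinP; apply: measurable_funX; exact: Lu.1.
  - by move=> x _; rewrite lee_fin.
split => //; apply: le_Rintegral => //.
- exact: (mul_integrable L L).
- exact: (mul_integrable Lu Lu).
- by move=> x _; rewrite -!expr2.
Qed.

Lemma cvgL2M_bounded (m : T -> R) (u : nat -> T -> R) u' : measurable_fun [set: T] m -> (forall x, `|m x| <= 1) ->
  (forall k, L2 (u k)) -> L2 u' -> cvgL2 u u' -> cvgL2 (fun k x => m x * u k x) (fun x => m x * u' x).
Proof.
move=> mm m1 Lu Lu' uu'.
apply: (squeeze_cvgr _ (cvg_cst 0) uu'); apply: nearW => k; rewrite ip_ge0/=.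
have [_] := L2M_bounded mm m1 (L2B (Lu k) Lu').
apply: le_trans; rewrite le_eqVlt; apply/orP; left; apply/eqP.
by apply: eq_Rintegral => x _ /=; ring.
Qed.

(** A strict bound by a real forces the norm to be finite; squaring it then yields square
    integrability and the bound on [ip] together. *)
Lemma Lnorm2_lt u (e : R) : measurable_fun [set: T] u ->
  ('N[mu]_2%:E[EFin \o u] < e%:E)%E -> L2 u /\ ip u u < e ^+ 2.
Proof.
move=> mu_u Ne.
have N0 := @Lnorm_ge0 _ _ _ mu 2%:E (EFin \o u).
have Nf : 'N[mu]_2%:E[EFin \o u]%E \is a fin_num by rewrite ge0_fin_numE// (lt_trans Ne)// ltry.
have := powR_Lnorm mu (EFin \o u) (r := 2) ltac:(by []).
move: N0 Ne; rewrite -(fineK Nf) poweR_EFin lee_fin lte_fin => N0 Ne.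
rewrite powR_mulrn// => E.
have E2 : ((fine 'N[mu]_2%:E[EFin \o u] ^+ 2)%:E = \int[mu]_x (u x ^+ 2)%:E)%E.
  rewrite E; apply: eq_integral => x _ /=.
  by rewrite powR_mulrn// real_normK ?num_real.
have Lu : L2 u by split; rewrite // -E2 ltry.
split => //; rewrite -lte_fin EFin_ip//.
rewrite (_ : (\int[mu]_x (u x * u x)%:E)%E = (fine 'N[mu]_2%:E[EFin \o u] ^+ 2)%:E).
  by rewrite lte_fin ltr_pXn2r// ?nnegrE// (le_trans N0)// ltW.
by rewrite E2; apply: eq_integral => x _; rewrite expr2.
Qed.

End L2_limits.

(** * The identity on the L^2 closure, and approximation of Sobolev functions *)

Section stein_L2.
Context {R : realType} {n : nat}.
Local Notation gam := (gauss_row R n).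
Local Notation lam := (lebesgue_row R n).
Implicit Types (x : 'rV[R]_n).

Lemma ae_gauss (Q : 'rV[R]_n -> Prop) : {ae lam, forall x, Q x} -> {ae gam, forall x, Q x}.
Proof. by move=> [A [mA A0 QA]]; exists A; split => //; exact: gauss_dominates. Qed.

(* x_i * f need not be in L^2 when f is; multiplying by this bounded positive
   weight makes delta_i continuous on L^2, which identifies the limit. *)
Definition coord_weight x : R := (1 + \sum_(i < n) `|x ord0 i|)^-1.

Lemma coord_weight_gt0 x : 0 < coord_weight x.
Proof. by rewrite invr_gt0 ltr_pwDl// sumr_ge0. Qed.

Lemma measurable_coord_weight : measurable_fun [set: 'rV[R]_n] coord_weight.
Proof.
have c : continuous (fun x : 'rV[R]_n => 1 + \sum_(i < n) `|x ord0 i|).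
  apply: continuous_rowD; first by move=> x; exact: cst_continuous.
  rewrite (_ : (fun x : 'rV[R]_n => _) = \big[(fun a b x => a x + b x)/cst 0]_(i < n) (fun x : 'rV[R]_n => `|x ord0 i|)).
    elim/big_ind : _ => //; first by move=> x; exact: cst_continuous.
    + by move=> a b; exact: continuous_rowD.
    + move=> i _ x; apply: continuous_comp; first exact: coord_continuous.
      exact: norm_continuous.
  apply/funext => x; elim: (index_enum _) => [|a s IH]; first by rewrite !big_nil.
  by rewrite !big_cons IH.
have nz x : 1 + \sum_(i < n) `|x ord0 i| != 0 by rewrite gt_eqF// ltr_pwDl// sumr_ge0.
apply: continuous_measurable_row; exact: (fun x : 'rV[R]_n => cvgV (nz x) (c x)).
Qed.

Lemma coord_weight_le1 x : `|coord_weight x| <= 1.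
Proof.
rewrite ger0_norm ?(ltW (coord_weight_gt0 _))// invf_le1 ?lerDl ?sumr_ge0//.
by rewrite ltr_pwDl// sumr_ge0.
Qed.

Lemma coord_weightM_le1 x (i : 'I_n) : `|x ord0 i * coord_weight x| <= 1.
Proof.
rewrite normrM [`|coord_weight x|]ger0_norm ?(ltW (coord_weight_gt0 _))//.
rewrite ler_pdivrMr ?mul1r; last by rewrite ltr_pwDl// sumr_ge0.
by rewrite (le_trans (abs_coord_le_sum x i))// lerDr.
Qed.

Definition skorohod (f : 'I_n -> 'rV[R]_n -> R) (D : 'I_n -> 'I_n -> 'rV[R]_n -> R) x : R :=
  \sum_(i < n) delta i (f i) (D i) x.

(** The identity for the differences, with D_ij D_ji <= (D_ij^2 + D_ji^2) / 2 in the indefinite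
    term; exchanging i and j in half of the double sum restores the full squared norm of the
    derivatives. *)
Lemma stein_cauchy (phi : nat -> 'I_n -> 'rV[R]_n -> R) (Dphi : nat -> 'I_n -> 'I_n -> 'rV[R]_n -> R) k l :
  (forall k i, reg (phi k i) (Dphi k i)) ->
  ip gam (skorohod (phi k) (Dphi k) \- skorohod (phi l) (Dphi l))
    (skorohod (phi k) (Dphi k) \- skorohod (phi l) (Dphi l)) <=
  \sum_(i < n) ip gam (phi k i \- phi l i) (phi k i \- phi l i) +
  \sum_(i < n) \sum_(j < n) ip gam (Dphi k i j \- Dphi l i j) (Dphi k i j \- Dphi l i j).
Proof.
move=> rphi; pose U k := skorohod (phi k) (Dphi k).
pose f i := phi k i \- phi l i.
pose D i j x := Dphi k i j x - Dphi l i j x.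
have rf i : reg (f i) (D i) by exact: regB.
have tf i : tame (f i) by case: (rf i).
have tD i j : tame (D i j) by case: (rf i).
rewrite -/(U k) -/(U l).
have -> : ip gam (U k \- U l) (U k \- U l) = gE (fun x => (\sum_(i < n) delta i (f i) (D i) x) ^+ 2).
  apply: eq_Rintegral => x _; rewrite -expr2; congr (_ ^+ 2).
  by rewrite /U /skorohod /= -sumrB; apply: eq_bigr => i _; rewrite /delta /f /D /=; ring.
rewrite second_order_identity//; apply: lerD.
  by rewrite gE_sum// => i _; exact: tameM.
rewrite gE_sum; last by move=> i _; apply: tame_sum => j _; exact: tameM.
under eq_bigr => i _ do (rewrite gE_sum; last by move=> j _; exact: tameM).
have LD i j : L2 gam (D i j) by exact: tame_L2.
have H i j : gE (fun x => D i j x * D j i x) <= 2^-1 * ip gam (D i j) (D i j) + 2^-1 * ip gam (D j i) (D j i).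
  have := ip_ge0 gam (D i j \- D j i).
  have LB := L2B (LD i j) (LD j i).
  rewrite (ipBl (LD i j) (LD j i) LB) (ipBr (LD i j) (LD j i) (LD i j)).
  rewrite (ipBr (LD i j) (LD j i) (LD j i)) [ip gam (D j i) (D i j)]ipC.
  rewrite -[gE _]/(ip gam (D i j) (D j i)).
  lra.
apply: (@le_trans _ _ (\sum_(i < n) \sum_(j < n) (2^-1 * ip gam (D i j) (D i j) + 2^-1 * ip gam (D j i) (D j i)))).
  by apply: ler_sum => i _; apply: ler_sum => j _.
under eq_bigr do rewrite big_split.
rewrite big_split/= [X in _ + X]exchange_big/= -big_split/=; apply: ler_sum => i _.
rewrite -big_split/=; apply: ler_sum => j _.
by rewrite -mulrDl (_ : 2^-1 + 2^-1 = 1 :> R) ?mul1r//; field.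
Qed.

Lemma cvg_sumr (I : Type) (s : seq I) (a : nat -> I -> R) (l : I -> R) :
  (forall i, a k i @[k --> \oo] --> l i) ->
  \sum_(i <- s) a k i @[k --> \oo] --> \sum_(i <- s) l i.
Proof.
move=> al; elim: s => [|i s IH].
  rewrite big_nil; rewrite (_ : (fun k => _) = fun=> 0); first exact: cvg_cst.
  by apply/funext => k; rewrite big_nil.
rewrite (_ : (fun k => _) = (fun k => a k i + \sum_(i <- s) a k i)); last first.
  by apply/funext => k; rewrite big_cons.
by rewrite big_cons; exact: cvgD.
Qed.

Lemma cvg_sumr_0 (I : Type) (s : seq I) (a : nat -> I -> R) :
  (forall i, a k i @[k --> \oo] --> 0) -> \sum_(i <- s) a k i @[k --> \oo] --> 0.
Proof. by move=> a0; have := @cvg_sumr I s a (fun=> 0) a0; rewrite big1. Qed.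

(** Completeness gives a limit V of the sums [U k]; the point is that V is the formal expression W.
    Multiplied by [coord_weight], both are L^2 limits of one sequence, hence equal almost
    everywhere. *)
Lemma stein_L2 (phi : nat -> 'I_n -> 'rV[R]_n -> R) (Dphi : nat -> 'I_n -> 'I_n -> 'rV[R]_n -> R)
    (f : 'I_n -> 'rV[R]_n -> R) (D : 'I_n -> 'I_n -> 'rV[R]_n -> R) :
  (forall k i, reg (phi k i) (Dphi k i)) -> (forall i, L2 gam (f i)) -> (forall i j, L2 gam (D i j)) ->
  (forall i, cvgL2 gam (fun k => phi k i) (f i)) ->
  (forall i j, cvgL2 gam (fun k => Dphi k i j) (D i j)) ->
  L2 gam (fun x => \sum_(i < n) delta i (f i) (D i) x) /\
  ip gam (fun x => \sum_(i < n) delta i (f i) (D i) x) (fun x => \sum_(i < n) delta i (f i) (D i) x) =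
  \sum_(i < n) ip gam (f i) (f i) + \sum_(i < n) \sum_(j < n) ip gam (D i j) (D j i).
Proof.
move=> rphi Lf LD phif DphiD.
pose U k x := \sum_(i < n) delta i (phi k i) (Dphi k i) x.
pose W x := \sum_(i < n) delta i (f i) (D i) x.
have tphi k i : tame (phi k i) by case: (rphi k i).
have tDphi k i j : tame (Dphi k i j) by case: (rphi k i).
have Lphi k i : L2 gam (phi k i) by exact: tame_L2.
have LDphi k i j : L2 gam (Dphi k i j) by exact: tame_L2.
have LU k : L2 gam (U k) by apply: tame_L2; apply: tame_sum => i _; exact: tame_delta.
pose A k := \sum_(i < n) ip gam (phi k i \- f i) (phi k i \- f i) +
  \sum_(i < n) \sum_(j < n) ip gam (Dphi k i j \- D i j) (Dphi k i j \- D i j).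
have A0 : A k @[k --> \oo] --> 0.
  rewrite -[X in _ --> X]addr0; apply: cvgD; first exact: cvg_sumr_0.
  apply: cvg_sumr_0 => i.
  by apply: (@cvg_sumr_0 _ _ (fun k j => ip gam (Dphi k i j \- D i j) (Dphi k i j \- D i j))) => j; exact: DphiD.
(* The terms for k and l are compared through the limits f and D; the factors 2 come from
   [ip_dist]. *)
have UA k l : ip gam (U k \- U l) (U k \- U l) <= 2 * A k + 2 * A l.
  rewrite (le_trans (stein_cauchy k l rphi))//.
  rewrite (_ : 2 * A k + 2 * A l =
    \sum_(i < n) (2 * ip gam (phi k i \- f i) (phi k i \- f i) + 2 * ip gam (phi l i \- f i) (phi l i \- f i)) +
    \sum_(i < n) \sum_(j < n) (2 * ip gam (Dphi k i j \- D i j) (Dphi k i j \- D i j) +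
       2 * ip gam (Dphi l i j \- D i j) (Dphi l i j \- D i j))); last first.
    rewrite /A !mulrDr !mulr_sumr big_split/= addrACA; congr (_ + _).
    rewrite -big_split/=; apply: eq_bigr => i _.
    by rewrite !mulr_sumr big_split.
  apply: lerD; first by apply: ler_sum => i _; exact: ip_dist.
  by apply: ler_sum => i _; apply: ler_sum => j _; exact: ip_dist.
have [V LV UV] : exists2 V, L2 gam V & cvgL2 gam U V.
  apply: (L2_complete (@gauss_row_setT R n)) => // e e0.
  have /cvgrPdist_lt/(_ (e / 4)) := A0; move=> /(_ ltac:(by rewrite divr_gt0))[N _ HN].
  exists N => k l Nk Nl; rewrite (le_lt_trans (UA k l))//.
  have := HN _ Nk; have := HN _ Nl; rewrite /= !sub0r !normrN => h1 h2.
  have := ler_norm (A k); have := ler_norm (A l); lra.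
have mw := measurable_coord_weight.
have mxw i : measurable_fun [set: 'rV[R]_n] (fun x => x ord0 i * coord_weight x).
  by apply: measurable_funM => //; exact: measurable_coord.
have LwU k : L2 gam (fun x => coord_weight x * U k x).
  by have [] := L2M_bounded mw coord_weight_le1 (LU k).
have LwV : L2 gam (fun x => coord_weight x * V x).
  by have [] := L2M_bounded mw coord_weight_le1 LV.
have cV := cvgL2M_bounded mw coord_weight_le1 LU LV UV.
(* The weighted delta_i, grouped so that the multipliers of g and h are both bounded by 1. *)
pose q (g : 'rV[R]_n -> R) (h : 'rV[R]_n -> R) i : 'rV[R]_n -> R :=
  (fun x => x ord0 i * coord_weight x * g x) \- (fun x => coord_weight x * h x).
have Lxg i g : L2 gam g -> L2 gam (fun x => x ord0 i * coord_weight x * g x).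
  by move=> Lg; have [] := L2M_bounded (mxw i) (fun x => coord_weightM_le1 x i) Lg.
have Lwg g : L2 gam g -> L2 gam (fun x => coord_weight x * g x).
  by move=> Lg; have [] := L2M_bounded mw coord_weight_le1 Lg.
have Lq g h i : L2 gam g -> L2 gam h -> L2 gam (q g h i).
  by move=> Lg Lh; apply: L2B; [exact: Lxg|exact: Lwg].
have cW : cvgL2 gam (fun k x => coord_weight x * U k x) (fun x => coord_weight x * W x).
  have -> : (fun k x => coord_weight x * U k x) = (fun k x => \sum_(i < n) q (phi k i) (Dphi k i i) i x).
    apply/funext => k; apply/funext => x; rewrite /U mulr_sumr; apply: eq_bigr => i _.
    by rewrite /delta /q /=; ring.
  have -> : (fun x => coord_weight x * W x) = (fun x => \sum_(i < n) q (f i) (D i i) i x).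
    apply/funext => x; rewrite /W mulr_sumr; apply: eq_bigr => i _.
    by rewrite /delta /q /=; ring.
  apply: cvgL2_sum => [k i|i|i]; [exact: Lq|exact: Lq|].
  have c1 := cvgL2M_bounded (mxw i) (fun x => coord_weightM_le1 x i) (Lphi ^~ i) (Lf i) (phif i).
  have c2 := cvgL2M_bounded mw coord_weight_le1 (fun k => LDphi k i i) (LD i i) (DphiD i i).
  have c3 : cvgL2 gam (fun k x => (-1) * (coord_weight x * Dphi k i i x)) (fun x => (-1) * (coord_weight x * D i i x)).
    apply: cvgL2M_bounded => //; first by move=> x; rewrite normrN1.
    - by move=> k; exact: Lwg.
    - exact: Lwg.
  have E (g h : 'rV[R]_n -> R) : q g h i = (fun x => x ord0 i * coord_weight x * g x) \+ (fun x => (-1) * (coord_weight x * h x)).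
    by apply/funext => x; rewrite /q/= mulN1r.
  rewrite E; under eq_fun do rewrite E.
  apply: cvgL2D => //.
  - by move=> k; exact: Lxg.
  - by move=> k; apply: L2Z; exact: Lwg.
  - exact: Lxg.
  - by apply: L2Z; exact: Lwg.
have LwW : L2 gam (fun x => coord_weight x * W x).
  have -> : (fun x => coord_weight x * W x) = (fun x => \sum_(i < n) q (f i) (D i i) i x).
    apply/funext => x; rewrite /W mulr_sumr; apply: eq_bigr => i _.
    by rewrite /delta /q /=; ring.
  by apply: L2_sum => i _; exact: Lq.
have WV : {ae gam, forall x, W x = V x}.
  (* The weight is positive everywhere, so it cancels pointwise. *)
  apply: filterS (cvgL2_unique LwU LwW LwV cW cV) => x /mulfI; apply.
  by rewrite gt_eqF// coord_weight_gt0.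
have mW : measurable_fun [set: 'rV[R]_n] W.
  apply: measurable_sum => i; apply: measurable_funB; last exact: (LD i i).1.
  by apply: measurable_funM; [exact: measurable_coord|exact: (Lf i).1].
have LW := ae_eq_L2 mW WV LV.
split => //.
rewrite (ae_eq_ip LW LW LV LV WV WV).
have c1 := ip_cvg LU LU LV LV UV UV.
have c2 : ip gam (U k) (U k) @[k --> \oo] --> \sum_(i < n) ip gam (f i) (f i) + \sum_(i < n) \sum_(j < n) ip gam (D i j) (D j i).
  have E k : ip gam (U k) (U k) = \sum_(i < n) ip gam (phi k i) (phi k i) +
     \sum_(i < n) \sum_(j < n) ip gam (Dphi k i j) (Dphi k j i).
    transitivity (gE (fun x => (\sum_(i < n) delta i (phi k i) (Dphi k i) x) ^+ 2)).
      by apply: eq_Rintegral => x _; rewrite -expr2.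
    rewrite second_order_identity//; congr (_ + _); first by rewrite gE_sum// => i _; exact: tameM.
    rewrite gE_sum; last by move=> i _; apply: tame_sum => j _; exact: tameM.
    by apply: eq_bigr => i _; rewrite gE_sum// => j _; exact: tameM.
  rewrite (funext E); apply: cvgD.
    by apply: cvg_sumr => i; exact: ip_cvg.
  apply: cvg_sumr => i.
  by apply: (@cvg_sumr _ _ (fun k j => ip gam (Dphi k i j) (Dphi k j i)) (fun j => ip gam (D i j) (D j i))) => j; exact: ip_cvg.
exact: cvg_unique c1 c2.
Qed.

(** [sobolev_norm] bounds the L^2 norm of the gradient and so that of each partial derivative; the
    Cauchy condition then provides limits [h j] by completeness. *)
Lemma sobolev_approx (g : 'rV[R]_n -> R) : gauss_sobolev g ->
  L2 gam g /\ exists (phi : nat -> 'rV[R]_n -> R) (h : 'I_n -> 'rV[R]_n -> R),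
    [/\ forall k, test_function (phi k), cvgL2 gam phi g, forall j, L2 gam (h j) &
        forall j, cvgL2 gam (fun k => partial j (phi k)) (h j)].
Proof.
move=> [mg [phi [tphi cauchy phig]]].
have rphi k := reg_test (tphi k).
have tam k : tame (phi k) by case: (rphi k).
have tamD k j : tame (partial j (phi k)) by case: (rphi k).
have LD k j : L2 gam (partial j (phi k)) by exact: tame_L2.
have Lphi k : L2 gam (phi k) by exact: tame_L2.
have small (e : R) : 0 < e -> \forall k \near \oo, L2 gam (phi k \- g) /\ ip gam (phi k \- g) (phi k \- g) < e.
  move=> e0; have se : 0 < Num.sqrt e by rewrite sqrtr_gt0.
  have : \forall k \near \oo, ('N[gam]_2%:E[EFin \o (phi k \- g)%R] < (Num.sqrt e)%:E)%E.
    have H : nbhs (0 : \bar R)%E [set y | (y < (Num.sqrt e)%:E)%E].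
      by apply: open_nbhs_nbhs; split; [exact: open_ereal_lt_ereal|rewrite /= lte_fin].
    exact: (phig _ H).
  apply: filterS => k /(Lnorm2_lt _) -/(_ _)[|L i].
    by apply: measurable_funB => //; case: (tam k).
  by split => //; move: i; rewrite sqr_sqrtr// ltW.
have Lg : L2 gam g.
  have [k _ /(_ k (leqnn k)) [L _]] := small 1 ltr01.
  rewrite (_ : g = phi k \- (phi k \- g)); first exact: L2B.
  by apply/funext => x /=; rewrite subKr.
split => //.
have cphi : cvgL2 gam phi g.
  apply/cvgrPdist_lt => e e0; apply: filterS (small e e0) => k [_].
  by rewrite sub0r normrN ger0_norm ?ip_ge0.
have /choice[h hP] : forall j, exists h, L2 gam h /\ cvgL2 gam (fun k => partial j (phi k)) h.
  move=> j.
  have [|e e0|h Lh hc] := L2_complete (@gauss_row_setT R n) (u := fun k => partial j (phi k)); last by exists h.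
    by move=> k; exact: LD.
  (* [ip] is a squared norm, so the Cauchy condition is used at the square root of e. *)
  have se : 0 < Num.sqrt e by rewrite sqrtr_gt0.
  have [N HN] := cauchy _ se; exists N => k l Nk Nl.
  have := HN k l Nk Nl; rewrite /sobolev_norm => Hs.
  have dphi k' x : differentiable (phi k') x by have [K [_ _ _ df _]] := test_functionP (tphi k'); exact: df.
  have gE' x : enorm (grad (phi k \- phi l) x) = Num.sqrt (\sum_(i < n) (partial i (phi k) x - partial i (phi l) x) ^+ 2).
    rewrite /enorm; congr Num.sqrt; apply: eq_bigr => i _; rewrite mxE /partial.
    by rewrite deriveB//; exact: diff_derivable.
  have mG : measurable_fun [set: 'rV[R]_n] (fun x => enorm (grad (phi k \- phi l) x)).
    under eq_fun do rewrite gE'.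
    apply: (measurableT_comp (f := @Num.sqrt R)).
      by apply: continuous_measurable_fun; exact: sqrt_continuous.
    apply: measurable_sum => i; apply: measurable_funX; apply: measurable_funB; [exact: (tamD k i).1|exact: (tamD l i).1].
  have NG : ('N[gam]_2%:E[EFin \o (fun x => enorm (grad (phi k \- phi l)%R x))%R] < (Num.sqrt e)%:E)%E.
    by apply: le_lt_trans Hs; rewrite leeDr// Lnorm_ge0.
  have [LG] := Lnorm2_lt mG NG; rewrite sqr_sqrtr ?ltW// => iG.
  apply: le_lt_trans iG.
  apply: le_Rintegral => //.
  - exact: (mul_integrable (L2B (LD k j) (LD l j)) (L2B (LD k j) (LD l j))).
  - exact: (mul_integrable LG LG).
  move=> x _; rewrite -!expr2 gE' sqr_sqrtr; last by apply: sumr_ge0 => i _; rewrite sqr_ge0.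
  by rewrite (bigD1 j)//= lerDl sumr_ge0// => i _; rewrite sqr_ge0.
by exists phi, h; split => // j; case: (hP j).
Qed.

End stein_L2.

Section sobolev_stein.
Context {R : realType} {n : nat} {d : measure_display} {Omega : measurableType d}
  {P : probability Omega R} {z : {RV P >-> 'rV[R]_n}}.
Hypothesis hz : forall A : set 'rV[R]_n, measurable A ->
       distribution P z A = gauss_row R n A.
Local Notation gam := (gauss_row R n).

Lemma second_order_stein_L2 (f : 'I_n -> 'rV[R]_n -> R) (D : 'I_n -> 'I_n -> 'rV[R]_n -> R) :
  (forall i, L2 gam (f i)) -> (forall i j, L2 gam (D i j)) ->
  L2 gam (skorohod f D) ->
  ip gam (skorohod f D) (skorohod f D) =
    \sum_(i < n) ip gam (f i) (f i) + \sum_(i < n) \sum_(j < n) ip gam (D i j) (D j i) ->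
  second_order_stein P z f D.
Proof.
move=> Lf LD Ls E.
have iDD : gam.-integrable [set: 'rV[R]_n] (EFin \o (fun x => \sum_(i < n) \sum_(j < n) D i j x * D j i x)).
  apply: (@eq_integrable _ _ _ _ _ measurableT (fun x => \sum_(i < n) \sum_(j < n) (D i j x * D j i x)%:E)%E).
    by move=> x _ /=; rewrite -sumEFin; apply: eq_bigr => i _; rewrite sumEFin.
  apply: integrable_sum => // i _; apply: integrable_sum => // j _.
  exact: (mul_integrable (LD i j) (LD j i)).
apply: (second_order_stein_gauss hz) => //.
- by move=> i; exact: (Lf i).1.
- by move=> i j; exact: (LD i j).1.
transitivity (ip gam (skorohod f D) (skorohod f D))%:E.
  by rewrite EFin_ip//; apply: eq_integral => x _; rewrite expr2.
rewrite E EFinD; congr (_ + _)%E.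
  rewrite -sumEFin (eq_bigr _ (fun i _ => EFin_ip (Lf i) (Lf i))).
  rewrite -integral_sum//; last by move=> i; exact: (mul_integrable (Lf i) (Lf i)).
  by apply: eq_integral => x _; rewrite sumEFin.
rewrite -sumEFin.
under eq_bigr => i _.
  rewrite -sumEFin (eq_bigr _ (fun j _ => EFin_ip (LD i j) (LD j i))).
  rewrite -integral_sum//; last by move=> j; exact: (mul_integrable (LD i j) (LD j i)).
  over.
rewrite -integral_sum//.
  by apply: eq_integral => x _; rewrite -sumEFin; apply: eq_bigr => i _; rewrite sumEFin.
move=> i; apply: integrable_sum => // j _.
exact: (mul_integrable (LD i j) (LD j i)).
Qed.

(** The L^2 limits h of the approximating partial derivatives are weak derivatives, whence
    existence. Any other choice D agrees with h almost everywhere for Lebesgue, hence for the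
    Gaussian measure, and inherits square integrability and the convergence. *)
Lemma second_order_stein_sobolev (f : 'I_n -> 'rV[R]_n -> R) :
  (forall i, gauss_sobolev (f i)) ->
  (exists D : 'I_n -> 'I_n -> 'rV[R]_n -> R, forall i j, weak_partial j (f i) (D i j)) /\
  (forall D : 'I_n -> 'I_n -> 'rV[R]_n -> R, (forall i j, weak_partial j (f i) (D i j)) ->
     second_order_stein P z f D).
Proof.
move=> sf; have Lf i : L2 gam (f i) by have [] := sobolev_approx (sf i).
have /choice[phi /choice[h H]] : forall i, exists (phi : nat -> 'rV[R]_n -> R) (h : 'I_n -> 'rV[R]_n -> R),
    [/\ forall k, test_function (phi k), cvgL2 gam phi (f i), forall j, L2 gam (h j) &
        forall j, cvgL2 gam (fun k => partial j (phi k)) (h j)].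
  by move=> i; have [] := sobolev_approx (sf i).
have rphi i k : reg (phi i k) (fun j => partial j (phi i k)).
  by have [tphi _ _ _] := H i; exact: reg_test.
have wh i j : weak_partial j (f i) (h i j).
  have [_ phif Lh Dh] := H i.
  exact: (weak_partial_L2 (rphi i) (Lf i) (Lh j) phif (Dh j)).
split; first by exists h.
move=> D wD.
have Dh i j : {ae gam, forall x, D i j x = h i j x}.
  exact: ae_gauss (weak_partial_unique (wD i j) (wh i j)).
have mD i j : measurable_fun [set: 'rV[R]_n] (D i j) by have [_ []] := wD i j.
have Lh i j : L2 gam (h i j) by have [_ _ ? _] := H i.
have LD i j : L2 gam (D i j) := ae_eq_L2 (mD i j) (Dh i j) (Lh i j).
have cD i j : cvgL2 gam (fun k => partial j (phi i k)) (D i j).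
  have [_ _ _ /(_ j)] := H i.
  have Lp k : L2 gam (partial j (phi i k)) by apply: tame_L2; case: (rphi i k).
  rewrite /cvgL2 (_ : (fun k => ip gam (partial j (phi i k) \- h i j) _) =
    (fun k => ip gam (partial j (phi i k) \- D i j) (partial j (phi i k) \- D i j)))//.
  apply/funext => k; apply: ae_eq_ip; try exact: L2B.
    by apply: filterS (Dh i j) => x /= ->.
  by apply: filterS (Dh i j) => x /= ->.
have [Ls E] := stein_L2 (phi := fun k i => phi i k) (Dphi := fun k i j => partial j (phi i k))
  (fun k i => rphi i k) Lf LD (fun i => let: And4 _ c _ _ := H i in c) cD.
exact: second_order_stein_L2.
Qed.

End sobolev_stein.

(** * Lipschitz functions *)

Section rademacher_line.
Context {R : realType}.
Local Notation lam := (@lebesgue_measure R).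

Lemma derivable_near_eq (f g : R -> R) (x : R) : (\forall y \near x, f y = g y) ->
  derivable f x 1 -> derivable g x 1.
Proof.
move=> fg /cvg_ex[l fl]; apply/cvg_ex; exists l.
apply: cvg_trans fl; apply: near_eq_cvg.
have fx : f x = g x by exact: nbhs_singleton fg.
have : \forall h \near (0 : R), f (h *: 1 + x) = g (h *: 1 + x).
  have ch : (fun h : R => h *: (1 : R) + x) @ (0 : R) --> x.
    rewrite -[X in _ --> X]add0r; apply: cvgD; last exact: cvg_cst.
    by under eq_fun do rewrite [_ *: _]mulr1; exact: cvg_id.
  exact: (ch _ fg).
move=> H; apply: (@cvg_within _ (nbhs (0:R))); apply: filterS H => h hh.
by rewrite /= hh fx.
Qed.

Lemma wlength_ocitv_le (G H : R -> R) (A : set R) : {homo G : x y / x <= y} ->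
  (forall x y, x <= y -> G y - G x <= H y - H x) -> ocitv A -> (wlength G A <= wlength H A)%E.
Proof.
move=> ndG GH /ocitvP[->|[[a b]/= ab ->]]; first by rewrite !wlength0.
by rewrite !wlength_itv/= lte_fin ab -!EFinB lee_fin GH// ltW.
Qed.

(** Both measures are infima over the same coverings by half-open intervals, and the comparison
    holds interval by interval. *)
Lemma stieltjes_le (G H : cumulative R R) (A : set (measurableTypeR R)) :
  (forall x y, x <= y -> G y - G x <= H y - H x) ->
  (lebesgue_stieltjes_measure G A <= lebesgue_stieltjes_measure H A)%E.
Proof.
move=> GH; apply: le_ereal_inf_tmp => _ [F [mF AF] <-].
apply: le_trans (_ : (\sum_(0 <= k <oo) wlength G (F k) <= _)%E).
  by apply: ereal_inf_lbound; exists F.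
apply: lee_nneseries => [i _ _|i _]; first exact: wlength_ge0.
by apply: wlength_ocitv_le => //; [exact: cumulative_is_nondecreasing|exact: mF].
Qed.

Lemma monotone_contraction_derivable (G : R -> R) : {homo G : x y / x <= y} ->
  (forall x y, x <= y -> G y - G x <= y - x) ->
  {ae lam, forall x, derivable G x 1}.
Proof.
move=> ndG GL.
have cG : continuous G.
  move=> x; apply/cvgrPdist_le => e e0; near=> y.
  apply: (@le_trans _ _ `|x - y|); last by near: y; apply: cvgr_dist_le => //; exact: cvg_id.
  have [xy|/ltW yx] := leP x y.
    by rewrite !(distrC x) !(distrC (G x)) !ger0_norm ?subr_ge0// ?ndG// GL.
  by rewrite !ger0_norm ?subr_ge0// ?ndG// GL.
pose cumG := isCumulative.Build R _ R G ndG (right_continuousW cG).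
pose Gc : cumulative R R := HB.pack G cumG.
(* Lebesgue measure is the Stieltjes measure of the identity, so the bound on increments compares
   the two measures. *)
have Gdom : lebesgue_stieltjes_measure Gc `<< lam.
  apply/null_content_dominatesP => A mA A0; apply/eqP; rewrite -measure_le0 -A0.
  exact: (@stieltjes_le Gc (idfun : cumulative R R)).
(* Localisation allows the measure to be cut down to ]-N, N], where it is finite; its density is
   then integrable and has an indefinite integral starting at -oo. *)
suff main (N : nat) : {ae lam, forall x, -(N%:R) < x < N%:R -> derivable G x 1}.
  have : {ae lam, forall x, forall N : nat, -(N%:R) < x < N%:R -> derivable G x 1} by exact/ae_foralln.
  apply: filterS; first exact: (ae_filter_ringOfSetsType lam).
  move=> x /(_ (Num.bound `|x|)); apply.
  by rewrite -ltr_norml archi_boundP.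
pose D : set (measurableTypeR R) := `]- N%:R, N%:R]%classic.
have mD : measurable D by exact: measurable_itv.
have GI a b : a <= b -> lebesgue_stieltjes_measure Gc `]a, b]%classic = (G b - G a)%:E.
  move=> ab; rewrite /lebesgue_stieltjes_measure/= /measure_extension measurable_mu_extE//=; last exact: is_ocitv.
  rewrite wlength_itv_bnd//.
have Dfin : (lebesgue_stieltjes_measure Gc D < +oo)%E.
  by rewrite /D GI ?ltry// (@le_trans _ _ 0)// oppr_le0.
pose nu : {finite_measure set (measurableTypeR R) -> \bar R} := mfrestr mD Dfin.
have nu_dom : nu `<< lam.
  apply/null_content_dominatesP => A mA A0.
  rewrite /nu/= /mfrestr /mrestr.
  have /null_content_dominatesP Gd := Gdom.
  apply: Gd; first exact: measurableI.
  by apply: subset_measure0 A0 => //; exact: measurableI.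
have [h [h0 hfin ih hE]] := radon_nikodym_sigma_finite nu_dom.
have hE' : h = EFin \o (fine \o h) by apply/funext => x; rewrite /= fineK.
have ih' : lam.-integrable [set: measurableTypeR R] (EFin \o (fine \o h)) by rewrite -hE'.
have loch : locally_integrable [set: R] (fine \o h).
  rewrite -(patch_setT (fun=> 0%R) (fine \o h)); exact: integrable_locally.
have hint y : lam.-integrable `]-oo, y] (EFin \o (fine \o h)) by exact: integrableS ih'.
have := FTC1Ny hint loch.
apply: filterS; first exact: (ae_filter_ringOfSetsType lam).
move=> x [dH _] /andP[Nx xN].
apply: (@derivable_near_eq (fun y => G (- N%:R) + \int[lam]_(t in `]-oo, y]) (fine \o h) t)); last first.
  exact: (derivableD (derivable_cst _ _ _) dH).
near=> y.
have Ny : - N%:R < y by near: y; exact: lt_nbhsr.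
have yN : y < N%:R by near: y; exact: lt_nbhsl.
(* For -N < y < N the cut-down measure of ]-oo, y] is G y - G (-N), so near x the function G is the
   indefinite integral plus a constant. *)
rewrite /Rintegral (_ : (\int[lam]_(t in _) _)%E = (G y - G (- N%:R))%:E) /= ?subrKC//.
rewrite -[RHS]GI ?ltW//.
transitivity (nu `]-oo, y]%classic).
  rewrite hE; last exact: measurable_itv.
  by apply: eq_integral => t _; rewrite fineK.
rewrite /nu/= /mfrestr /mrestr; congr lebesgue_stieltjes_measure.
apply/seteqP; split => t; rewrite /D /= !in_itv/=.
  by move=> [-> /andP[->]].
by move=> /andP[-> ty]; rewrite ty (le_trans ty (ltW yN)).
Unshelve. all: by end_near. Qed.

(** Adding k x brings all slopes of F between 0 and 2 k, and division by 2 k brings them below 1,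
    which is the monotone case. *)
Lemma lipschitz_derivable (K : R) (F : R -> R) :
  (forall x y, `|F x - F y| <= K * `|x - y|) -> {ae lam, forall x, derivable F x 1}.
Proof.
(* [K] may be 0 or negative, while k is divided by. *)
move=> FK; pose k := `|K| + 1; have k0 : 0 < k by rewrite ltr_pwDr.
have Fk x y : x <= y -> `|F y - F x| <= k * (y - x).
  move=> xy; rewrite (le_trans (FK _ _))// (ger0_norm (_ : 0 <= y - x)) ?subr_ge0//.
  by rewrite ler_wpM2r ?subr_ge0// (le_trans (ler_norm K))// lerDl.
pose G x := (2 * k)^-1 * (F x + k * x).
have GE x y : G y - G x = (2 * k)^-1 * ((F y - F x) + k * (y - x)).
  by rewrite /G; ring.
have kk : 0 < 2 * k by rewrite mulr_gt0.
have ndG : {homo G : x y / x <= y}.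
  move=> x y xy; rewrite -subr_ge0 GE mulr_ge0 ?invr_ge0 ?(ltW kk)//.
  by have := Fk _ _ xy; rewrite ler_norml => /andP[]; lra.
have GL x y : x <= y -> G y - G x <= y - x.
  move=> xy; rewrite GE ler_pdivrMl//.
  by have := Fk _ _ xy; rewrite ler_norml => /andP[]; lra.
apply: filterS (monotone_contraction_derivable ndG GL).
  exact: (ae_filter_ringOfSetsType lam).
move=> x dG; rewrite (_ : F = (2 * k) \*: G - (k \*: id)); last first.
  apply/funext => y; change (F y = 2 * k * ((2 * k)^-1 * (F y + k * y)) - k * y).
  by rewrite mulrA mulfV ?gt_eqF// mul1r addrK.
by apply: derivableB; apply: derivableZ.
Qed.

(** The form that Fubini consumes: a line section of the exceptional set is measurable, so
    negligibility becomes measure 0. *)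
Lemma lipschitz_nonderivable_null (K : R) (F : R -> R) (U : set (measurableTypeR R)) :
  (forall x y, `|F x - F y| <= K * `|x - y|) -> measurable U ->
  (forall t, U t -> ~ derivable F t 1) -> lam U = 0.
Proof.
move=> /lipschitz_derivable FK mU UF; apply: measure_negligible; first exact: mU.
case: FK => B [mB B0 dB]; exists B; split; [exact: mB|exact: B0|].
move=> t Ut; apply: dB => dt; exact: UF Ut dt.
Qed.

End rademacher_line.

(** * Almost everywhere partial derivatives of Lipschitz functions on R^n *)

Section lipschitz_row.
Context {R : realType} {n : nat}.
Local Notation lam := (lebesgue_row R n).
Local Notation gam := (gauss_row R n).
Implicit Types (f : 'rV[R]_n -> R) (x : 'rV[R]_n).

(* The oscillation over all real h, h' (not only rational ones) is bounded on a
   closed set, since each quotient is continuous in x. *)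
Let osc f (j : 'I_n) (m k : nat) : set 'rV[R]_n :=
  [set x | forall h h', h != 0 -> h' != 0 -> `|h| < hseq k -> `|h'| < hseq k ->
    `|dq j h f x - dq j h' f x| <= hseq m].

(** Cauchy criterion for the difference quotients, with radii and tolerances of the form 1 / (k + 1)
    so that only countable operations occur. *)
Lemma derivable_osc f j :
  [set x | derivable f x (evec j)] = \bigcap_m \bigcup_k osc f j m k.
Proof.
apply/seteqP; split => x /=.
  move=> /cvg_ex[/= l fl] m _.
  have e0 : 0 < hseq m / 2 :> R by rewrite divr_gt0// hseq_gt0.
  have /cvgrPdist_le/(_ _ e0)/nbhs_ballP[d /= d0 H] := fl.
  have [k kd] : exists k, hseq k < d.
    have /cvgrPdist_lt/(_ _ d0)[k _ Hk] := @hseq_cvg0 R; exists k.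
    by have := Hk k (leqnn k); rewrite sub0r normrN ger0_norm// ltW// hseq_gt0.
  exists k => // h h' h0 h'0 hk h'k.
  have H' t : t != 0 -> `|t| < hseq k -> `|l - dq j t f x| <= hseq m / 2.
    move=> t0 tk; rewrite /dq [x + _]addrC; apply: H => //.
    by rewrite /ball/= sub0r normrN (lt_trans tk).
  rewrite (_ : _ - _ = (l - dq j h' f x) - (l - dq j h f x)); last by ring.
  rewrite (le_trans (ler_normB _ _))// [leRHS](splitr (hseq m)) lerD// H'//.
move=> H; apply/cauchy_cvgP/cauchy_exP => e e0.
have [m me] : exists m, hseq m < e.
  have /cvgrPdist_lt/(_ _ e0)[m _ Hm] := @hseq_cvg0 R; exists m.
  by have := Hm m (leqnn m); rewrite sub0r normrN ger0_norm// ltW// hseq_gt0.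
have [k _ Hk] := H m I.
(* Any nonzero step below [hseq k] would do: its quotient is the centre of the small ball that the
   Cauchy criterion asks for. *)
pose h0 : R := hseq k / 2.
have h0p : 0 < h0 by rewrite divr_gt0// hseq_gt0.
exists (dq j h0 f x).
apply/nbhs_ballP; exists (hseq k); first exact: hseq_gt0.
move=> h; rewrite /ball/= sub0r normrN => hk h_0.
rewrite [_ *: _ + x]addrC; apply: le_lt_trans me; apply: Hk => //.
- exact: lt0r_neq0.
- rewrite ger0_norm ?(ltW h0p)// /h0 ltr_pdivrMr// ltr_pMr ?ltr1n//; exact: hseq_gt0.
Qed.

Lemma continuous_dq f j h : continuous f -> continuous (dq j h f).
Proof.
move=> cf; rewrite /dq.
have c1 : continuous (fun x : 'rV[R]_n => x + h *: evec j).
  exact: (fun x : 'rV[R]_n => cvgD (@cvg_id _ (nbhs x)) (cvg_cst (h *: evec j))).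
have c2 : continuous (fun x => f (x + h *: evec j)) by exact: (fun x : 'rV[R]_n => continuous_comp (c1 x) (cf (x + h *: evec j))).
have c3 : continuous (fun x => f (x + h *: evec j) - f x) by exact: (fun x : 'rV[R]_n => cvgB (c2 x) (cf x)).
exact: (fun x : 'rV[R]_n => cvgM (cvg_cst h^-1) (c3 x)).
Qed.

Lemma measurable_derivable f j : continuous f -> measurable [set x | derivable f x (evec j)].
Proof.
move=> cf; rewrite derivable_osc; apply: bigcap_measurable => // m _.
apply: bigcup_measurable => k _; apply: closed_measurable_row.
rewrite (_ : osc f j m k = \bigcap_(hh in [set hh : R * R | [/\ hh.1 != 0, hh.2 != 0, `|hh.1| < hseq k & `|hh.2| < hseq k]])
    (fun x => `|dq j hh.1 f x - dq j hh.2 f x|) @^-1` [set r | r <= hseq m]).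
  apply: closed_bigI => hh _; apply: closed_comp; last exact: closed_le.
  have c : continuous (fun x => dq j hh.1 f x - dq j hh.2 f x).
    exact: (fun x : 'rV[R]_n => cvgB (@continuous_dq f j hh.1 cf x) (@continuous_dq f j hh.2 cf x)).
  by move=> x _; exact: (cvg_norm (c x)).
apply/seteqP; split => x /= H.
  by move=> [h h'] /= [? ? ? ?]; exact: H.
by move=> h h' *; apply: (H (h, h')).
Qed.

(** Multiplied by the indicator of the derivability set, the quotients converge at every point, so
    the partial derivative is an everywhere limit of measurable functions. *)
Lemma measurable_partial f j : continuous f -> measurable_fun [set: 'rV[R]_n] (partial j f).
Proof.
move=> cf; pose A := [set x | derivable f x (evec j)].
have mA : measurable A by exact: measurable_derivable.
apply: (@measurable_fun_cvg _ _ _ _ (fun k x => \1_A x * dq j (hseq k) f x)).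
  move=> k; apply: measurable_funM; first exact: measurable_indic.
  by apply: continuous_measurable_row; exact: continuous_dq.
move=> x _; have [xA|xA] := pselect (A x).
  rewrite indicE mem_set//=; under eq_fun do rewrite mul1r.
  by apply: dq_cvg; [exact: DeriveDef|exact: hseq_neq0|exact: hseq_cvg0].
rewrite indicE memNset//=; under eq_fun do rewrite mul0r.
(* [partial] has the junk value 0 where the quotients diverge. *)
rewrite (_ : partial j f x = 0); first exact: cvg_cst.
by rewrite /partial /derive; apply: dvgP.
Qed.

Lemma enorm_evec (h : R) (j : 'I_n) : enorm (h *: evec j) = `|h|.
Proof.
rewrite /enorm (bigD1 j)//= big1 ?addr0; last first.
  by move=> i ij; rewrite mxE evecE (negbTE ij) mulr0 expr0n.
by rewrite mxE evecE eqxx mulr1 sqrtr_sqr.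
Qed.

Variables (f : 'rV[R]_n -> R) (L : R).
Hypothesis fL : forall x y, `|f x - f y| <= L * enorm (x - y).

Let L' := `|L|.

Let L'_ge0 : 0 <= L'. Proof. exact: normr_ge0. Qed.

Let fL' x y : `|f x - f y| <= L' * enorm (x - y).
Proof. by rewrite (le_trans (fL x y))// ler_wpM2r ?sqrtr_ge0// ler_norm. Qed.

Lemma lipschitz_continuous_row : continuous f.
Proof.
suff H (x : 'rV[R]_n) : f y @[y --> x] --> f x by exact: H.
apply/(@cvgrPdist_le _ _ _ (nbhs x) _) => e e0.
(* The Euclidean norm is at most the sum of n coordinate differences, each at most e / M; the + 1
   keeps M positive. *)
pose M := L' * n%:R + 1; have M0 : 0 < M by rewrite ltr_pwDr// mulr_ge0.
have d0 : 0 < e / M by rewrite divr_gt0.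
have : nbhs x [set y : 'rV[R]_n | forall i : 'I_n, `|x ord0 i - y ord0 i| <= e / M].
  apply: (@filter_forall _ _ (fun (i : 'I_n) (y : 'rV[R]_n) => `|x ord0 i - y ord0 i| <= e / M) (nbhs x)) => i.
  by have /cvgrPdist_le := @coord_continuous R _ _ ord0 i x; apply.
apply: filterS => y xy; rewrite (le_trans (fL' _ _))//.
apply: (@le_trans _ _ (L' * (n%:R * (e / M)))).
  rewrite ler_wpM2l// (le_trans (enorm_le_sum _))//.
  rewrite (_ : n%:R * (e / M) = \sum_(i < n) e / M); last by rewrite sumr_const card_ord mulr_natl.
  by apply: ler_sum => i _; rewrite !mxE.
have -> : L' * (n%:R * (e / M)) = e * (L' * n%:R / M) by ring.
by rewrite ler_piMr ?(ltW e0)// ler_pdivrMr// mul1r /M lerDl.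
Qed.

Lemma lipschitz_tame : tame f.
Proof.
split; first exact: continuous_measurable_row lipschitz_continuous_row.
exists (`|f 0| + L'), 1 => x; rewrite (_ : f x = f 0 + (f x - f 0)); last by rewrite addrC subrK.
have e1 : \sum_(i < n) `|x ord0 i| <= expgrowth 1 x.
  by rewrite /expgrowth mul1r; have := expR_ge1Dx (\sum_(i < n) `|x ord0 i|); lra.
have e2 : 1 <= expgrowth 1 x by rewrite -expR0 ler_expR mulr_ge0// sumr_ge0.
rewrite (le_trans (ler_normD _ _))// mulrDl lerD ?ler_peMr// (le_trans (fL' _ _))//.
have -> : x - 0 = x by apply/rowP => i; rewrite !mxE subr0.
by rewrite ler_wpM2l// (le_trans (enorm_le_sum x)).
Qed.

(** Difference quotients obey the bound and pass it to their limit; where they diverge the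
    derivative defaults to 0, so the bound holds at every point. *)
Lemma partial_lipschitz_le j x : `|partial j f x| <= L'.
Proof.
have [dx|dx] := pselect (derivable f x (evec j)); last first.
  rewrite /partial /derive (dvgP dx) normr0; exact: normr_ge0.
have c : `|dq j (hseq k) f x| @[k --> \oo] --> `|'D_(evec j) f x|.
  apply: cvg_norm; exact: dq_cvg (DeriveDef dx erefl) hseq_neq0 hseq_cvg0.
rewrite /partial -(cvg_lim _ c)//; apply: limr_le; first by apply/cvg_ex; eexists; exact: c.
apply: nearW => k; rewrite normrM normfV ler_pdivrMl ?normr_gt0 ?hseq_neq0//.
by rewrite (le_trans (fL' _ _))// addrAC subrr add0r enorm_evec mulrC.
Qed.

(** By Fubini along coordinate j: on each line parallel to e_j the exceptional set consists of
    points where a one-variable Lipschitz function is not derivable, so the indicator integrates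
    like 0 there. *)
Lemma lipschitz_ae_derivable j : {ae lam, forall x, derivable f x (evec j)}.
Proof.
have mA := measurable_derivable j lipschitz_continuous_row.
set A := [set x | _] in mA.
exists (~` A); split; [exact: measurableC| |by []].
have mu0 : (\int[lam]_x (\1_(~` A) x)%:E = \int[lam]_x (cst 0 x))%E.
  apply: (@eq_ge0_integral_upd _ _ _ j) => //.
  - by apply/measurable_EFinP; apply: measurable_indic; exact: measurableC.
  - move=> x; rewrite integral0.
    pose F (t : R) := f (upd j t x).
    have dF t : derivable F t 1 -> derivable f (upd j t x) (evec j).
      rewrite /derivable.
      suff -> : (fun h : R => h^-1 *: ((F \o shift t) (h *: (1 : R)) - F t)) =
          (fun h : R => h^-1 *: ((f \o shift (upd j t x)) (h *: evec j) - f (upd j t x))) by [].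
      apply/funext => h /=.
      have -> : h *: (1 : R) = h by exact: mulr1.
      by rewrite /F (addrC (h *: evec j)) upd_add (addrC t h).
    have FL s t : `|F s - F t| <= L' * `|s - t|.
      rewrite (le_trans (fL' _ _))// ler_wpM2l// (_ : upd j s x - upd j t x = (s - t) *: evec j) ?enorm_evec//.
      by apply/rowP => i; rewrite !mxE eqxx; case: eqP => _; rewrite ?mulr1 ?mulr0 ?subrr.
    pose U := (fun t : measurableTypeR R => upd j t x) @^-1` (~` A).
    have mU : measurable U.
      by rewrite -[U]setTI; apply: measurable_upd => //; exact: measurableC.
    rewrite (_ : (fun t => _) = (fun t => (\1_U t)%:E)); last by [].
    rewrite integral_indic// setIT.
    apply: (lipschitz_nonderivable_null FL mU) => t Ut dt; exact: Ut (dF t dt).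
by move: mu0; rewrite integral_indic ?setIT ?integral0//; exact: measurableC.
Qed.

Lemma reg_lipschitz : reg f (fun j => partial j f).
Proof.
split; first exact: lipschitz_tame.
- move=> j; split; first exact: measurable_partial lipschitz_continuous_row.
  by exists L', 0 => x; rewrite /expgrowth mul0r expR0 mulr1 partial_lipschitz_le.
- exists L', 0 => j x t _; rewrite /expgrowth mul0r expR0 mulr1 (le_trans (fL' _ _))//.
  by rewrite addrAC subrr add0r enorm_evec mulrC.
move=> j; have := ae_gauss (lipschitz_ae_derivable j).
by apply: filterS => x dx; exact: DeriveDef.
Qed.

End lipschitz_row.

Lemma lipschitz_enorm_coord {R : realType} {n : nat} (L : R) (f : 'I_n -> 'rV[R]_n -> R) i :
  lipschitz_enorm L (fun x => \row_(i < n) f i x) ->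
  forall x y, `|f i x - f i y| <= L * enorm (x - y).
Proof.
move=> fL x y; apply: le_trans (fL x y); rewrite /enorm -sqrtr_sqr ler_sqrt ?sqr_ge0//.
  by rewrite (bigD1 i)//= !mxE lerDl sumr_ge0// => k _; exact: sqr_ge0.
by apply: sumr_ge0 => k _; exact: sqr_ge0.
Qed.

Theorem theorem2p1 (R : realType) (n : nat) (d : measure_display)
    (Omega : measurableType d) (P : probability Omega R)
    (z : {RV P >-> 'rV[R]_n})
    (hz : forall A : set 'rV[R]_n, measurable A ->
       distribution P z A = gauss_row R n A)
    (f : 'I_n -> 'rV[R]_n -> R)
    (mf : forall i, measurable_fun [set: 'rV[R]_n] (f i))
    (f2 : forall i, ('E_P[(fun w => f i (z w) ^+ 2)%R] < +oo)%E) :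
  [/\ (* (i) *)
      (forall i, Cclass 2 (f i)) ->
      (forall i j, subexponential (partial j (f i))) ->
      (forall i j k, subexponential (partial k (partial j (f i)))) ->
      second_order_stein P z f (fun i j => partial j (f i)),
      (* (ii) *)
      forall L : R, lipschitz_enorm L (fun x => \row_(i < n) f i x) ->
      {ae lebesgue_row R n, forall x, forall i j,
         derivable (f i) x (delta_mx ord0 j)} /\
      second_order_stein P z f (fun i j => partial j (f i))
    & (* (iii) *)
      (forall i, gauss_sobolev (f i)) ->
      (exists D : 'I_n -> 'I_n -> 'rV[R]_n -> R,
         forall i j, weak_partial j (f i) (D i j)) /\
      (forall D : 'I_n -> 'I_n -> 'rV[R]_n -> R,
         (forall i j, weak_partial j (f i) (D i j)) ->
         second_order_stein P z f D)].
Proof.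
split.
- by move=> f2C fs _; apply: (second_order_stein_reg hz) => i; exact: reg_C2.
- move=> L /lipschitz_enorm_coord fL; split.
    by apply: filter_forall => i; apply: filter_forall => j; exact: lipschitz_ae_derivable (fL i) j.
  by apply: (second_order_stein_reg hz) => i; exact: reg_lipschitz (fL i).
- exact: second_order_stein_sobolev.
Qed.
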